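(* Suppose $U,V$ are additive countably determined cuts in ${}^*\mathbb N$ other than $\emptyset$ and ${}^*\mathbb N$. Then $\mathsf D_{{}^*\mathbb N}\le_{\mathrm B}\mathsf E_U$. In addition: (i) if both $U,V$ are countably cofinal or both are countably coinitial, then $\mathsf E_U$ and $\mathsf E_V$ are $\le_{\mathrm B}$-comparable, and $\mathsf E_U\le_{\mathrm B}\mathsf E_V\iff\mathsf E_U\le_{\mathrm{CD}}\mathsf E_V\iff U\preccurlyeq V$; in particular, if $U$ is slow then $\mathsf E_U\le_{\mathrm{CD}}\mathsf E_V$; (ii) if $U$ is countably cofinal and $V$ is countably coinitial, then $\mathsf E_V\not\le_{\mathrm{CD}}\mathsf E_U$ and $\mathsf E_U\not\le_{\mathrm B}\mathsf E_V$, while $\mathsf E_U\le_{\mathrm{CD}}\mathsf E_V$ holds iff $U$ is slow; (iii) $\mathsf E_U$ is not B-smooth, and $\mathsf E_U$ is CD-smooth if and only if $U$ is countably cofinal and slow; (iv) for any countable sequence $(U_n)_{n\in\mathbb N}$ of countably cofinal fast cuts there are countably cofinal fast cuts $U',V'$ with $\mathsf E_{U'}<_{\mathrm B}\mathsf E_{U_n}<_{\mathrm B}\mathsf E_{V'}$ for all $n$; and the same holds for countably coinitial fast cuts.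
   Context: Work in a fixed countably saturated nonstandard universe; ${}^*\mathbb N$ = hyperintegers, $\mathbb N$ = standard ones. Borel sets: the $\sigma$-algebra generated by internal sets. A set is countably determined (CD) if it equals $\bigcup_{f\in F}\bigcap_{m\in\mathbb N}X_{f\restriction m}$ for some $F\subseteq2^{\mathbb N}$ and internal $X_s$ ($s$ finite binary sequences) with $X_t\subseteq X_s$ for $s\subset t$; maps are Borel/CD if their graphs are. For equivalence relations $E$ on $X$, $F$ on $Y$: $E\le_{\mathrm B}F$ ($E\le_{\mathrm{CD}}F$) means there is a Borel (CD) map $\vartheta:X\to Y$ with $x\mathrel Ex'\iff\vartheta(x)\mathrel F\vartheta(x')$; $E<_{\mathrm B}F$ means $E\le_{\mathrm B}F$ and not $F\le_{\mathrm B}E$. $\mathsf D_A$ is the equality relation on $A$. $E$ is B-smooth (CD-smooth) if $E\le_{\mathrm B}\mathsf D_{{}^*\mathbb N}$ ($E\le_{\mathrm{CD}}\mathsf D_{{}^*\mathbb N}$). A cut is an initial segment of ${}^*\mathbb N$, additive if closed under $+$. For an additive cut $U$, the monadic equivalence relation $\mathsf E_U$ on ${}^*\mathbb N$ is $x\mathrel{\mathsf E_U}y\iff|x-y|\in U$. $U$ is countably cofinal if $U=\bigcup_n[0,a_n)$ for a strictly increasing $(a_n)$ in ${}^*\mathbb N$, countably coinitial if $U=\bigcap_n[0,a_n)$ for a strictly decreasing $(a_n)$. For $c\in{}^*\mathbb N$: $c\mathbb N=\bigcup_{n}[0,cn]$, $c/\mathbb N=\bigcap_{n\ge1}[0,c/n]$.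 An additive countably cofinal cut is slow if it equals $c\mathbb N$ for some $c\in{}^*\mathbb N$; an additive countably coinitial cut is slow if it equals $c/\mathbb N$ for some $c\in{}^*\mathbb N\setminus\mathbb N$; other additive countably cofinal/coinitial cuts are fast. For strictly increasing sequences $(a_n),(b_k)$ in ${}^*\mathbb N$: $(a_n)\preccurlyeq(b_k)$ iff $\forall k\,\exists n\,\forall n'>n\,\exists k'>k\,(a_{n'}-a_n\le b_{k'}-b_k)$. For strictly decreasing sequences: $(a_n)\preccurlyeq(b_k)$ iff $\forall k\,\exists n\,\forall n'>n\,\exists k'>k\,(a_n-a_{n'}\le b_k-b_{k'})$. For countably cofinal additive cuts, $U\preccurlyeq V$ iff there are strictly increasing $(a_n)\preccurlyeq(b_k)$ with $U=\bigcup_n[0,2^{a_n})$, $V=\bigcup_k[0,2^{b_k})$; for countably coinitial additive cuts, $U\preccurlyeq V$ iff there are strictly decreasing $(a_n)\preccurlyeq(b_k)$ with $U=\bigcap_n[0,2^{a_n})$, $V=\bigcap_k[0,2^{b_k})$.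
   Formalization: Clause (iii) is stated only for U ≠ {0}: the cut {0} is additive, countably determined, neither empty nor all of *ℕ, but E_{0} is equality on *ℕ, hence B-smooth and CD-smooth although {0} is not countably cofinal, so (iii) fails for it as written. *)

(* Defs.v *)
From mathcomp Require Import all_boot all_order all_classical.
From mathcomp Require Import measurable_structure.

Set Implicit Arguments.
Unset Strict Implicit.
Unset Printing Implicit Defensive.

Local Open Scope classical_set_scope.

(* A nonstandard universe is rendered in A. Robinson's type-theoretic form: an
   elementary embedding of the full finite-type structure over the natural
   numbers (pairs, sets, sets of sets, ...) into another structure with the same
   sorts.  The elements of sort [Pow t] on the nonstandard side are (codes of)
   the internal sets of objects of sort [t]. *)

Inductive typ : Type :=
| Nat
| Prod of typ & typ
| Pow of typ.

Record structure : Type := Structure {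
  car : typ -> Type;
  pr : forall s t, car s -> car t -> car (Prod s t);
  isin : forall t, car t -> car (Pow t) -> Prop }.

Fixpoint std (t : typ) : Type :=
  match t with
  | Nat => nat
  | Prod s t => (std s * std t)%type
  | Pow t => set (std t)
  end.

Definition full : structure :=
  @Structure std (fun s t x y => (x, y)) (fun t x A => A x).

(* Many-sorted first-order formulas, with de Bruijn variables: a formula over
   the context [G] has one free variable for each entry of [G]. *)

Inductive var : seq typ -> typ -> Type :=
| V0 G t : var (t :: G) t
| VS G s t : var G t -> var (s :: G) t.

Inductive term (G : seq typ) : typ -> Type :=
| TVar t : var G t -> term G t
| TPair s t : term G s -> term G t -> term G (Prod s t).

Inductive form : seq typ -> Type :=
| FEq G t : term G t -> term G t -> form G
| FMem G t : term G t -> term G (Pow t) -> form G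
| FNot G : form G -> form G
| FAnd G : form G -> form G -> form G
| FOr G : form G -> form G -> form G
| FImp G : form G -> form G -> form G
| FAll G t : form (t :: G) -> form G
| FEx G t : form (t :: G) -> form G.

Fixpoint env (M : structure) (G : seq typ) : Type :=
  if G is t :: G' then (car M t * env M G')%type else unit.

Fixpoint lookup (M : structure) G t (v : var G t) : env M G -> car M t :=
  match v in var G t return env M G -> car M t with
  | V0 _ _ => fun e => e.1
  | VS _ _ _ v' => fun e => lookup v' e.2
  end.

Fixpoint eval (M : structure) G t (a : term G t) (e : env M G) : car M t :=
  match a in term _ t return car M t with
  | TVar _ v => lookup v e
  | TPair _ _ a b => pr (eval a e) (eval b e)
  end.

Fixpoint sat (M : structure) G (phi : form G) : env M G -> Prop :=
  match phi in form G return env M G -> Prop with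
  | FEq _ _ a b => fun e => eval a e = eval b e
  | FMem _ _ a b => fun e => isin (eval a e) (eval b e)
  | FNot _ p => fun e => ~ sat p e
  | FAnd _ p q => fun e => sat p e /\ sat q e
  | FOr _ p q => fun e => sat p e \/ sat q e
  | FImp _ p q => fun e => sat p e -> sat q e
  | FAll _ t p => fun e => forall x : car M t, sat p ((x, e) : env M (t :: _))
  | FEx _ t p => fun e => exists x : car M t, sat p ((x, e) : env M (t :: _))
  end.

Fixpoint map_env (M N : structure) (f : forall t, car M t -> car N t) G :
    env M G -> env N G :=
  match G return env M G -> env N G with
  | [::] => fun _ => tt
  | t :: G' => fun e => (f t e.1, map_env f e.2)
  end.

(* Extensionality of internal sets and bijectivity of [pr] are instances of
   transfer; properness of the extension follows from saturation. *)
Record universe : Type := Universe {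
  ustruct :> structure;
  star : forall t : typ, std t -> car ustruct t;
  transfer : forall G (phi : form G) (e : env full G),
    sat phi e <-> sat phi (@map_env full ustruct star G e);
  saturation : forall t (A : nat -> car ustruct (Pow t)),
    (forall n, exists x, forall i, i <= n -> isin x (A i)) ->
    exists x, forall i, isin x (A i) }.

Arguments star M {t} : rename.

Section Star.
Variable M : universe.

Lemma star_fun_exists s t (f : std s -> std t) (x : car M s) :
  exists y : car M t,
    isin (pr x y) (star M ([set p | p.2 = f p.1] : std (Pow (Prod s t)))).
Proof.
pose S := ([set p | p.2 = f p.1] : std (Pow (Prod s t))).
pose G := [:: Pow (Prod s t)].
pose phi : form G := FAll (FEx (FMem
  (TPair (TVar (VS t (V0 G s))) (TVar (V0 (s :: G) t)))
  (TVar (VS t (VS s (V0 [::] (Pow (Prod s t)))))))).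
have [+ _] := transfer M phi ((S, tt) : env full G).
by apply => a; exists (f a).
Qed.

Definition star_fun s t (f : std s -> std t) (x : car M s) : car M t :=
  projT1 (cid (star_fun_exists f x)).

Definition hyperN : Type := car M Nat.

Definition hnat (n : nat) : hyperN := star M (n : std Nat).

Definition hop (f : nat -> nat -> nat) (x y : hyperN) : hyperN :=
  @star_fun (Prod Nat Nat) Nat (fun p => f p.1 p.2) (pr x y).

Definition hrel (r : rel nat) (x y : hyperN) : Prop :=
  isin (pr x y) (star M ([set p | r p.1 p.2] : std (Pow (Prod Nat Nat)))).

Definition hadd := hop addn.
Definition hsub := hop subn. (* truncated *)
Definition hmul := hop muln.
Definition hdiv := hop divn. (* floor of the quotient *)
Definition hdist := hop (fun m n => (m - n) + (n - m)).
Definition hpow2 : hyperN -> hyperN := @star_fun Nat Nat (fun n => 2 ^ n).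
Definition hle := hrel leq.
Definition hlt := hrel ltn.

Definition ext t (A : car M (Pow t)) : set (car M t) := [set x | isin x A].

Definition internal t : set (set (car M t)) := range (@ext t).

Definition borel t (A : set (car M t)) : Prop := <<s @internal t >> A.

Definition countably_determined t (A : set (car M t)) : Prop :=
  exists (F : set (nat -> bool)) (X : seq bool -> set (car M t)),
    [/\ forall u, internal (X u),
        forall u v, prefix u v -> X v `<=` X u &
        A = \bigcup_(f in F) \bigcap_m X (mkseq f m)].

Definition graph s t (f : car M s -> car M t) : set (car M (Prod s t)) :=
  [set z | exists x, z = pr x (f x)].

Definition reduction S T (E : S -> S -> Prop) (F : T -> T -> Prop)
  (f : S -> T) : Prop := forall x y, E x y <-> F (f x) (f y).

Definition borel_le s t (E : car M s -> car M s -> Prop)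
    (F : car M t -> car M t -> Prop) : Prop :=
  exists2 f : car M s -> car M t, borel (graph f) & reduction E F f.

Definition cd_le s t (E : car M s -> car M s -> Prop)
    (F : car M t -> car M t -> Prop) : Prop :=
  exists2 f : car M s -> car M t,
    countably_determined (graph f) & reduction E F f.

Definition borel_lt s t (E : car M s -> car M s -> Prop)
    (F : car M t -> car M t -> Prop) : Prop :=
  borel_le E F /\ ~ borel_le F E.

Definition eqN : car M Nat -> car M Nat -> Prop := fun x y => x = y.

Definition borel_smooth t (E : car M t -> car M t -> Prop) := borel_le E eqN.

Definition cd_smooth t (E : car M t -> car M t -> Prop) := cd_le E eqN.

Definition cut (U : set hyperN) : Prop :=
  forall x y, U x -> hle y x -> U y.

Definition additive_cut (U : set hyperN) : Prop :=
  cut U /\ forall x y, U x -> U y -> U (hadd x y).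

Definition monadic (U : set hyperN) : car M Nat -> car M Nat -> Prop :=
  fun x y => U (hdist x y).

Definition below (a : hyperN) : set hyperN := [set x | hlt x a].

Definition upto (a : hyperN) : set hyperN := [set x | hle x a].

Definition increasing (a : nat -> hyperN) : Prop :=
  forall m n, (m < n)%N -> hlt (a m) (a n).

Definition decreasing (a : nat -> hyperN) : Prop :=
  forall m n, (m < n)%N -> hlt (a n) (a m).

Definition countably_cofinal (U : set hyperN) : Prop :=
  exists2 a, increasing a & U = \bigcup_n below (a n).

Definition countably_coinitial (U : set hyperN) : Prop :=
  exists2 a, decreasing a & U = \bigcap_n below (a n).

Definition mulN (c : hyperN) : set hyperN :=
  \bigcup_n upto (hmul c (hnat n)).

Definition divN (c : hyperN) : set hyperN :=
  \bigcap_(n in [set n | (1 <= n)%N]) upto (hdiv c (hnat n)).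

Definition slow (U : set hyperN) : Prop :=
  additive_cut U /\
  ((countably_cofinal U /\ exists c, U = mulN c) \/
   (countably_coinitial U /\ exists2 c, ~ range hnat c & U = divN c)).

Definition fast (U : set hyperN) : Prop :=
  [/\ additive_cut U, countably_cofinal U \/ countably_coinitial U & ~ slow U].

Definition inc_prec (a b : nat -> hyperN) : Prop :=
  forall k, exists n, forall n', (n < n')%N ->
    exists2 k', (k < k')%N & hle (hsub (a n') (a n)) (hsub (b k') (b k)).

Definition dec_prec (a b : nat -> hyperN) : Prop :=
  forall k, exists n, forall n', (n < n')%N ->
    exists2 k', (k < k')%N & hle (hsub (a n) (a n')) (hsub (b k) (b k')).

Definition cofinal_prec (U V : set hyperN) : Prop :=
  exists a b, [/\ increasing a, increasing b, inc_prec a b,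
    U = \bigcup_n below (hpow2 (a n)) & V = \bigcup_k below (hpow2 (b k))].

Definition coinitial_prec (U V : set hyperN) : Prop :=
  exists a b, [/\ decreasing a, decreasing b, dec_prec a b,
    U = \bigcap_n below (hpow2 (a n)) & V = \bigcap_k below (hpow2 (b k))].

(* The disjuncts are mutually exclusive: no cut is both countably cofinal and
   countably coinitial, by saturation. *)
Definition cut_prec (U V : set hyperN) : Prop :=
  cofinal_prec U V \/ coinitial_prec U V.

End Star.

Arguments hnat M n : clear implicits.
Arguments eqN M : clear implicits.

(* Main.v *)
(* A countably cofinal additive cut is the union of the intervals [0, 2^(a_n)) for an increasing
   sequence (a_n), and a countably coinitial one is their intersection for a decreasing sequence;
   everything is decided by comparing the gaps of such sequences of exponents.

   Positive part. If the gaps of (b_k) dominate those of (a_n), an internal map moves each block of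
   binary digits between consecutive exponents a_n to a block between consecutive exponents b_k.
   It reduces eventual (or complete) agreement of digits to E_V, and that relation agrees with E_U
   once each class containing a number divisible by all (or by some) 2^(a_n) has been moved to
   that number, which is a Borel operation. If U = cN, a CD transversal of finite differences is
   obtained by choosing one residue system modulo the powers of 2 in every orbit of the integers.

   Negative part. The graph of a CD map is a union of sets /\_m X_(f|m). If the map is a reduction,
   saturation makes an internal X_(f|m) satisfy one inequality between distances in the domain and
   in the range in each direction, and counting then shows that the domain of X_(f|m) has density
   below every 2^-j when the gaps are too large. Countably many such sets cannot cover an
   interval. A reduction from a coinitial to a cofinal cut is excluded in the same way, by nested
   intervals instead of counting. A Borel map is moreover Loeb measurable on countably many pieces
   where it is internal, which excludes Borel reductions of E_(cN) to a coinitial cut. *)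

Require Import Defs.
From mathcomp Require Import all_boot all_order all_classical.
From mathcomp Require Import zify measurable_structure.

Set Implicit Arguments.
Unset Strict Implicit.
Unset Printing Implicit Defensive.

Local Open Scope classical_set_scope.

(** * Transfer and internal definability *)

(** All comparisons of exponents lose a bounded amount: rounding, carries and the pigeonhole
    principle each cost a fixed number of binary digits. Strict monotonicity pays for this. For
    increasing b, the term b_(k+j) is at least b_k + j, so a strict failure of the gap inequality at
    all later indices is a deficit exceeding every standard number, which makes a set null; a strict
    success leaves the one spare digit that stops carries.

    The index set F of a countably determined map may be uncountable, so its branches cannot be
    discarded one at a time. What is needed of a branch shows at some finite level, by saturation,
    and there are only countably many finite binary sequences. The internal set at that level may be
    larger than the part of the graph that it approximates and need not be the graph of a function;
    hence the arguments use distance estimates on pairs of its points.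

    The finite-distance transversal is of Vitali type: the choice made there is compatible with
    countable determinacy, while a Borel graph has Loeb measurable pieces, and sparse measurable
    pieces are null. *)

Definition tup (G : seq typ) : typ := foldr Prod Nat G.

(** A context is coded by a single sort of nested pairs, so that a predicate in several variables
    becomes one standard set to which [star] applies. The number [z] fills the empty context. *)
Fixpoint enc (M : structure) (z : car M Nat) (G : seq typ) :
    env M G -> car M (tup G) :=
  match G return env M G -> car M (tup G) with
  | [::] => fun _ => z
  | t :: G' => fun e => pr e.1 (enc z e.2)
  end.

Fixpoint dec (G : seq typ) : std (tup G) -> env full G :=
  match G return std (tup G) -> env full G with
  | [::] => fun _ => tt
  | t :: G' => fun z => (z.1, dec z.2)
  end.

Section Lift.
Variable M : universe.
Implicit Types (G : seq typ) (s t : typ).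

Notation encM := (@enc M (hnat M 0) _).

(* [Q] is the nonstandard interpretation of the standard predicate [P]. *)
Definition Lft G (P : env full G -> Prop) (Q : env M G -> Prop) : Prop :=
  forall e, Q e <->
    isin (encM e) (star M ([set z | P (dec z)] : std (Pow (tup G)))).

Definition fgraph G t (f : env full G -> std t) : std (Pow (Prod t (tup G))) :=
  [set z | z.1 = f (dec z.2)].

Definition LftT G t (f : env full G -> std t) (g : env M G -> car M t) : Prop :=
  forall e, isin (pr (g e) (encM e)) (star M (fgraph f)).

Lemma lft_transfer (P : env full [::] -> Prop) (Q : env M [::] -> Prop) :
  Lft P Q -> P tt -> Q tt.
Proof.
move=> /(_ tt) PQ HP; apply/PQ.
pose S : std (Pow Nat) := [set z | P (dec (z : std (tup [::])))].
pose phi : form [:: Nat; Pow Nat] :=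
  FMem (TVar (V0 _ _)) (TVar (VS _ (V0 _ _))).
by have [+ _] := transfer M phi ((0, (S, tt)) : env full [:: Nat; Pow Nat]); apply.
Qed.

Notation v0 := (TVar (V0 _ _)).
Notation v1 := (TVar (VS _ (V0 _ _))).
Notation v2 := (TVar (VS _ (VS _ (V0 _ _)))).
Notation v3 := (TVar (VS _ (VS _ (VS _ (V0 _ _))))).
Notation v4 := (TVar (VS _ (VS _ (VS _ (VS _ (V0 _ _)))))).
Notation v5 := (TVar (VS _ (VS _ (VS _ (VS _ (VS _ (V0 _ _))))))).

(** Each closure rule transfers one fixed sentence whose parameters are the standard sets attached
    to the formulas: over the standard structure it holds by definition of these sets, and over [M]
    it gives the rule. *)
Lemma lft_and G (P P' : env full G -> Prop) (Q Q' : env M G -> Prop) :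
  Lft P Q -> Lft P' Q' -> Lft (fun e => P e /\ P' e) (fun e => Q e /\ Q' e).
Proof.
move=> h h' e.
pose T := tup G; pose H := [:: Pow T; Pow T; Pow T].
pose phi : form H :=
  FAll (t := T) (FAnd (FImp (FAnd (FMem v0 v1) (FMem v0 v2)) (FMem v0 v3))
     (FImp (FMem v0 v3) (FAnd (FMem v0 v1) (FMem v0 v2)))).
have [+ _] := transfer M phi (([set z | P (dec z)], ([set z | P' (dec z)],
   ([set z | P (dec z) /\ P' (dec z)], tt))) : env full H).
by move=> /(_ (fun z => conj id id)) /(_ (encM e)) /= []; rewrite (h e) (h' e).
Qed.

Lemma lft_or G (P P' : env full G -> Prop) (Q Q' : env M G -> Prop) :
  Lft P Q -> Lft P' Q' -> Lft (fun e => P e \/ P' e) (fun e => Q e \/ Q' e).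
Proof.
move=> h h' e.
pose T := tup G; pose H := [:: Pow T; Pow T; Pow T].
pose phi : form H :=
  FAll (t := T) (FAnd (FImp (FOr (FMem v0 v1) (FMem v0 v2)) (FMem v0 v3))
     (FImp (FMem v0 v3) (FOr (FMem v0 v1) (FMem v0 v2)))).
have [+ _] := transfer M phi (([set z | P (dec z)], ([set z | P' (dec z)],
   ([set z | P (dec z) \/ P' (dec z)], tt))) : env full H).
by move=> /(_ (fun z => conj id id)) /(_ (encM e)) /= []; rewrite (h e) (h' e).
Qed.

Lemma lft_imp G (P P' : env full G -> Prop) (Q Q' : env M G -> Prop) :
  Lft P Q -> Lft P' Q' -> Lft (fun e => P e -> P' e) (fun e => Q e -> Q' e).
Proof.
move=> h h' e.
pose T := tup G; pose H := [:: Pow T; Pow T; Pow T].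
pose phi : form H :=
  FAll (t := T) (FAnd (FImp (FImp (FMem v0 v1) (FMem v0 v2)) (FMem v0 v3))
     (FImp (FMem v0 v3) (FImp (FMem v0 v1) (FMem v0 v2)))).
have [+ _] := transfer M phi (([set z | P (dec z)], ([set z | P' (dec z)],
   ([set z | P (dec z) -> P' (dec z)], tt))) : env full H).
by move=> /(_ (fun z => conj id id)) /(_ (encM e)) /= []; rewrite (h e) (h' e).
Qed.

Lemma lft_not G (P : env full G -> Prop) (Q : env M G -> Prop) :
  Lft P Q -> Lft (fun e => ~ P e) (fun e => ~ Q e).
Proof.
move=> h e.
pose T := tup G; pose H := [:: Pow T; Pow T].
pose phi : form H :=
  FAll (t := T) (FAnd (FImp (FNot (FMem v0 v1)) (FMem v0 v2))
     (FImp (FMem v0 v2) (FNot (FMem v0 v1)))).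
have [+ _] := transfer M phi (([set z | P (dec z)],
   ([set z | ~ P (dec z)], tt)) : env full H).
by move=> /(_ (fun z => conj id id)) /(_ (encM e)) /= [h1 h2]; split=> [/h|/h2 nP /h] //.
Qed.

Lemma lft_false G : Lft (fun _ : env full G => False) (fun _ => False).
Proof.
move=> e; pose T := tup G; pose phi : form [:: Pow T] := FAll (t := T) (FNot (FMem v0 v1)).
have [+ _] := transfer M phi ((set0, tt) : env full [:: Pow T]).
by move=> /(_ (fun z => id)) /(_ (encM e)).
Qed.

Lemma lft_iff G (P P' : env full G -> Prop) (Q Q' : env M G -> Prop) :
  Lft P Q -> Lft P' Q' -> Lft (fun e => P e <-> P' e) (fun e => Q e <-> Q' e).
Proof. move=> h h'; exact: (lft_and (lft_imp h h') (lft_imp h' h)). Qed.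

Lemma lft_all G t (P : env full (t :: G) -> Prop) (Q : car M t -> env M G -> Prop) :
  Lft P (fun e : env M (t :: G) => Q e.1 e.2) ->
  Lft (fun e => forall y : std t, P (y, e)) (fun e => forall y : car M t, Q y e).
Proof.
move=> h e.
pose T := tup G; pose H := [:: Pow (Prod t T); Pow T].
pose phi : form H :=
  FAll (t := T) (FAnd (FImp (FAll (t := t) (FMem (TPair v0 v1) v2)) (FMem v0 v2))
     (FImp (FMem v0 v2) (FAll (t := t) (FMem (TPair v0 v1) v2)))).
have [+ _] := transfer M phi (([set z | P (z.1, dec z.2)],
   ([set z | forall y : std t, P (y, dec z)], tt)) : env full H).
move=> /(_ (fun z => conj id id)) /(_ (encM e)) /= [h1 h2]; split => [Q1|/h2 Q1].
  by apply: h1 => y; exact: (proj1 (h (y, e)) (Q1 y)).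
by move=> y; exact: (proj2 (h (y, e)) (Q1 y)).
Qed.

Lemma lft_ex G t (P : env full (t :: G) -> Prop) (Q : car M t -> env M G -> Prop) :
  Lft P (fun e : env M (t :: G) => Q e.1 e.2) ->
  Lft (fun e => exists y : std t, P (y, e)) (fun e => exists y : car M t, Q y e).
Proof.
move=> h e.
pose T := tup G; pose H := [:: Pow (Prod t T); Pow T].
pose phi : form H :=
  FAll (t := T) (FAnd (FImp (FEx (t := t) (FMem (TPair v0 v1) v2)) (FMem v0 v2))
     (FImp (FMem v0 v2) (FEx (t := t) (FMem (TPair v0 v1) v2)))).
have [+ _] := transfer M phi (([set z | P (z.1, dec z.2)],
   ([set z | exists y : std t, P (y, dec z)], tt)) : env full H).
move=> /(_ (fun z => conj id id)) /(_ (encM e)) /= [h1 h2]; split => [[y Q1]|/h2 [y Q1]].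
  by apply: h1; exists y; exact: (proj1 (h (y, e)) Q1).
by exists y; exact: (proj2 (h (y, e)) Q1).
Qed.

Lemma lftT_const G t (c : std t) : LftT (fun _ : env full G => c) (fun _ => star M c).
Proof.
move=> e; pose T := tup G; pose H := [:: t; Pow (Prod t T)].
pose phi : form H := FAll (t := T) (FMem (TPair v1 v0) v2).
have [+ _] := transfer M phi ((c, (fgraph (fun _ : env full G => c), tt)) : env full H).
by move=> /(_ (fun z => erefl)) /(_ (encM e)).
Qed.

Lemma lftT_var G t (v : var G t) :
  LftT (lookup v : env full G -> _) (lookup v : env M G -> _).
Proof.
elim: v => {t G} [G t|G s t v IH] e.
  pose T := tup G; pose H := [:: Pow (Prod t (Prod t T))].
  pose phi : form H := FAll (t := T) (FAll (t := t) (FMem (TPair v0 (TPair v0 v1)) v2)).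
  have [+ _] := transfer M phi
    ((fgraph (lookup (V0 G t) : env full (t :: G) -> std t), tt) : env full H).
  by move=> /(_ (fun z y => erefl)) /(_ (encM e.2) e.1).
pose T := tup G; pose H := [:: Pow (Prod t T); Pow (Prod t (Prod s T))].
pose phi : form H := FAll (t := T) (FAll (t := t) (FAll (t := s)
  (FImp (FMem (TPair v1 v2) v3) (FMem (TPair v1 (TPair v0 v2)) v4)))).
have [+ _] := transfer M phi ((fgraph (lookup v : env full G -> std t),
   (fgraph (lookup (VS s v) : env full (s :: G) -> std t), tt)) : env full H).
by move=> /(_ (fun z y x => id)) /(_ (encM e.2) (lookup v e.2) e.1) /=; apply; apply: IH.
Qed.

Lemma lftT_pair G s t (f : env full G -> std s) (f' : env full G -> std t) g g' :
  LftT f g -> LftT f' g' ->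
  LftT (fun e => (f e, f' e) : std (Prod s t)) (fun e => pr (g e) (g' e)).
Proof.
move=> h h' e; pose T := tup G.
pose H := [:: Pow (Prod s T); Pow (Prod t T); Pow (Prod (Prod s t) T)].
pose phi : form H := FAll (t := T) (FAll (t := s) (FAll (t := t)
  (FImp (FMem (TPair v1 v2) v3) (FImp (FMem (TPair v0 v2) v4)
     (FMem (TPair (TPair v1 v0) v2) v5))))).
have [+ _] := transfer M phi ((fgraph f, (fgraph f',
  (fgraph (fun e => (f e, f' e) : std (Prod s t)), tt))) : env full H).
move=> /(_ _) H'; apply: (H' _ (encM e) (g e) (g' e) (h e) (h' e)).
by move=> z x y; rewrite /fgraph /= => -> ->.
Qed.

Lemma star_funP s t (f : std s -> std t) x :
  isin (pr x (star_fun f x)) (star M ([set p | p.2 = f p.1] : std (Pow (Prod s t)))).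
Proof. exact: projT2 (cid (star_fun_exists f x)). Qed.

Lemma lftT_app G s t (k : std s -> std t) (f : env full G -> std s) g :
  LftT f g -> LftT (fun e => k (f e)) (fun e => star_fun k (g e)).
Proof.
move=> h e; pose T := tup G.
pose H := [:: Pow (Prod s T); Pow (Prod s t); Pow (Prod t T)].
pose phi : form H := FAll (t := T) (FAll (t := s) (FAll (t := t)
  (FImp (FMem (TPair v1 v2) v3) (FImp (FMem (TPair v1 v0) v4)
     (FMem (TPair v0 v2) v5))))).
have [+ _] := transfer M phi ((fgraph f, ([set p | p.2 = k p.1],
  (fgraph (fun e => k (f e)), tt))) : env full H).
move=> /(_ _) H'; apply: (H' _ (encM e) (g e) _ (h e) (star_funP _ _)).
by move=> z x y; rewrite /fgraph /= => -> ->.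
Qed.

Lemma lft_mem G t (f : env full G -> std t) (A : env full G -> std (Pow t)) g B :
  LftT f g -> LftT A B -> Lft (fun e => A e (f e)) (fun e => isin (g e) (B e)).
Proof.
move=> h h' e; pose T := tup G.
pose H := [:: Pow (Prod t T); Pow (Prod (Pow t) T); Pow T].
pose phi : form H := FAll (t := T) (FAll (t := t) (FAll (t := Pow t)
  (FImp (FMem (TPair v1 v2) v3) (FImp (FMem (TPair v0 v2) v4)
    (FAnd (FImp (FMem v1 v0) (FMem v2 v5)) (FImp (FMem v2 v5) (FMem v1 v0))))))).
have [+ _] := transfer M phi ((fgraph f, (fgraph A,
  ([set z | A (dec z) (f (dec z))], tt))) : env full H).
move=> /(_ _) H'; apply: (H' _ (encM e) (g e) (B e) (h e) (h' e)).
by move=> z x y; rewrite /fgraph /= => -> ->.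
Qed.

Lemma lft_eq G t (f f' : env full G -> std t) g g' :
  LftT f g -> LftT f' g' -> Lft (fun e => f e = f' e) (fun e => g e = g' e).
Proof.
move=> h h' e; pose T := tup G.
pose H := [:: Pow (Prod t T); Pow (Prod t T); Pow T].
pose phi : form H := FAll (t := T) (FAll (t := t) (FAll (t := t)
  (FImp (FMem (TPair v1 v2) v3) (FImp (FMem (TPair v0 v2) v4)
    (FAnd (FImp (FEq v1 v0) (FMem v2 v5)) (FImp (FMem v2 v5) (FEq v1 v0))))))).
have [+ _] := transfer M phi ((fgraph f, (fgraph f',
  ([set z | f (dec z) = f' (dec z)], tt))) : env full H).
move=> /(_ _) H'; apply: (H' _ (encM e) (g e) (g' e) (h e) (h' e)).
by move=> z x y; rewrite /fgraph /= => -> ->.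
Qed.

Lemma lft_rel G (r : rel nat) (f f' : env full G -> std Nat) g g' :
  LftT f g -> LftT f' g' -> Lft (fun e => r (f e) (f' e)) (fun e => hrel r (g e) (g' e)).
Proof.
move=> h h'; apply: (@lft_mem _ (Prod Nat Nat) (fun e => (f e, f' e)) (fun _ => [set p | r p.1 p.2])).
  exact: lftT_pair.
exact: lftT_const.
Qed.

Lemma lft_lt G (f f' : env full G -> std Nat) g g' :
  LftT f g -> LftT f' g' -> Lft (fun e => f e < f' e) (fun e => hlt (g e) (g' e)).
Proof. exact: lft_rel. Qed.

Lemma lftT_op G (k : nat -> nat -> nat) (f f' : env full G -> std Nat) g g' :
  LftT f g -> LftT f' g' ->
  LftT (fun e => k (f e) (f' e) : std Nat) (fun e => hop k (g e) (g' e)).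
Proof.
move=> h h'.
by apply: (@lftT_app _ (Prod Nat Nat) Nat (fun p => k p.1 p.2) (fun e => (f e, f' e))); apply: lftT_pair.
Qed.

End Lift.

Ltac lift_var v G :=
  lazymatch G with
  | _ :: ?G' =>
      first [ exact (lftT_var v) | let w := uconstr:(VS _ v) in lift_var w G' ]
  end.

Ltac lift_term :=
  lazymatch goal with
  | |- LftT _ (fun e => hnat _ ?n) => exact (@lftT_const _ _ Nat n)
  | |- LftT _ (fun e => @star _ ?t ?c) => exact (@lftT_const _ _ t c)
  | |- LftT _ (fun e => pr (@?a e) (@?b e)) =>
      eapply (@lftT_pair _ _ _ _ _ _ a b); [lift_term | lift_term]
  | |- LftT _ (fun e => @hop _ ?k (@?a e) (@?b e)) =>
      eapply (@lftT_op _ _ k _ _ a b); [lift_term | lift_term]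
  | |- LftT _ (fun e => @hadd _ (@?a e) (@?b e)) =>
      eapply (@lftT_op _ _ addn _ _ a b); [lift_term | lift_term]
  | |- LftT _ (fun e => @hsub _ (@?a e) (@?b e)) =>
      eapply (@lftT_op _ _ subn _ _ a b); [lift_term | lift_term]
  | |- LftT _ (fun e => @hmul _ (@?a e) (@?b e)) =>
      eapply (@lftT_op _ _ muln _ _ a b); [lift_term | lift_term]
  | |- LftT _ (fun e => @hdiv _ (@?a e) (@?b e)) =>
      eapply (@lftT_op _ _ divn _ _ a b); [lift_term | lift_term]
  | |- LftT _ (fun e => @hdist _ (@?a e) (@?b e)) =>
      eapply (@lftT_op _ _ (fun m n => (m - n) + (n - m)) _ _ a b); [lift_term | lift_term]
  | |- LftT _ (fun e => @hpow2 _ (@?a e)) =>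
      eapply (@lftT_app _ _ Nat Nat (fun n => 2 ^ n) _ a); lift_term
  | |- LftT _ (fun e => @star_fun _ ?s ?t ?k (@?a e)) =>
      eapply (@lftT_app _ _ s t k _ a); lift_term
  | |- @LftT _ (?t :: ?G) _ _ _ =>
      let v := uconstr:(V0 _ _) in lift_var v (t :: G)
  end.

(* Given a closed formula [Q] over [M], [lift_form] finds the standard [P] with [Lft P Q]. *)
Ltac lift_form :=
  lazymatch goal with
  | |- Lft _ (fun _ => False) => exact (@lft_false _ _)
  | |- Lft _ (fun e => (@?A e) /\ (@?B e)) =>
      eapply (@lft_and _ _ _ _ A B); [lift_form | lift_form]
  | |- Lft _ (fun e => (@?A e) \/ (@?B e)) =>
      eapply (@lft_or _ _ _ _ A B); [lift_form | lift_form]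
  | |- Lft _ (fun e => ~ (@?A e)) => eapply (@lft_not _ _ _ A); lift_form
  | |- Lft _ (fun e => (@?A e) <-> (@?B e)) =>
      eapply (@lft_iff _ _ _ _ A B); [lift_form | lift_form]
  | |- Lft _ (fun e => (@?A e) -> (@?B e)) =>
      eapply (@lft_imp _ _ _ _ A B); [lift_form | lift_form]
  | |- Lft _ (fun e => forall y : ?T, @?B e y) =>
      eapply (@lft_all _ _ _ _ (fun y e => B e y)); cbv beta; lift_form
  | |- Lft _ (fun e => exists y : ?T, @?B e y) =>
      eapply (@lft_ex _ _ _ _ (fun y e => B e y)); cbv beta; lift_form
  | |- Lft _ (fun e => @hle _ (@?a e) (@?b e)) =>
      eapply (@lft_rel _ _ leq _ _ a b); [lift_term | lift_term]
  | |- Lft _ (fun e => @hlt _ (@?a e) (@?b e)) =>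
      eapply (@lft_lt _ _ _ _ a b); [lift_term | lift_term]
  | |- Lft _ (fun e => @hrel _ ?r (@?a e) (@?b e)) =>
      eapply (@lft_rel _ _ r _ _ a b); [lift_term | lift_term]
  | |- Lft _ (fun e => isin (@?a e) (@?b e)) =>
      eapply (@lft_mem _ _ _ _ _ a b); [lift_term | lift_term]
  | |- Lft _ (fun e => @eq _ (@?a e) (@?b e)) =>
      eapply (@lft_eq _ _ _ _ _ a b); [lift_term | lift_term]
  end.

(** The standard statement starts as an existential variable; the syntactic lifting fills it in, and
    only this statement remains to be proved. Nonstandard parameters have to be generalised
    beforehand, since the lifted formula is closed. *)
Ltac htransfer :=
  lazymatch goal with
  | |- ?G =>
    let H := fresh in
    eenough (H : _); [ refine (@lft_transfer _ _ (fun _ => G) _ H); lift_form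
    | cbn [lookup fst snd env full car pr isin std] ]
  end.

(** * Internal sets and functions with parameters *)

Section Internal.
Variable M : universe.
Implicit Types (G : seq typ) (s t : typ).

Notation encM := (@enc M (hnat M 0) _).

(* [Q] is internal, as a set of tuples. *)
Definition Int G (Q : env M G -> Prop) : Prop :=
  exists A : car M (Pow (tup G)), forall e, Q e <-> isin (encM e) A.

Definition IntT G t (g : env M G -> car M t) : Prop :=
  exists A : car M (Pow (Prod t (tup G))),
    forall y e, y = g e <-> isin (pr y (encM e)) A.

Definition internal_fun s t (f : car M s -> car M t) : Prop :=
  exists A : car M (Pow (Prod t s)), forall y x, y = f x <-> isin (pr y x) A.

(** Unlike [Lft], [Int] permits nonstandard parameters; closure under a connective is a transferred
    comprehension statement that quantifies over all internal sets. *)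
Lemma int_and G (Q R : env M G -> Prop) : Int Q -> Int R -> Int (fun e => Q e /\ R e).
Proof.
case=> A HA [B HB].
have : forall A B : car M (Pow (tup G)), exists C : car M (Pow (tup G)),
    forall z, isin z C <-> isin z A /\ isin z B.
  by htransfer => A' B'; exists (A' `&` B').
by move=> /(_ A B) [C HC]; exists C => e; rewrite HA HB HC.
Qed.

Lemma int_or G (Q R : env M G -> Prop) : Int Q -> Int R -> Int (fun e => Q e \/ R e).
Proof.
case=> A HA [B HB].
have : forall A B : car M (Pow (tup G)), exists C : car M (Pow (tup G)),
    forall z, isin z C <-> isin z A \/ isin z B.
  by htransfer => A' B'; exists (A' `|` B').
by move=> /(_ A B) [C HC]; exists C => e; rewrite HA HB HC.
Qed.

Lemma int_not G (Q : env M G -> Prop) : Int Q -> Int (fun e => ~ Q e).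
Proof.
case=> A HA.
have : forall A : car M (Pow (tup G)), exists C : car M (Pow (tup G)),
    forall z, isin z C <-> ~ isin z A.
  by htransfer => A'; exists (~` A').
by move=> /(_ A) [C HC]; exists C => e; rewrite HA HC.
Qed.

Lemma int_imp G (Q R : env M G -> Prop) : Int Q -> Int R -> Int (fun e => Q e -> R e).
Proof.
case=> A HA [B HB].
have : forall A B : car M (Pow (tup G)), exists C : car M (Pow (tup G)),
    forall z, isin z C <-> (isin z A -> isin z B).
  by htransfer => A' B'; exists [set z | A' z -> B' z].
by move=> /(_ A B) [C HC]; exists C => e; rewrite HA HB HC.
Qed.

Lemma int_iff G (Q R : env M G -> Prop) : Int Q -> Int R -> Int (fun e => Q e <-> R e).
Proof. by move=> h h'; exact: (int_and (int_imp h h') (int_imp h' h)). Qed.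

Lemma int_all G t (Q : car M t -> env M G -> Prop) :
  Int (fun e : env M (t :: G) => Q e.1 e.2) ->
  Int (fun e => forall y, Q y e).
Proof.
case=> A HA.
have : forall A : car M (Pow (Prod t (tup G))), exists C : car M (Pow (tup G)),
    forall z, isin z C <-> forall y, isin (pr y z) A.
  by htransfer => A'; exists [set z | forall y, A' (y, z)].
move=> /(_ A) [C HC]; exists C => e; rewrite HC.
by split=> H y; [apply/(HA (y, e))|apply/(HA (y, e)); apply: H].
Qed.

Lemma int_ex G t (Q : car M t -> env M G -> Prop) :
  Int (fun e : env M (t :: G) => Q e.1 e.2) ->
  Int (fun e => exists y, Q y e).
Proof.
case=> A HA.
have : forall A : car M (Pow (Prod t (tup G))), exists C : car M (Pow (tup G)),
    forall z, isin z C <-> exists y, isin (pr y z) A.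
  by htransfer => A'; exists [set z | exists y, A' (y, z)].
move=> /(_ A) [C HC]; exists C => e; rewrite HC.
by split=> -[y H]; exists y; [apply/(HA (y, e))|apply/(HA (y, e)); apply: H].
Qed.

Lemma intT_const G t (c : car M t) : IntT (fun _ : env M G => c).
Proof.
have : forall c : car M t, exists C : car M (Pow (Prod t (tup G))),
    forall y z, isin (pr y z) C <-> y = c.
  by htransfer => c'; exists [set z | z.1 = c'].
by move=> /(_ c) [C HC]; exists C => y e; rewrite HC.
Qed.

Lemma intT_var G t (v : var G t) : IntT (lookup v : env M G -> car M t).
Proof.
elim: v => {t G} [G t|G s t v [A HA]].
  have : exists C : car M (Pow (Prod t (tup (t :: G)))),
      forall y x z, isin (pr y (pr x z)) C <-> y = x.
    by htransfer; exists [set z | z.1 = z.2.1].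
  by case=> C HC; exists C => y e; rewrite HC.
have : forall A : car M (Pow (Prod t (tup G))), exists C : car M (Pow (Prod t (tup (s :: G)))),
    forall y x z, isin (pr y (pr x z)) C <-> isin (pr y z) A.
  by htransfer => A'; exists [set z | A' (z.1, z.2.2)].
by move=> /(_ A) [C HC]; exists C => y e; rewrite HC -HA.
Qed.

Lemma intT_pair G s t (f : env M G -> car M s) (g : env M G -> car M t) :
  IntT f -> IntT g -> IntT (fun e => pr (f e) (g e)).
Proof.
case=> A HA [B HB].
have : forall (A : car M (Pow (Prod s (tup G)))) (B : car M (Pow (Prod t (tup G)))),
    exists C : car M (Pow (Prod (Prod s t) (tup G))),
    forall y z, isin (pr y z) C <-> exists u v, [/\ isin (pr u z) A, isin (pr v z) B & y = pr u v].
  (* The lifting recognises only binary conjunctions, hence the restatement without the triple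
     one. *)
  have : forall (A : car M (Pow (Prod s (tup G)))) (B : car M (Pow (Prod t (tup G)))),
    exists C : car M (Pow (Prod (Prod s t) (tup G))),
    forall y z, isin (pr y z) C <-> exists u v, isin (pr u z) A /\ isin (pr v z) B /\ y = pr u v.
    by htransfer => A' B'; exists [set z | exists u v, A' (u, z.2) /\ B' (v, z.2) /\ z.1 = (u, v)].
  move=> H A' B'; have [C HC] := H A' B'; exists C => y z; rewrite HC.
  by split=> -[u] [v]; [case=> ? []|case]; exists u, v.
move=> /(_ A B) [C HC]; exists C => y e; rewrite HC; split=> [->|[u][v]].
  by exists (f e), (g e); split=> //; [apply/HA|apply/HB].
by case=> /HA -> /HB ->.
Qed.

Lemma intT_app G s t (f : car M s -> car M t) (g : env M G -> car M s) :
  internal_fun f -> IntT g -> IntT (fun e => f (g e)).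
Proof.
case=> A HA [B HB].
have : forall (A : car M (Pow (Prod t s))) (B : car M (Pow (Prod s (tup G)))),
    exists C : car M (Pow (Prod t (tup G))),
    forall y z, isin (pr y z) C <-> exists u, isin (pr y u) A /\ isin (pr u z) B.
  by htransfer => A' B'; exists [set z | exists u, A' (z.1, u) /\ B' (u, z.2)].
move=> /(_ A B) [C HC]; exists C => y e; rewrite HC; split=> [->|[u]].
  by exists (g e); split; [apply/HA|apply/HB].
by case=> /HA -> /HB ->.
Qed.

Lemma star_fun_internal s t (k : std s -> std t) : internal_fun (@star_fun M s t k).
Proof.
pose K : std (Pow (Prod s t)) := [set p | p.2 = k p.1].
have uniq : forall (x : car M s) (y y' : car M t),
    isin (pr x y) (star M K) -> isin (pr x y') (star M K) -> y = y'.
  by htransfer => x y y'; rewrite /K /= => -> ->.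
have : forall A : car M (Pow (Prod s t)), exists C : car M (Pow (Prod t s)),
    forall y x, isin (pr y x) C <-> isin (pr x y) A.
  by htransfer => A'; exists [set z | A' (z.2, z.1)].
move=> /(_ (star M K)) [C HC].
exists C => y x; rewrite HC; split=> [->|yx]; first exact: star_funP.
exact: uniq yx (star_funP k x).
Qed.

Lemma intT_op G (k : nat -> nat -> nat) (f g : env M G -> hyperN M) :
  @IntT G Nat f -> @IntT G Nat g -> @IntT G Nat (fun e => hop k (f e) (g e)).
Proof.
move=> hf hg; apply: (@intT_app G (Prod Nat Nat) Nat _ (fun e => pr (f e) (g e))).
  exact: star_fun_internal.
exact: intT_pair.
Qed.

Lemma int_mem G t (g : env M G -> car M t) (B : env M G -> car M (Pow t)) :
  IntT g -> IntT B -> Int (fun e => isin (g e) (B e)).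
Proof.
case=> A HA [B' HB].
have : forall (A : car M (Pow (Prod t (tup G)))) (B : car M (Pow (Prod (Pow t) (tup G)))),
    exists C : car M (Pow (tup G)),
    forall z, isin z C <-> exists u v, isin (pr u z) A /\ isin (pr v z) B /\ isin u v.
  by htransfer => A' B''; exists [set z | exists u v, A' (u, z) /\ B'' (v, z) /\ v u].
move=> /(_ A B') [C HC]; exists C => e; rewrite HC; split=> [h|[u][v]].
  by exists (g e), (B e); split=> //; [apply/HA|split=> //; apply/HB].
by case=> /HA -> [/HB ->].
Qed.

Lemma int_eq G t (f g : env M G -> car M t) :
  IntT f -> IntT g -> Int (fun e => f e = g e).
Proof.
case=> A HA [B HB].
have : forall (A B : car M (Pow (Prod t (tup G)))),
    exists C : car M (Pow (tup G)),
    forall z, isin z C <-> exists u, isin (pr u z) A /\ isin (pr u z) B.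
  by htransfer => A' B''; exists [set z | exists u, A' (u, z) /\ B'' (u, z)].
move=> /(_ A B) [C HC]; exists C => e; rewrite HC; split=> [h|[u]].
  by exists (f e); split; [apply/HA|apply/HB].
by case=> /HA <- /HB <-.
Qed.

Lemma int_rel G (r : rel nat) (f g : env M G -> hyperN M) :
  @IntT G Nat f -> @IntT G Nat g -> Int (fun e => hrel r (f e) (g e)).
Proof. by move=> hf hg; apply: int_mem; [apply: intT_pair|apply: intT_const]. Qed.

Lemma int_set G t (X : set (car M t)) (g : env M G -> car M t) :
  internal X -> IntT g -> Int (fun e => X (g e)).
Proof. by case=> c _ <- hg; apply: int_mem => //; apply: intT_const. Qed.

(** The code of a one-variable environment carries a dummy number; the section at 0 removes it. *)
Lemma int_internal t (P : car M t -> Prop) :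
  Int (fun e : env M [:: t] => P e.1) -> internal [set x | P x].
Proof.
case=> A HA.
have : forall (A : car M (Pow (Prod t Nat))) (z : car M Nat),
    exists C : car M (Pow t), forall y, isin y C <-> isin (pr y z) A.
  by htransfer => A' z; exists [set y | A' (y, z)].
move=> /(_ A (hnat M 0)) [C HC]; exists C => //; apply/seteqP; split=> x /=.
  by move/HC => h; apply/(HA (x, tt)).
by move=> h; apply/HC; apply/(HA (x, tt)).
Qed.

Lemma int_internal_fun s t (f : car M s -> car M t) :
  IntT (fun e : env M [:: s] => f e.1) -> internal_fun f.
Proof.
case=> A HA.
have : forall (A : car M (Pow (Prod t (Prod s Nat)))) (z : car M Nat),
    exists C : car M (Pow (Prod t s)), forall y x, isin (pr y x) C <-> isin (pr y (pr x z)) A.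
  by htransfer => A' z; exists [set y | A' (y.1, (y.2, z))].
move=> /(_ A (hnat M 0)) [C HC]; exists C => y x; rewrite HC.
exact: (HA y (x, tt)).
Qed.

End Internal.

Ltac int_var v G :=
  lazymatch G with
  | _ :: ?G' =>
      first [ exact (@intT_var _ _ _ v) | let w := uconstr:(VS _ v) in int_var w G' ]
  end.

Ltac int_term :=
  lazymatch goal with
  | |- IntT (fun _ => ?c) => exact (@intT_const _ _ _ c)
  | |- IntT (fun e => pr (@?a e) (@?b e)) =>
      apply (@intT_pair _ _ _ _ a b); [int_term | int_term]
  | |- IntT (fun e => @hop _ ?k (@?a e) (@?b e)) =>
      apply (@intT_op _ _ k a b); [int_term | int_term]
  | |- IntT (fun e => @hadd _ (@?a e) (@?b e)) =>
      apply (@intT_op _ _ addn a b); [int_term | int_term]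
  | |- IntT (fun e => @hsub _ (@?a e) (@?b e)) =>
      apply (@intT_op _ _ subn a b); [int_term | int_term]
  | |- IntT (fun e => @hmul _ (@?a e) (@?b e)) =>
      apply (@intT_op _ _ muln a b); [int_term | int_term]
  | |- IntT (fun e => @hdiv _ (@?a e) (@?b e)) =>
      apply (@intT_op _ _ divn a b); [int_term | int_term]
  | |- IntT (fun e => @hdist _ (@?a e) (@?b e)) =>
      apply (@intT_op _ _ (fun m n => (m - n) + (n - m)) a b); [int_term | int_term]
  | |- IntT (fun e => @hpow2 _ (@?a e)) =>
      apply (@intT_app _ _ Nat Nat (@hpow2 _) a); [exact (@star_fun_internal _ _ _ _) | int_term]
  | |- IntT (fun e => @star_fun _ ?s ?t ?k (@?a e)) =>
      apply (@intT_app _ _ s t (@star_fun _ s t k) a); [exact (@star_fun_internal _ _ _ _) | int_term]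
  | |- @IntT _ ?G _ _ =>
      first [ let v := uconstr:(V0 _ _) in int_var v G
            | lazymatch goal with
              | |- IntT (fun e => ?f (@?a e)) =>
                  apply (@intT_app _ _ _ _ f a); [eauto | int_term]
              end ]
  end.

Ltac int_form :=
  lazymatch goal with
  | |- Int (fun e => (@?A e) /\ (@?B e)) =>
      apply (@int_and _ _ A B); [int_form | int_form]
  | |- Int (fun e => (@?A e) \/ (@?B e)) =>
      apply (@int_or _ _ A B); [int_form | int_form]
  | |- Int (fun e => ~ (@?A e)) => apply (@int_not _ _ A); int_form
  | |- Int (fun e => (@?A e) <-> (@?B e)) =>
      apply (@int_iff _ _ A B); [int_form | int_form]
  | |- Int (fun e => (@?A e) -> (@?B e)) =>
      apply (@int_imp _ _ A B); [int_form | int_form]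
  | |- Int (fun e => forall y : ?T, @?B e y) =>
      apply (@int_all _ _ _ (fun y e => B e y)); cbv beta; int_form
  | |- Int (fun e => exists y : ?T, @?B e y) =>
      apply (@int_ex _ _ _ (fun y e => B e y)); cbv beta; int_form
  | |- Int (fun e => @hle _ (@?a e) (@?b e)) =>
      apply (@int_rel _ _ leq a b); [int_term | int_term]
  | |- Int (fun e => @hlt _ (@?a e) (@?b e)) =>
      apply (@int_rel _ _ ltn a b); [int_term | int_term]
  | |- Int (fun e => @hrel _ ?r (@?a e) (@?b e)) =>
      apply (@int_rel _ _ r a b); [int_term | int_term]
  | |- Int (fun e => isin (@?a e) (@?b e)) =>
      apply (@int_mem _ _ _ a b); [int_term | int_term]
  | |- Int (fun e => @eq _ (@?a e) (@?b e)) =>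
      apply (@int_eq _ _ _ a b); [int_term | int_term]
  | |- Int (fun e => ?X (@?a e)) =>
      apply (@int_set _ _ _ X a); [eauto | int_term]
  end.

Ltac internal_tac :=
  lazymatch goal with
  | |- internal_fun ?f => apply (@int_internal_fun _ _ _ f); cbv beta; int_term
  | |- internal ?X =>
      apply (@int_internal _ _ (fun x => X x)); cbv beta delta [mkset]; int_form
  end.

(** * Saturation, countably determined and Borel sets *)

Ltac harith T :=
  lazymatch T with
  | hle _ _ => idtac
  | hlt _ _ => idtac
  | @eq (hyperN _) _ _ => idtac
  | @eq (car _ Nat) _ _ => idtac
  | ~ ?A => harith A
  | ?A /\ ?B => harith A; harith B
  | ?A \/ ?B => harith A; harith B
  | ?A <-> ?B => harith A; harith B
  | ?A -> ?B => harith A; harith B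
  end.

Ltac hgoal :=
  repeat match goal with x := _ |- _ => clearbody x end;
  repeat match goal with H : ?T |- _ =>
    lazymatch type of T with Prop => harith T; revert H end end;
  repeat match goal with H : ?T |- _ =>
    lazymatch type of T with Prop => clear H end end;
  repeat match goal with |- context [?a ?n] => is_var a;
    lazymatch type of (a n) with
    | hyperN _ => generalize (a n)
    | car _ Nat => generalize (a n)
    end end;
  repeat match goal with
  | x : hyperN _ |- _ => first [clear x | revert x]
  | x : car _ Nat |- _ => first [clear x | revert x] end.

(** Linear arithmetic on hyperintegers: [hgoal] closes the goal over its arithmetic hypotheses and
    atoms, and transfer turns it into a statement about [nat]. *)
Ltac hlia := hgoal; htransfer; clear; intros; lia.

Section Basics.
Variable M : universe.
Local Notation N := (hyperN M).
Implicit Types (s t : typ).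

Lemma hle_trans (x y z : N) : hle x y -> hle y z -> hle x z.
Proof. hlia. Qed.

Lemma hdistC (x y : N) : hdist x y = hdist y x.
Proof. hlia. Qed.

Lemma hdistxx (x : N) : hdist x x = hnat M 0.
Proof. hlia. Qed.

Lemma pr_inj s t (x x' : car M s) (y y' : car M t) :
  pr x y = pr x' y' -> x = x' /\ y = y'.
Proof. by move: x x' y y'; htransfer => x x' y y' [-> ->]. Qed.

Lemma pr_surj s t (z : car M (Prod s t)) : exists x y, z = pr x y.
Proof. by move: z; htransfer => -[x y]; exists x, y. Qed.

Lemma hpow2_nat n : hpow2 (hnat M n) = hnat M (2 ^ n).
Proof. by htransfer. Qed.

Lemma internal_setT t : @internal M t setT.
Proof.
suff -> : setT = [set x : car M t | x = x] by internal_tac.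
by apply/seteqP; split.
Qed.

Lemma internal_setC t (A : set (car M t)) : internal A -> internal (~` A).
Proof. by move=> hA; change (internal [set x | ~ A x]); internal_tac. Qed.

Lemma internal_setI t (A B : set (car M t)) :
  internal A -> internal B -> internal (A `&` B).
Proof. by move=> hA hB; change (internal [set x | A x /\ B x]); internal_tac. Qed.

Lemma internal_set0 t : @internal M t set0.
Proof. by rewrite -setCT; apply: internal_setC; apply: internal_setT. Qed.

Lemma saturate t (A : nat -> set (car M t)) :
  (forall n, internal (A n)) ->
  (forall n, exists x, forall i, i <= n -> A i x) ->
  exists x, forall i, A i x.
Proof.
move=> hA fip.
have /choice[c hc] : forall n, exists c, ext c = A n by move=> n; have [c _ <-] := hA n; exists c.
have [|x hx] := @saturation M t c.
  by move=> n; have [x hx] := fip n; exists x => i /hx; rewrite -hc.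
by exists x => i; rewrite -hc; apply: hx.
Qed.

Lemma saturate_dec t (A : nat -> set (car M t)) :
  (forall n, internal (A n)) -> (forall n, A n.+1 `<=` A n) ->
  (forall n, exists x, A n x) -> exists x, forall i, A i x.
Proof.
move=> hA dec ne; apply: saturate => // n; have [x hx] := ne n; exists x => i le_in.
have : forall k, A (i + k) `<=` A i.
  by elim=> [|k IH]; rewrite ?addn0 // addnS => z /dec /IH.
by move=> /(_ (n - i)); apply; rewrite subnKC.
Qed.

(** Pointwise bounds along a branch become one uniform bound on an internal approximation. Otherwise
    the counterexamples at the levels m form decreasing nonempty internal sets, and saturation
    yields two points of the limit for which no bound [R m] holds. *)
Lemma saturate_pairs s t (X : nat -> set (car M (Prod s t)))
    (R : nat -> car M s -> car M t -> car M s -> car M t -> Prop) :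
  (forall m, internal (X m)) -> (forall m, X m.+1 `<=` X m) ->
  (forall m, internal [set z : car M (Prod (Prod s t) (Prod s t)) |
     exists x y x' y', z = pr (pr x y) (pr x' y') /\ R m x y x' y']) ->
  (forall m x y x' y', R m x y x' y' -> R m.+1 x y x' y') ->
  (forall x y x' y', (forall m, X m (pr x y)) -> (forall m, X m (pr x' y')) ->
     exists m, R m x y x' y') ->
  exists m, forall x y x' y', X m (pr x y) -> X m (pr x' y') -> R m x y x' y'.
Proof.
move=> hX decX hR incR H; apply: contrapT => nex.
pose RR m := [set z : car M (Prod (Prod s t) (Prod s t)) |
     exists x y x' y', z = pr (pr x y) (pr x' y') /\ R m x y x' y'].
have hRR m : internal (RR m) := hR m.
pose A m := [set z : car M (Prod (Prod s t) (Prod s t)) |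
     (exists p q, z = pr p q /\ X m p /\ X m q) /\ ~ RR m z].
have [|||z hz] := @saturate_dec _ A.
- by move=> m; rewrite /A; internal_tac.
- move=> m z [[p [q [-> [Xp Xq]]]] nR]; split; first by exists p, q; split=> //; split; apply: decX.
  by move=> [x][y][x'][y'] [E r]; apply: nR; exists x, y, x', y'; split=> //; apply: incR.
- move=> m; apply: contrapT => ne; apply: nex; exists m => x y x' y' Xp Xq.
  apply: contrapT => nr; apply: ne; exists (pr (pr x y) (pr x' y')); split.
    by exists (pr x y), (pr x' y').
  by move=> [a][b][c][d] [] /pr_inj[/pr_inj[? ?] /pr_inj[? ?]]; subst.
have [p [q E]] := pr_surj z; have [x [y Ep]] := pr_surj p; have [x' [y' Eq]] := pr_surj q.
subst.
have Xpq m : X m (pr x y) /\ X m (pr x' y').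
  by have [[p [q [/pr_inj[-> ->]]]]] := hz m.
have [m r] := H x y x' y' (fun m => proj1 (Xpq m)) (fun m => proj2 (Xpq m)).
by have [_] := hz m; apply; exists x, y, x', y'.
Qed.

Definition determines t (Y : nat -> set (car M t)) (A : set (car M t)) :=
  forall x y, (forall n, Y n x <-> Y n y) -> A x -> A y.

Lemma internal_bigI t (Y : nat -> set (car M t)) m :
  (forall n, internal (Y n)) -> internal [set x | forall i, i < m -> Y i x].
Proof.
move=> hY; elim: m => [|m IH].
  suff -> : [set x | forall i, i < 0 -> Y i x] = setT by apply: internal_setT.
  by apply/seteqP; split.
suff -> : [set x | forall i, i < m.+1 -> Y i x] = [set x | forall i, i < m -> Y i x] `&` Y m.
  exact: internal_setI.
apply/seteqP; split=> x /= h; first by split=> [i im|]; apply: h => //; lia.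
by move=> i; rewrite ltnS leq_eqVlt => /orP[/eqP->|]; [case: h|apply: (proj1 h)].
Qed.

(** A symmetric form of the scheme: membership depends only on the truth values of countably many
    internal conditions, which makes closure under complements and countable unions immediate.
    Conversely, F consists of the truth sequences realised in [A], and [X u] prescribes the first
    truth values. *)
Lemma cdP t (A : set (car M t)) :
  countably_determined A <-> exists2 Y, forall n, internal (Y n) & determines Y A.
Proof.
split=> [[F [X [hX _ ->]]]|[Y hY dY]].
  exists (fun n => if unpickle n is Some u then X u else set0).
    by move=> n; case: unpickle => [u|] //; apply: internal_set0.
  move=> x y xy [f Ff hf]; exists f => // m _.
  by have := xy (pickle (mkseq f m)); rewrite pickleK => -[+ _]; apply; apply: hf.
pose Z (u : seq bool) i := if nth false u i then Y i else ~` Y i.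
exists [set f | exists2 x, A x & forall n, f n = `[< Y n x >]],
  (fun u => [set x | forall i, i < size u -> Z u i x]); split.
- move=> u; apply: internal_bigI => i; rewrite /Z; case: nth => //; exact: internal_setC.
- move=> u v /prefixP[w ->] x h i iu.
  have := h i; rewrite size_cat /Z nth_cat iu; apply; lia.
- apply/seteqP; split=> x.
    move=> Ax; exists (fun n => `[< Y n x >]); first by exists x.
    move=> m _ i; rewrite size_mkseq => im; rewrite /Z nth_mkseq //.
    by case: asboolP.
  case=> f [y Ay hf] h; apply: dY Ay => n.
  have := h n.+1 Logic.I n; rewrite size_mkseq /Z nth_mkseq // hf => /(_ (ltnSn n)).
  by case: asboolP.
Qed.

Lemma internal_cd t (A : set (car M t)) : internal A -> countably_determined A.
Proof.
by move=> hA; apply/cdP; exists (fun _ => A) => // x y /(_ 0) [].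
Qed.

Lemma cd_setC t (A : set (car M t)) : countably_determined A -> countably_determined (~` A).
Proof.
move=> /cdP[Y hY dY]; apply/cdP; exists Y => // x y xy nA Ay; apply: nA.
by apply: dY Ay => n; split=> /xy.
Qed.

Lemma cd_bigU t (A : nat -> set (car M t)) :
  (forall n, countably_determined (A n)) -> countably_determined (\bigcup_n A n).
Proof.
move=> hA.
have /choice[Y hY] : forall n, exists Y, (forall m, internal (Y m)) /\ determines Y (A n).
  by move=> n; have /cdP[Y h1 h2] := hA n; exists Y.
apply/cdP; exists (fun k => if unpickle k is Some (n, m) then Y n m else set0).
  by move=> k; case: unpickle => [[n m]|]; [apply: (proj1 (hY n))|apply: internal_set0].
move=> x y xy [n _ Ax]; exists n => //; apply: (proj2 (hY n)) Ax => m.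
by have := xy (pickle (n, m)); rewrite pickleK.
Qed.

Lemma borel_ind t (P : set (set (car M t))) :
  (forall A, internal A -> P A) -> (forall A, P A -> P (~` A)) ->
  (forall A : nat -> set (car M t), (forall n, P (A n)) -> P (\bigcup_n A n)) ->
  forall A, borel A -> P A.
Proof.
move=> PI PC PU A; apply: smallest_sub; last exact: PI.
split=> //; first by apply: PI; apply: internal_set0.
by move=> B PB; rewrite setTD; apply: PC.
Qed.

Lemma borel_cd t (A : set (car M t)) : borel A -> countably_determined A.
Proof.
move: A; apply: borel_ind; [exact: internal_cd|exact: cd_setC|exact: cd_bigU].
Qed.

Lemma borel_le_cd s t (E : car M s -> car M s -> Prop) (F : car M t -> car M t -> Prop) :
  borel_le E F -> cd_le E F.
Proof. by case=> f /borel_cd hf r; exists f. Qed.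

Lemma internal_borel t (A : set (car M t)) : internal A -> borel A.
Proof. by move=> hA; apply: sub_sigma_algebra. Qed.

Lemma borel_setC t (A : set (car M t)) : borel A -> borel (~` A).
Proof.
move=> hA; have [_ + _] := @smallest_sigma_algebra _ setT (@internal M t).
by move=> /(_ A hA); rewrite setTD.
Qed.

Lemma borel_bigU t (A : nat -> set (car M t)) :
  (forall n, borel (A n)) -> borel (\bigcup_n A n).
Proof.
by move=> hA; have [_ _] := @smallest_sigma_algebra _ setT (@internal M t); apply.
Qed.

Lemma borel_bigI t (A : nat -> set (car M t)) :
  (forall n, borel (A n)) -> borel (\bigcap_n A n).
Proof.
move=> hA; rewrite -[X in borel X]setCK setC_bigcap; apply: borel_setC.
by apply: borel_bigU => n; apply: borel_setC.
Qed.

Lemma borel_setU t (A B : set (car M t)) : borel A -> borel B -> borel (A `|` B).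
Proof.
move=> hA hB; rewrite -bigcup2E; apply: borel_bigU => -[|[|n]] //=.
by apply: internal_borel; apply: internal_set0.
Qed.

Lemma borel_setI t (A B : set (car M t)) : borel A -> borel B -> borel (A `&` B).
Proof.
move=> hA hB; rewrite -[X in borel X]setCK setCI.
by apply: borel_setC; apply: borel_setU; apply: borel_setC.
Qed.

Lemma internal_fun_graph s t (f : car M s -> car M t) : internal_fun f -> internal (graph f).
Proof.
move=> hf; rewrite /graph; internal_tac.
Qed.

Lemma internal_fun_le s t (E : car M s -> car M s -> Prop) (F : car M t -> car M t -> Prop) f :
  internal_fun f -> reduction E F f -> borel_le E F.
Proof. by move=> hf r; exists f => //; apply: internal_borel; apply: internal_fun_graph. Qed.

End Basics.

(** * Counting and null sets *)

Definition cnt (A : set nat) (n : nat) : nat := count (fun i => `[< A i >]) (iota 0 n).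

Lemma cnt_le (A B C : set nat) n :
  (forall x, A x -> B x \/ C x) -> cnt A n <= cnt B n + cnt C n.
Proof.
move=> ABC; rewrite /cnt; elim: (iota 0 n) => //= i s IH.
have := ABC i; case: asboolP => [Ai /(_ Ai)|_ _]; last by lia.
by case: asboolP => Bi; case: asboolP => Ci; case=> // _ /=; lia.
Qed.

Lemma cnt_full (A : set nat) n : (forall x, x < n -> A x) -> cnt A n = n.
Proof.
move=> h; rewrite /cnt -[RHS](size_iota 0 n); apply/eqP; rewrite -all_count.
by apply/allP => x; rewrite mem_iota add0n => /andP[_ /h]; case: asboolP.
Qed.

Lemma cnt_pos (A : set nat) n : 0 < cnt A n -> exists x, x < n /\ A x.
Proof.
rewrite -has_count => /hasP[x]; rewrite mem_iota add0n => /andP[_ xn] /asboolP Ax.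
by exists x.
Qed.

(** Every fibre of [f] has diameter below w, so residues modulo w separate its points and
    [f x * w + x %% w] is injective. *)
Lemma cnt_fibres (A : set nat) n L w (f : nat -> nat) :
  (forall x, x < n -> A x -> f x < L) ->
  (forall x y, x < n -> y < n -> A x -> A y -> f x = f y -> (x - y) + (y - x) < w) ->
  cnt A n <= L * w.
Proof.
move=> fL fw; rewrite /cnt -size_filter.
have mem x : x \in [seq i <- iota 0 n | `[< A i >]] -> x < n /\ A x.
  by rewrite mem_filter mem_iota add0n => /andP[/asboolP Ax /andP[_ xn]].
rewrite -(size_map (fun x => f x * w + x %% w)) -[X in _ <= X](size_iota 0).
apply: uniq_leq_size.
  rewrite map_inj_in_uniq ?filter_uniq ?iota_uniq // => x y /mem[xn Ax] /mem[yn Ay] E.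
  have w0 : 0 < w by have := fw x x xn xn Ax Ax erefl; lia.
  have Ef : f x = f y.
    by have := congr1 (divn^~ w) E; rewrite !divnMDl // !divn_small ?ltn_mod // !addn0.
  have := fw x y xn yn Ax Ay Ef.
  have : x %% w = y %% w by move: E; rewrite Ef; apply: addnI.
  move=> Em Hw; have [xy|xy] := leqP x y.
    have : (y - x) %% w = 0 by apply/eqP; rewrite -/(dvdn w (y - x)) -eqn_mod_dvd // Em.
    rewrite modn_small; lia.
  have : (x - y) %% w = 0 by apply/eqP; rewrite -/(dvdn w (x - y)) -eqn_mod_dvd ?Em // ltnW.
  rewrite modn_small; lia.
move=> v /mapP[x /mem[xn Ax] ->]; rewrite mem_iota add0n /=.
have w0 : 0 < w by have := fw x x xn xn Ax Ax erefl; lia.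
have := fL x xn Ax; have := ltn_pmod x w0; nia.
Qed.

(** Pigeonhole at two scales. The interval has 2^(A-q) blocks of length 2^q; the images of one block
    are within 2^s of each other and thus meet at most 2^(s-r+1) cells of length 2^r; points with
    images in one cell are within 2^p. *)
Lemma cnt_coarse (S : set (nat * nat)) (Z : set nat) A p q r s :
  r <= s -> q <= A ->
  (forall x, Z x -> exists y, S (x, y)) ->
  (forall x y x' y', S (x, y) -> S (x', y') ->
     (x - x') + (x' - x) < 2 ^ q -> (y - y') + (y' - y) < 2 ^ s) ->
  (forall x y x' y', S (x, y) -> S (x', y') ->
     (y - y') + (y' - y) < 2 ^ r -> (x - x') + (x' - x) < 2 ^ p) ->
  cnt Z (2 ^ A) * 2 ^ (q + r) <= 2 ^ (A + s + p + 1).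
Proof.
move=> rs qA tot H1 H2.
have /choice[g hg] : forall x, exists y, Z x -> S (x, y).
  by move=> x; have [/tot[y]|nZ] := pselect (Z x); [exists y|exists 0].
have [K EK] : exists K, K = 2 ^ (s - r + 1) by eexists.
(* The cell indices occurring over one block differ by less than K, so the index modulo K identifies
   the cell, wherever the images of the block begin. *)
pose f x := (x %/ 2 ^ q) * K + (g x %/ 2 ^ r) %% K.
have e0 n : 0 < 2 ^ n by rewrite expn_gt0.
have K0 : 0 < K by rewrite EK.
have lt_dist m a b : a %/ 2 ^ m = b %/ 2 ^ m -> (a - b) + (b - a) < 2 ^ m.
  by have := divn_eq a (2 ^ m); have := divn_eq b (2 ^ m);
     have := ltn_pmod a (e0 m); have := ltn_pmod b (e0 m) => ? ? ? ? E; nia.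
have : cnt Z (2 ^ A) <= (2 ^ (A - q) * K) * 2 ^ p.
  apply: (cnt_fibres (f := f)) => [x xA Zx|x y xA yA Zx Zy E].
    have : x %/ 2 ^ q < 2 ^ (A - q) by rewrite ltn_divLR // -expnD subnK.
    have := ltn_pmod (g x %/ 2 ^ r) K0; rewrite /f; nia.
  have Eq : x %/ 2 ^ q = y %/ 2 ^ q.
    by have := congr1 (divn^~ K) E; rewrite /f !divnMDl // !(divn_small (ltn_pmod _ K0)) !addn0.
  have Em : (g x %/ 2 ^ r) %% K = (g y %/ 2 ^ r) %% K by move: E; rewrite /f Eq; apply: addnI.
  have D := H1 _ _ _ _ (hg _ Zx) (hg _ Zy) (lt_dist _ _ _ Eq).
  apply: (H2 _ _ _ _ (hg _ Zx) (hg _ Zy)); apply: lt_dist.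
  move: (g x) (g y) Em D => a b Em D.
  have bound u v : u <= v -> v - u < 2 ^ s -> v %/ 2 ^ r - u %/ 2 ^ r < K.
    move=> uv vu; have := leq_divDl (2 ^ r) u (v - u); rewrite subnKC // => h.
    have : (v - u) %/ 2 ^ r < 2 ^ (s - r) by rewrite ltn_divLR // -expnD subnK.
    rewrite EK addn1 expnS; move: h (e0 (s - r)).
    move: (v %/ _) (u %/ _) ((v - u) %/ _) (2 ^ (s - r)); clear; lia.
  have small u v : u <= v -> v - u < 2 ^ s -> (u %/ 2 ^ r) %% K = (v %/ 2 ^ r) %% K ->
      u %/ 2 ^ r = v %/ 2 ^ r.
    move=> uv vu Em'; have le_uv := leq_div2r (2 ^ r) uv.
    have : (v %/ 2 ^ r - u %/ 2 ^ r) %% K = 0.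
      by apply/eqP; rewrite -/(dvdn K _) -eqn_mod_dvd // Em'.
    rewrite modn_small ?bound // => /eqP; rewrite subn_eq0 => vu'.
    by apply/eqP; rewrite eqn_leq le_uv.
  have [ab|ba] := leqP a b.
    by apply: small => //; apply: leq_ltn_trans D; apply: leq_addl.
  by symmetry; apply: small => //; [exact: ltnW|apply: leq_ltn_trans D; apply: leq_addr].
move=> h; apply: (leq_trans (leq_mul h (leqnn _))).
rewrite EK -!expnD; apply: leq_pexp2l => //; lia.
Qed.

Section Null.
Variable M : universe.
Local Notation N := (hyperN M).

Definition hcnt (A : car M (Pow Nat)) (H : N) : N :=
  @star_fun M (Prod (Pow Nat) Nat) Nat (fun p => cnt p.1 p.2) (pr A H).

Lemma hcnt_le : forall (A B C : car M (Pow Nat)) (H : N),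
  (forall x, isin x A -> isin x B \/ isin x C) ->
  hle (hcnt A H) (hadd (hcnt B H) (hcnt C H)).
Proof. rewrite /hcnt; htransfer => A B C n; exact: cnt_le. Qed.

Lemma hcnt_full : forall (A : car M (Pow Nat)) (H : N),
  (forall x : N, hlt x H -> isin x A) -> hcnt A H = H.
Proof. rewrite /hcnt; htransfer => A n; exact: cnt_full. Qed.

Lemma hcnt_pos : forall (A : car M (Pow Nat)) (H : N),
  hlt (hnat M 0) (hcnt A H) -> exists x : N, hlt x H /\ isin x A.
Proof. rewrite /hcnt; htransfer => A n; exact: cnt_pos. Qed.

Lemma hcnt_coarse : forall (S : car M (Pow (Prod Nat Nat))) (Z : car M (Pow Nat)) (A p q r s : N),
  hle r s -> hle q A ->
  (forall x, isin x Z -> exists y, isin (pr x y) S) ->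
  (forall x y x' y' : N, isin (pr x y) S -> isin (pr x' y') S ->
     hlt (hdist x x') (hpow2 q) -> hlt (hdist y y') (hpow2 s)) ->
  (forall x y x' y' : N, isin (pr x y) S -> isin (pr x' y') S ->
     hlt (hdist y y') (hpow2 r) -> hlt (hdist x x') (hpow2 p)) ->
  hle (hmul (hcnt Z (hpow2 A)) (hpow2 (hadd q r)))
    (hpow2 (hadd (hadd (hadd A s) p) (hnat M 1))).
Proof. rewrite /hcnt; htransfer => S Z A p q r s; exact: cnt_coarse. Qed.

(** Outer Loeb measure zero for the normalised counting measure on [0, H). *)
Definition null (H : N) (D : set N) : Prop := forall j : nat,
  exists2 c : car M (Pow Nat), D `<=` ext c & hle (hmul (hcnt c H) (hnat M (2 ^ j))) H.

(** Removing in turn a cover of [D i] of relative size at most 2^-(i+1) leaves at least H / 2^i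
    points before stage i, so the remainders never become empty and saturation finds a common
    point. *)
Lemma null_cover (H : N) (D : nat -> set N) : hlt (hnat M 0) H ->
  (forall n, null H (D n)) -> exists x, hlt x H /\ forall n, ~ D n x.
Proof.
move=> H0 hD.
have /choice[c hc] : forall i, exists c : car M (Pow Nat), D i `<=` ext c /\
    hle (hmul (hcnt c H) (hnat M (2 ^ i.+1))) H.
  by move=> i; have [c] := hD i i.+1; exists c.
have diff : forall A B : car M (Pow Nat), exists C : car M (Pow Nat),
    forall x, isin x C <-> isin x A /\ ~ isin x B.
  by htransfer => A B; exists (A `\` B).
have [C0 hC0] : exists C : car M (Pow Nat), forall x : N, hlt x H -> isin x C.
  by move: H {H0 hD hc}; htransfer => n; exists setT.
have : exists C : nat -> car M (Pow Nat), C 0 = C0 /\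
    forall i x, isin x (C i.+1) <-> isin x (C i) /\ ~ isin x (c i).
  have /choice[F hF] : forall p : car M (Pow Nat) * nat, exists C : car M (Pow Nat),
      forall x, isin x C <-> isin x p.1 /\ ~ isin x (c p.2) by move=> [A i]; apply: diff.
  exists (fix C i := if i is j.+1 then F (C j, j) else C0); split=> // i x; exact: (hF (_, i)).
case=> C [C00 hC].
have E0 : forall H : N, hle H (hmul H (hnat M (2 ^ 0))) by htransfer; lia.
have ES : forall i (H a b d : N), hle a (hadd b d) -> hle (hmul d (hnat M (2 ^ i.+1))) H ->
    hle H (hmul a (hnat M (2 ^ i))) -> hle H (hmul b (hnat M (2 ^ i.+1))).
  by move=> i; rewrite expnS; htransfer; move: (2 ^ i); nia.
have big i : hle H (hmul (hcnt (C i) H) (hnat M (2 ^ i))).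
  elim: i => [|i IH].
    rewrite C00 (hcnt_full hC0).
    exact: E0.
  have h1 := @hcnt_le (C i) (C i.+1) (c i) H.
  have {}h1 : hle (hcnt (C i) H) (hadd (hcnt (C i.+1) H) (hcnt (c i) H)).
    by apply: h1 => x Cx; rewrite hC; have [|] := pselect (isin x (c i)); [right|left].
  have h2 := proj2 (hc i).
  exact: ES h1 h2 IH.
have [x hx] : exists x : N, forall i, hlt x H /\ isin x (C i).
  apply: (@saturate_dec M Nat (fun i => [set x | hlt x H /\ isin x (C i)])).
  - by move=> n; internal_tac.
  - by move=> n x [xH]; rewrite hC => -[].
  - move=> n; apply: hcnt_pos.
    move: (hcnt (C n) H) (big n) H0 => a; clear; move: a H.
    by htransfer => -[|a] H; lia.
exists x; split=> [|n Dx]; first exact: (proj1 (hx 0)).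
have [_ ] := hx n.+1; rewrite hC => -[_]; apply.
exact: (proj1 (hc n)).
Qed.

Lemma null_sub H D D' : D' `<=` D -> null H D -> null H D'.
Proof. by move=> DD hD j; have [c Dc hc] := hD j; exists c => // x /DD /Dc. Qed.

Lemma null_set0 H : null H set0.
Proof.
move=> j; have [c hc] : exists c : car M (Pow Nat), forall x, ~ isin x c.
  by htransfer; exists set0 => x [].
exists c => //.
have : hcnt c H = hnat M 0.
  apply: contrapT => nz; have [|x [_]] := @hcnt_pos c H; last exact: hc.
  by move: (hcnt c H) nz; htransfer; lia.
by move=> ->; move: H; htransfer; lia.
Qed.

Lemma null_cover_countable (T : countType) (I : set T) (H : N) (D : T -> set N) :
  hlt (hnat M 0) H -> (forall u, I u -> null H (D u)) ->
  exists x, hlt x H /\ forall u, I u -> ~ D u x.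
Proof.
move=> H0 hD.
pose D' n := if unpickle n is Some u then [set x | I u /\ D u x] else set0.
have [n|x [xH hx]] := @null_cover H D' H0.
  rewrite /D'; case: unpickle => [u|]; last exact: null_set0.
  have [Iu|nI] := pselect (I u).
    by apply: null_sub (hD u Iu) => x [].
  by apply: null_sub (@null_set0 H) => x [].
by exists x; split=> // u Iu Du; apply: (hx (pickle u)); rewrite /D' pickleK.
Qed.

End Null.

(** * Countably determined maps *)

Section Negative.
Variable M : universe.
Local Notation N := (hyperN M).
Implicit Types (a b : nat -> N).

Lemma cd_graph_scheme t (f : N -> car M t) : @countably_determined M (Prod Nat t) (graph f) ->
  exists (F : set (nat -> bool)) (X : seq bool -> set (car M (Prod Nat t))),
  [/\ forall u, internal (X u),
      forall (phi : nat -> bool) m, X (mkseq phi m.+1) `<=` X (mkseq phi m),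
      forall x, exists2 phi, F phi & forall m, X (mkseq phi m) (pr x (f x)) &
      forall phi, F phi -> forall (x : N) y, (forall m, X (mkseq phi m) (pr x y)) -> y = f x].
Proof.
case=> F [X [hX dec E]]; exists F, X; split=> //.
- by move=> phi m; apply: dec; rewrite mkseqS; apply: prefix_rcons.
- move=> x; have : graph f (pr x (f x)) by exists x.
  by rewrite E => -[phi Fphi h]; exists phi => // m; apply: h.
- move=> phi Fphi x y h.
  have : graph f (pr x y) by rewrite E; exists phi => // m _; apply: h.
  by case=> x' /pr_inj[<- ->].
Qed.

Definition dom_set t (X : set (car M (Prod Nat t))) : set N := [set x | exists y, X (pr x y)].

Lemma dom_set_internal t (X : set (car M (Prod Nat t))) : internal X -> @internal M Nat (dom_set X).
Proof. by move=> hX; rewrite /dom_set; internal_tac. Qed.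

(** If every branch reached an approximation with null domain, these domains would cover the line;
    being indexed by finite binary sequences they are countably many, against
    [null_cover_countable]. *)
Lemma cd_branch t (f : N -> car M t) (H : N) :
  @countably_determined M (Prod Nat t) (graph f) -> hlt (hnat M 0) H ->
  exists X : nat -> set (car M (Prod Nat t)),
  [/\ forall m, internal (X m), forall m, X m.+1 `<=` X m,
      forall x y, (forall m, X m (pr x y)) -> y = f x &
      forall m, ~ null H (dom_set (X m))].
Proof.
move=> /cd_graph_scheme[F [X [hX dec cov fn]]] H0; apply: contrapT => nex.
have nul phi : F phi -> exists m, null H (dom_set (X (mkseq phi m))).
  move=> Fphi; apply: contrapT => nn; apply: nex; exists (fun m => X (mkseq phi m)); split=> //.
  - exact: fn.
  - by move=> m hm; apply: nn; exists m.
have [//|x [_ hx]] := @null_cover_countable M (seq bool) [set u | null H (dom_set (X u))] H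
  (fun u => dom_set (X u)) H0.
have [phi Fphi h] := cov x; have [m hm] := nul _ Fphi.
by apply: hx hm _; exists (f x).
Qed.

Lemma upper_bound a : exists A, forall n, hle (a n) A.
Proof.
have [||A hA] := @saturate M Nat (fun n => [set A : N | hle (a n) A]).
- by move=> n; internal_tac.
- elim=> [|n [x hx]]; first by exists (a 0) => i; rewrite leqn0 => /eqP -> /=; hlia.
  exists (hadd x (a n.+1)) => i; rewrite leq_eqVlt => /orP[/eqP->|]; first by rewrite /=; hlia.
  by rewrite ltnS => /hx /=; hlia.
- by exists A.
Qed.

Lemma increasing_le a m n : increasing a -> m <= n -> hle (a m) (a n).
Proof.
move=> ia; rewrite leq_eqVlt => /orP[/eqP->|/ia]; hlia.
Qed.

Lemma decreasing_le a m n : decreasing a -> m <= n -> hle (a n) (a m).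
Proof.
move=> ia; rewrite leq_eqVlt => /orP[/eqP->|/ia]; hlia.
Qed.

Lemma increasing_addn a n j : increasing a -> hle (hadd (a n) (hnat M j)) (a (n + j)).
Proof.
move=> ia; elim: j => [|j IH]; first by rewrite addn0; hlia.
by rewrite addnS; have := ia _ _ (ltnSn (n + j)); move: IH; hlia.
Qed.

Lemma decreasing_addn a n j : decreasing a -> hle (hadd (a (n + j)) (hnat M j)) (a n).
Proof.
move=> ia; elim: j => [|j IH]; first by rewrite addn0; hlia.
by rewrite addnS; have := ia _ _ (ltnSn (n + j)); move: IH; hlia.
Qed.

Lemma hpow2_le : forall p q : N, hle p q -> hle (hpow2 p) (hpow2 q).
Proof. by htransfer => p q; apply: leq_pexp2l. Qed.

Lemma hpow2_lt : forall p q : N, hlt p q -> hlt (hpow2 p) (hpow2 q).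
Proof. by htransfer => p q pq; rewrite ltn_exp2l. Qed.

Lemma hpow2_gt0 : forall p : N, hlt (hnat M 0) (hpow2 p).
Proof. by htransfer => p; rewrite expn_gt0. Qed.

Lemma hlt_le_trans (x y z : N) : hlt x y -> hle y z -> hlt x z.
Proof. hlia. Qed.

Lemma hltP (x y : N) : ~ hle x y <-> hlt y x.
Proof. hlia. Qed.

Lemma coarse_null (S : set (car M (Prod Nat Nat))) (A p q r s : N) :
  internal S -> hle r s -> hle q A ->
  (forall x y x' y' : N, S (pr x y) -> S (pr x' y') ->
     hlt (hdist x x') (hpow2 q) -> hlt (hdist y y') (hpow2 s)) ->
  (forall x y x' y' : N, S (pr x y) -> S (pr x' y') ->
     hlt (hdist y y') (hpow2 r) -> hlt (hdist x x') (hpow2 p)) ->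
  (forall j, hle (hadd (hadd p s) (hnat M j)) (hadd q r)) ->
  null (hpow2 A) (dom_set S).
Proof.
move=> hS rs qA H1 H2 H3 j; have [Z _ EZ] := dom_set_internal hS.
case: hS => c _ Ec; subst S.
exists Z; first by rewrite EZ.
have tot (x : N) : isin x Z -> exists y, isin (pr x y) c.
  by move=> xZ; have : ext Z x by []; rewrite EZ.
have h := @hcnt_coarse M c Z A p q r s rs qA tot H1 H2; move: h.
(* The instance [j.+1] absorbs the factor 2 of the counting bound. *)
move: {H3}(H3 j.+1) (hcnt Z (hpow2 A)); clear; move: A p q r s.
htransfer => A p q r s H z h.
have : z * 2 ^ (p + s + j.+1) <= 2 ^ (A + s + p + 1).
  by apply: leq_trans h; rewrite leq_mul2l leq_exp2l // H orbT.
have -> : p + s + j.+1 = j + (s + p + 1) by lia.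
have -> : A + s + p + 1 = A + (s + p + 1) by lia.
by rewrite !expnD mulnA leq_pmul2r // !muln_gt0 !expn_gt0.
Qed.

Lemma hcnt_sparse (Z : car M (Pow Nat)) (A p q : N) : hle q A ->
  (forall x x' : N, isin x Z -> isin x' Z -> hlt (hdist x x') (hpow2 q) -> hlt (hdist x x') (hpow2 p)) ->
  hle (hmul (hcnt Z (hpow2 A)) (hpow2 q)) (hpow2 (hadd (hadd A p) (hnat M 2))).
Proof.
move=> qA H.
move: Z A p q qA H; rewrite /hcnt; htransfer => Z A p q qA H.
(* The relation is the graph of division by 2^q: r = 0 expresses equality of quotients, and s = 1
   suffices because points within 2^q have equal or adjacent quotients. *)
have := @cnt_coarse [set z | Z z.1 /\ z.2 = z.1 %/ 2 ^ q] Z A p q 0 1 isT qA.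
rewrite addn0 [A + 1 + p + 1](_ : _ = A + p + 2); last by lia.
have e0 : 0 < 2 ^ q by rewrite expn_gt0.
apply=> [x Zx|x y x' y' /= [_ ->] [_ ->]|x y x' y' /= [Zx ->] [Zx' ->]]; first by exists (x %/ 2 ^ q).
  have bound u v : u <= v -> v - u < 2 ^ q -> v %/ 2 ^ q - u %/ 2 ^ q < 2.
    move=> uv vu; have := leq_divDl (2 ^ q) u (v - u); rewrite subnKC // (divn_small vu).
    by move: (v %/ _) (u %/ _); clear; lia.
  have le2 := leq_div2r (2 ^ q).
  have [ab|ba] := leqP x x'; move=> D.
    by rewrite (eqP (le2 _ _ ab)) add0n; apply: bound => //; apply: leq_ltn_trans D; apply: leq_addl.
  rewrite (eqP (le2 _ _ (ltnW ba))) addn0; apply: bound; first exact: ltnW.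
  by apply: leq_ltn_trans D; apply: leq_addr.
move=> D; apply: H => //.
have E : x %/ 2 ^ q = x' %/ 2 ^ q by move: D; move: (_ %/ _) (x' %/ _); clear; lia.
have := divn_eq x (2 ^ q); have := divn_eq x' (2 ^ q).
have := ltn_pmod x e0; have := ltn_pmod x' e0; rewrite E.
move: (x' %/ _ * _) (x %% _) (x' %% _); clear; lia.
Qed.

Lemma decr_sets t (X : nat -> set (car M t)) : (forall m, X m.+1 `<=` X m) ->
  forall i j, i <= j -> X j `<=` X i.
Proof.
move=> dec i j /subnKC <-; elim: (j - i) => [|d IH]; rewrite ?addn0 // addnS => z /dec.
exact: IH.
Qed.

(** The order of the choices is decisive: n comes from k by uniformity of the inverse direction, n'
    from n by the failure of [inc_prec] at k, and m from n' by uniformity of the forward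
    direction. *)
Lemma cofinal_neg (U V : set N) a b (f : N -> N) :
  increasing a -> increasing b ->
  U = \bigcup_n below (hpow2 (a n)) -> V = \bigcup_k below (hpow2 (b k)) ->
  @countably_determined M (Prod Nat Nat) (@graph M Nat Nat f) ->
  reduction (monadic U) (monadic V) f -> inc_prec a b.
Proof.
move=> ia ib EU EV cdf red k; apply: contrapT => nk.
have {}nk n : exists2 n', n < n' & forall k', k < k' -> hlt (hsub (b k') (b k)) (hsub (a n') (a n)).
  apply: contrapT => nn; apply: nk; exists n => n' nn'; apply: contrapT => nk; apply: nn.
  by exists n' => // k' kk'; apply/hltP => h; apply: nk; exists k'.
have [A hA] := upper_bound a.
have [X [hX dec fn nn]] := cd_branch cdf (hpow2_gt0 A).
have [|||n hn] := @saturate_pairs M Nat Nat X (fun m (x y x' y' : N) =>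
    hlt (hdist y y') (hpow2 (b k)) -> hlt (hdist x x') (hpow2 (a m))) hX dec.
- by move=> m; internal_tac.
- move=> m x y x' y' h /h h'; apply: hlt_le_trans h' _.
  by apply: hpow2_le; apply: increasing_le.
- move=> x y x' y' /fn -> /fn ->.
  have [D|nD] := pselect (hlt (hdist (f x) (f x')) (hpow2 (b k))); last by exists 0.
  have : monadic V (f x) (f x') by rewrite /monadic EV; exists k.
  by move=> /red; rewrite /monadic EU => -[m _ h]; exists m.
have [n' nn' hn'] := nk n.
have [|||m hm] := @saturate_pairs M Nat Nat X (fun m (x y x' y' : N) =>
    hlt (hdist x x') (hpow2 (a n')) -> hlt (hdist y y') (hpow2 (b m))) hX dec.
- by move=> m; internal_tac.
- move=> m x y x' y' h /h h'; apply: hlt_le_trans h' _.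
  by apply: hpow2_le; apply: increasing_le.
- move=> x y x' y' /fn -> /fn ->.
  have [D|nD] := pselect (hlt (hdist x x') (hpow2 (a n'))); last by exists 0.
  have : monadic U x x' by rewrite /monadic EU; exists n'.
  by move=> /red; rewrite /monadic EV => -[m _ h]; exists m.
have Xle := decr_sets dec.
apply: (nn (maxn n m)).
apply: (@coarse_null _ A (a n) (a n') (b k) (b (k + m).+1) (hX _)).
- by apply: increasing_le => //; lia.
- exact: hA.
- move=> x y x' y' h h' /hm D; apply: hlt_le_trans (D _ _ _ _) _.
  + by apply: Xle h; lia.
  + by apply: Xle h'; lia.
  + by apply: hpow2_le; apply: increasing_le => //; lia.
- by move=> x y x' y' h h'; apply: hn; [apply: Xle h|apply: Xle h']; lia.
(* Strict growth of [b] turns the inequality at the index (k + m).+1 + j into a deficit of at least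
   j at the index (k + m).+1. *)
- move=> j; have kj : k < (k + m).+1 + j by lia.
  move: (increasing_addn (k + m).+1 j ib) (hn' _ kj) (increasing_le ia (ltnW nn')).
  hlia.
Qed.

(** For intersections the quantifiers on exponents are interchanged: uniformity of the forward
    direction comes first and yields n for the given k, while n' from the failure is used for the
    inverse direction. *)
Lemma coinitial_neg (U V : set N) a b (f : N -> N) :
  decreasing a -> decreasing b ->
  U = \bigcap_n below (hpow2 (a n)) -> V = \bigcap_k below (hpow2 (b k)) ->
  @countably_determined M (Prod Nat Nat) (@graph M Nat Nat f) ->
  reduction (monadic U) (monadic V) f -> dec_prec a b.
Proof.
move=> ia ib EU EV cdf red k; apply: contrapT => nk.
have {}nk n : exists2 n', n < n' & forall k', k < k' -> hlt (hsub (b k) (b k')) (hsub (a n) (a n')).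
  apply: contrapT => nn; apply: nk; exists n => n' nn'; apply: contrapT => nk; apply: nn.
  by exists n' => // k' kk'; apply/hltP => h; apply: nk; exists k'.
pose A := a 0.
have hA n : hle (a n) A by apply: decreasing_le.
have [X [hX dec fn nn]] := cd_branch cdf (hpow2_gt0 A).
have [|||n hn] := @saturate_pairs M Nat Nat X (fun m (x y x' y' : N) =>
    hlt (hdist x x') (hpow2 (a m)) -> hlt (hdist y y') (hpow2 (b k))) hX dec.
- by move=> m; internal_tac.
- move=> m x y x' y' h h'; apply: h; apply: hlt_le_trans h' _.
  by apply: hpow2_le; apply: decreasing_le.
- move=> x y x' y' /fn -> /fn ->.
  have [D|] := pselect (forall m, hlt (hdist x x') (hpow2 (a m))).
    have : monadic U x x' by rewrite /monadic EU => m _; apply: D.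
    by move=> /red; rewrite /monadic EV => /(_ k Logic.I) h; exists 0.
  by move=> /existsNP[m nD]; exists m.
have [n' nn' hn'] := nk n.
have [|||m hm] := @saturate_pairs M Nat Nat X (fun m (x y x' y' : N) =>
    hlt (hdist y y') (hpow2 (b m)) -> hlt (hdist x x') (hpow2 (a n'))) hX dec.
- by move=> m; internal_tac.
- move=> m x y x' y' h h'; apply: h; apply: hlt_le_trans h' _.
  by apply: hpow2_le; apply: decreasing_le.
- move=> x y x' y' /fn -> /fn ->.
  have [D|] := pselect (forall m, hlt (hdist (f x) (f x')) (hpow2 (b m))).
    have : monadic V (f x) (f x') by rewrite /monadic EV => m _; apply: D.
    by move=> /red; rewrite /monadic EU => /(_ n' Logic.I) h; exists 0.
  by move=> /existsNP[m nD]; exists m.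
have Xle := decr_sets dec.
apply: (nn (maxn n m)).
apply: (@coarse_null _ A (a n') (a n) (b (k + m).+1) (b k) (hX _)).
- by apply: decreasing_le => //; lia.
- exact: hA.
- by move=> x y x' y' h h'; apply: hn; [apply: Xle h|apply: Xle h']; lia.
- move=> x y x' y' h h' D; apply: (hm x y x' y'); [apply: Xle h; lia|apply: Xle h'; lia|].
  by apply: hlt_le_trans D _; apply: hpow2_le; apply: decreasing_le => //; lia.
- move=> j; have kj : k < (k + m).+1 + j by lia.
  move: (decreasing_addn (k + m).+1 j ib) (hn' _ kj) (decreasing_le ia (ltnW nn')).
  move: (decreasing_le ib (ltnW kj)).
  hlia.
Qed.

Lemma sparse_null (Z : set N) (A p : N) (q : nat -> N) : @internal M Nat Z ->
  (forall j, hle (q j) A) ->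
  (forall j x x', Z x -> Z x' -> hlt (hdist x x') (hpow2 (q j)) -> hlt (hdist x x') (hpow2 p)) ->
  (forall j, hle (hadd p (hnat M j)) (q j)) -> null (hpow2 A) Z.
Proof.
case=> c _ EZ qA H pq j; subst Z; exists c => //.
(* [j.+2] absorbs the factor 4 of [hcnt_sparse]. *)
have := hcnt_sparse (qA j.+2) (H j.+2).
move: (pq j.+2) (hcnt c (hpow2 A)); move: (q j.+2) => {H pq qA}q; clear; move: q p A.
htransfer => q p A pq z h.
have : z * 2 ^ (p + j.+2) <= 2 ^ (A + p + 2).
  by apply: leq_trans h; rewrite leq_mul2l leq_exp2l // pq orbT.
have -> : p + j.+2 = j + (p + 2) by lia.
have -> : A + p + 2 = A + (p + 2) by lia.
by rewrite !expnD mulnA leq_pmul2r // !muln_gt0 !expn_gt0.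
Qed.

(** On an internal piece, [R n] forces distance below 2^(a n), and distance below 2^(a n') forces
    [R n], where a n' is infinitely far above a n. So points within 2^(a n') of each other are
    within 2^(a n), and the domain of the piece is null. [F] is abstract in order to cover both
    equality and coinitial relations. *)
Lemma fast_neg t (U : set N) a (F : car M t -> car M t -> Prop)
    (R : nat -> set (car M (Prod t t))) (f : N -> car M t) :
  increasing a -> (forall n, exists n', forall j, hle (hadd (a n) (hnat M j)) (a n')) ->
  U = \bigcup_n below (hpow2 (a n)) ->
  (forall m, internal (R m)) -> (forall m, R m.+1 `<=` R m) ->
  (forall y y', F y y' <-> forall m, R m (pr y y')) ->
  @countably_determined M (Prod Nat t) (graph f) ->
  ~ reduction (monadic U) F f.
Proof.
move=> ia fa EU hR decR EF cdf red.
have [A hA] := upper_bound a.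
have [X [hX dec fn nn]] := cd_branch cdf (hpow2_gt0 A).
have [|||n hn] := @saturate_pairs M Nat t X (fun m x y x' y' =>
    R m (pr y y') -> hlt (hdist x x') (hpow2 (a m))) hX dec.
- by move=> m; internal_tac.
- move=> m x y x' y' h /decR /h h'; apply: hlt_le_trans h' _.
  by apply: hpow2_le; apply: increasing_le.
- move=> x y x' y' /fn -> /fn ->.
  have [D|] := pselect (forall m, R m (pr (f x) (f x'))).
    by move: D => /EF /red; rewrite /monadic EU => -[m _ h]; exists m.
  by move=> /existsNP[m nD]; exists m.
have [n' hn'] := fa n.
have [|||m hm] := @saturate_pairs M Nat t X (fun m x y x' y' =>
    hlt (hdist x x') (hpow2 (a n')) -> R n (pr y y')) hX dec.
- by move=> m; internal_tac.
- by [].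
- move=> x y x' y' /fn -> /fn ->; exists 0 => D.
  have : monadic U x x' by rewrite /monadic EU; exists n'.
  by move=> /red /EF.
have Xle := decr_sets dec.
apply: (nn (maxn n m)).
apply: (@sparse_null _ A (a n) (fun _ => a n')) => //; first exact: dom_set_internal.
move=> j x x' [y h] [y' h'] D; apply: (hn x y x' y'); [apply: Xle h; lia|apply: Xle h'; lia|].
by apply: hm D; [apply: Xle h|apply: Xle h']; lia.
Qed.

(* At a suitable scale each [Q i] lies within a single monad, so a subinterval avoids it; a point
   common to the resulting nested intervals avoids all of them. *)
Lemma escape_monads (V : set N) a (Q : nat -> set N) : decreasing a ->
  V = \bigcap_n below (hpow2 (a n)) ->
  (forall i, exists n, forall x x', Q i x -> Q i x' ->
     hlt (hdist x x') (hpow2 (a n)) -> V (hdist x x')) ->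
  exists x, forall i, ~ Q i x.
Proof.
move=> ia EV HQ.
pose I (p : N * nat) : set N := [set x | hle p.1 x /\ hlt x (hadd p.1 (hpow2 (a p.2)))].
have halves n : hle (hmul (hnat M 2) (hpow2 (a n.+1))) (hpow2 (a n)).
  have := ia _ _ (ltnSn n); move: (a n) (a n.+1); clear; htransfer => u v vu.
  by rewrite -expnS leq_exp2l.
have step p i : exists p', I p' `<=` I p /\ forall x, I p' x -> ~ Q i x.
  case: p => u n; have [nQ hQ] := HQ i.
  pose l := (maxn n nQ).+1.
  have l1 : hle (hmul (hnat M 2) (hpow2 (a l))) (hpow2 (a n)).
    apply: hle_trans (halves _) _; apply: hpow2_le; apply: decreasing_le => //; lia.
  have l2 : hle (hmul (hnat M 2) (hpow2 (a l))) (hpow2 (a nQ)).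
    apply: hle_trans (halves _) _; apply: hpow2_le; apply: decreasing_le => //; lia.
  have l3 := halves l.
  have [ex|nex] := pselect (exists x, I (u, l.+1) x /\ Q i x); last first.
    exists (u, l.+1); split=> x; last by move=> h h'; apply: nex; exists x.
    rewrite /I /=; move: l1 l3; move: (hpow2 (a n)) (hpow2 (a l)) (hpow2 (a l.+1)); hlia.
  have [x [[x1 x2] Qx]] := ex.
  (* The first subinterval contains a point x of [Q i]. The second, shifted by 2^(a l), is too far
     from x to meet its monad, yet within 2^(a nQ) of it, so [hQ] excludes points of [Q i] there. *)
  exists (hadd u (hpow2 (a l)), l.+1); split=> y.
    rewrite /I /=; move: l1 l3; move: (hpow2 (a n)) (hpow2 (a l)) (hpow2 (a l.+1)); hlia.
  move=> [/= y1 y2] Qy.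
  have : V (hdist x y).
    apply: hQ => //; move: x1 x2 y1 y2 l2 l3 => /=.
    move: (hpow2 (a nQ)) (hpow2 (a l)) (hpow2 (a l.+1)); hlia.
  rewrite EV => /(_ l.+1 Logic.I); rewrite /below /=.
  move: x1 x2 y1 y2 l3 => /=; move: (hpow2 (a l)) (hpow2 (a l.+1)); hlia.
have /choice[g hg] : forall q : (N * nat) * nat,
    exists p', I p' `<=` I q.1 /\ forall x, I p' x -> ~ Q q.2 x.
  by move=> [p i]; apply: step.
pose p := fix p i := if i is j.+1 then g (p j, j) else (hnat M 0, 0).
have [|||x hx] := @saturate_dec M Nat (fun i => I (p i)).
- by move=> n; rewrite /I; internal_tac.
- by move=> n; exact: (proj1 (hg (p n, n))).
- move=> n; exists (p n).1; rewrite /I /=.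
  by have := hpow2_gt0 (a (p n).2); move: (p n).1 (hpow2 (a (p n).2)); hlia.
- by exists x => i; exact: (proj2 (hg (p i, i))) (hx i.+1).
Qed.

(** Along a branch, nearness in all scales implies [F]; by saturation one scale suffices at some
    finite level. There the points of the piece that are close in this scale lie in a single monad,
    as [escape_monads] requires. The sets [Q i] involve [f] itself and need not be internal. *)
Lemma coinitial_to_cofinal_neg t (V : set N) a (F : car M t -> car M t -> Prop)
    (R : nat -> set (car M (Prod t t))) (f : N -> car M t) :
  decreasing a -> V = \bigcap_n below (hpow2 (a n)) ->
  (forall m, internal (R m)) -> (forall m, R m `<=` R m.+1) ->
  (forall y y', F y y' <-> exists m, R m (pr y y')) ->
  @countably_determined M (Prod Nat t) (graph f) ->
  ~ reduction (monadic V) F f.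
Proof.
move=> ia EV hR incR EF cdf red.
have [Fs [X [hX dec cov fn]]] := cd_graph_scheme cdf.
pose good u := exists n, forall x y x' y', X u (pr x y) -> X u (pr x' y') ->
  hlt (hdist x x') (hpow2 (a n)) -> F y y'.
have ex_good phi : Fs phi -> exists m, good (mkseq phi m).
  move=> Fphi; have [|||n hn] := @saturate_pairs M Nat t (fun m => X (mkseq phi m)) (fun m x y x' y' =>
      hlt (hdist x x') (hpow2 (a m)) -> R m (pr y y')) (fun m => hX _) (dec phi).
  - by move=> m; internal_tac.
  - move=> m x y x' y' h D; apply: incR; apply: h; apply: hlt_le_trans D _.
    by apply: hpow2_le; apply: decreasing_le.
  - move=> x y x' y' /(fn _ Fphi) -> /(fn _ Fphi) ->.
    have [D|] := pselect (forall m, hlt (hdist x x') (hpow2 (a m))).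
      have : monadic V x x' by rewrite /monadic EV => m _; apply: D.
      by move=> /red /EF[m]; exists m.
    by move=> /existsNP[m nD]; exists m.
  by exists n, n => x y x' y' h h' D; apply/EF; exists n; apply: hn h h' D.
pose Q i := if unpickle i is Some u then [set x | good u /\ X u (pr x (f x))] else set0.
have [|x hx] := @escape_monads V a Q ia EV.
  move=> i; rewrite /Q; case: unpickle => [u|]; last by exists 0.
  have [[n hn]|ng] := pselect (good u); last by exists 0 => x x' [].
  by exists n => x x' [_ h] [_ h'] D; apply/red; apply: hn h h' D.
have [phi Fphi h] := cov x; have [m gm] := ex_good _ Fphi.
by apply: (hx (pickle (mkseq phi m))); rewrite /Q pickleK.
Qed.

End Negative.

(** * Loeb measure and Borel maps *)

Section Loeb.
Variable M : universe.
Local Notation N := (hyperN M).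
Local Notation code := (car M (Pow Nat)).
Implicit Types (c d o : code) (H : N).

Definition hsetD c d : code :=
  @star_fun M (Prod (Pow Nat) (Pow Nat)) (Pow Nat) (fun p => p.1 `\` p.2) (pr c d).

Definition hsetU c d : code :=
  @star_fun M (Prod (Pow Nat) (Pow Nat)) (Pow Nat) (fun p => p.1 `|` p.2) (pr c d).

Definition hset0 : code := star M (set0 : std (Pow Nat)).
Definition hsetT : code := star M (setT : std (Pow Nat)).

Lemma in_hsetD : forall c d (x : N), isin x (hsetD c d) <-> isin x c /\ ~ isin x d.
Proof. by rewrite /hsetD; htransfer. Qed.

Lemma in_hsetU : forall c d (x : N), isin x (hsetU c d) <-> isin x c \/ isin x d.
Proof. by rewrite /hsetU; htransfer. Qed.

Lemma in_hset0 : forall x : N, ~ isin x hset0.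
Proof. by rewrite /hset0; htransfer => x []. Qed.

Lemma in_hsetT : forall x : N, isin x hsetT.
Proof. by rewrite /hsetT; htransfer. Qed.

Lemma hcnt_sub : forall c d H, (forall x : N, isin x c -> isin x d) -> hle (hcnt c H) (hcnt d H).
Proof.
rewrite /hcnt; htransfer => A B n AB; have := @cnt_le A B set0 n (fun x Ax => or_introl (AB x Ax)).
rewrite [cnt set0 n](_ : _ = 0) ?addn0 // /cnt.
by rewrite (eq_count (a2 := pred0)) ?count_pred0 // => x; case: asboolP.
Qed.

Lemma hcnt_bound : forall c H, hle (hcnt c H) H.
Proof.
by rewrite /hcnt; htransfer => A n; rewrite /cnt -[X in _ <= X](size_iota 0); apply: count_size.
Qed.

Lemma hcnt_set0 H : hcnt hset0 H = hnat M 0.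
Proof.
apply: contrapT => nz; have [|x [_ /in_hset0]//] := @hcnt_pos M hset0 H.
by move: (hcnt _ _) nz; hlia.
Qed.

Fixpoint hbigU (c : nat -> code) (n : nat) : code :=
  if n is m.+1 then hsetU (hbigU c m) (c m) else hset0.

Lemma in_hbigU (c : nat -> code) n (x : N) :
  isin x (hbigU c n) <-> exists2 i, i < n & isin x (c i).
Proof.
elim: n => [|n IH] /=; first by split=> [/in_hset0|[]].
rewrite in_hsetU IH; split=> [[[i le h]|h]|[i]].
- by exists i => //; apply: leqW.
- by exists n.
- by rewrite ltnS leq_eqVlt => /orP[/eqP->|le h]; [right|left; exists i].
Qed.

(* Loeb measurability, with [H] points of equal weight. *)
Definition loeb H (A : set N) : Prop := forall l : nat, exists c o,
  [/\ ext c `<=` A, A `<=` ext o & hle (hmul (hcnt (hsetD o c) H) (hnat M (2 ^ l))) H].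

Lemma internal_loeb H (A : set N) : @internal M Nat A -> loeb H A.
Proof.
case=> c _ <- l; exists c, c; split=> //.
have : hle (hcnt (hsetD c c) H) (hcnt hset0 H) by apply: hcnt_sub => x /in_hsetD[].
rewrite hcnt_set0; move: (hcnt _ _) => k k0.
have -> : k = hnat M 0 by hlia.
by move: H {k k0}; htransfer; lia.
Qed.

Lemma loeb_setC H (A : set N) : loeb H A -> loeb H (~` A).
Proof.
move=> hA l; have [c [o [cA Ao h]]] := hA l.
exists (hsetD hsetT o), (hsetD hsetT c); split.
- by move=> x /in_hsetD[_ xo] /Ao.
- by move=> x nA; apply/in_hsetD; split; [exact: in_hsetT|move/cA].
- apply: hle_trans h.
  have : hle (hcnt (hsetD (hsetD hsetT c) (hsetD hsetT o)) H) (hcnt (hsetD o c) H).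
    apply: hcnt_sub => x /in_hsetD[/in_hsetD[xT xc] xo]; apply/in_hsetD; split=> //.
    by apply: contrapT => nxo; apply: xo; apply/in_hsetD.
  by move: (hcnt _ _) (hcnt _ _); htransfer => u v uv; apply: leq_mul.
Qed.

(* The counts increase and are bounded by [H], so they can gain more than [H / 2 ^ l] only
   finitely often. *)
Lemma stabilize H (d : nat -> code) (l : nat) : hlt (hnat M 0) H ->
  (forall n, ext (d n) `<=` ext (d n.+1)) ->
  exists n, forall m, n <= m -> hle (hmul (hcnt (hsetD (d m) (d n)) H) (hnat M (2 ^ l))) H.
Proof.
move=> H0 inc; apply: contrapT => nex.
have incl i j : i <= j -> ext (d i) `<=` ext (d j).
  by move=> /subnKC <-; elim: (j - i) => [|k IH]; rewrite ?addn0 // addnS => x /IH /inc.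
have {}nex n : exists2 m, n <= m & hlt H (hmul (hcnt (hsetD (d m) (d n)) H) (hnat M (2 ^ l))).
  apply: contrapT => nn; apply: nex; exists n => m nm; apply: contrapT => h; apply: nn.
  by exists m => //; apply/hltP.
have big k : exists n, hle (hmul H (hnat M k)) (hmul (hcnt (d n) H) (hnat M (2 ^ l))).
  elim: k => [|k [n IH]].
    by exists 0; move: (hcnt _ _) => u; move: {H0 nex}H u; htransfer; lia.
  have [m nm hm] := nex n; exists m.
  have : hle (hadd (hcnt (d n) H) (hcnt (hsetD (d m) (d n)) H)) (hcnt (d m) H).
    have : forall u w : code, (forall x : N, isin x u -> isin x w) ->
      hle (hadd (hcnt u H) (hcnt (hsetD w u) H)) (hcnt w H).
      move: {H0 nex IH hm}H; rewrite /hcnt /hsetD; htransfer => n' A B AB.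
      rewrite /cnt; elim: (iota 0 n') => //= i s IH.
      have ABi := AB i.
      have [Ai|nAi] := pselect (A i).
        rewrite (asboolT Ai) (asboolT (ABi Ai)) asboolF ?add0n; last by case.
        by move: IH; lia.
      rewrite (asboolF nAi) (_ : `[< _ >] = `[< B i >]); first by move: IH; lia.
      by apply: asbool_equiv_eq; split=> [[]|].
    apply=> //; exact: incl.
  move: IH hm; move: (hcnt (d n) H) (hcnt (hsetD _ _) H) (hcnt (d m) H); clear; move: H.
  by htransfer; move: (2 ^ l) => e; nia.
have [n hn] := big (2 ^ l).+1; have := hcnt_bound (d n) H.
move: (hcnt _ _) hn H0; clear; move: H; htransfer => H u; have : 0 < 2 ^ l by rewrite expn_gt0.
by move: (2 ^ l) => e; nia.
Qed.

(** Finitely many inner sets suffice up to 2^-(l+1), by [stabilize], and the errors of relative size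
    2^-(l+i+2) sum to less than 2^-(l+1). The union of all outer sets need not be internal;
    saturation replaces it by an internal set that contains them all and is no larger than
    allowed. *)
Lemma loeb_bigU H (A : nat -> set N) : hlt (hnat M 0) H ->
  (forall n, loeb H (A n)) -> loeb H (\bigcup_n A n).
Proof.
move=> H0 hA l.
have /choice[co hco] : forall i, exists p : code * code,
    [/\ ext p.1 `<=` A i, A i `<=` ext p.2 &
     hle (hmul (hcnt (hsetD p.2 p.1) H) (hnat M (2 ^ (l + i + 2)))) H].
  by move=> i; have [c [o h]] := hA i (l + i + 2); exists (c, o).
pose c i := (co i).1; pose o i := (co i).2.
pose e i := hsetD (o i) (c i).
have [|n hn] := @stabilize H (hbigU c) l.+1 H0.
  by move=> n x /in_hbigU[i ni h]; apply/in_hbigU; exists i => //; apply: leqW.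
have small m : hle (hmul (hcnt (hbigU e m) H) (hnat M (2 ^ (l.+1 + m)))) (hmul H (hnat M (2 ^ m - 1))).
  elim: m => [|m IH].
    rewrite /= hcnt_set0; clear; move: H; htransfer => H; exact: leq0n.
  have h1 : hle (hcnt (hbigU e m.+1) H) (hadd (hcnt (hbigU e m) H) (hcnt (e m) H)).
    by apply: hcnt_le => x /= /in_hsetU.
  have [_ _ h2] := hco m.
  move: IH h1 h2; rewrite -/(o m) -/(c m) -/(e m).
  move: (hcnt (hbigU e m) H) (hcnt (e m) H) (hcnt (hbigU e m.+1) H); clear; move: H.
  have -> : l + m + 2 = (l.+1 + m).+1 by lia.
  rewrite addnS !expnS; have : 0 < 2 ^ m by rewrite expn_gt0.
  move: (2 ^ m) (2 ^ (l.+1 + m)) => f g f0; htransfer; nia.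
exists (hbigU c n).
have [||O hO] := @saturate M (Pow Nat) (fun i => [set O : code |
    (forall x, isin x (o i) -> isin x O) /\
    hle (hmul (hcnt (hsetD O (hbigU c n)) H) (hnat M (2 ^ l))) H]).
- by move=> i; rewrite /hcnt /hsetD; internal_tac.
- move=> j; exists (hbigU o j.+1) => i ij; split.
    by move=> x xo; apply/in_hbigU; exists i.
  pose m := maxn n j.+1.
  have h1 : hle (hcnt (hsetD (hbigU o j.+1) (hbigU c n)) H)
      (hadd (hcnt (hbigU e j.+1) H) (hcnt (hsetD (hbigU c m) (hbigU c n)) H)).
    apply: hcnt_le => x /in_hsetD[/in_hbigU[k kj xo] nx].
    have [xc|nxc] := pselect (isin x (c k)); [right|left].
      by apply/in_hsetD; split=> //; apply/in_hbigU; exists k => //; rewrite /m; lia.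
    by apply/in_hbigU; exists k => //; apply/in_hsetD.
  have h2 := hn m (leq_maxl _ _).
  move: h1 h2 (small j.+1); rewrite expnD.
  move: (hcnt _ H) (hcnt _ H) (hcnt _ H); clear; move: H.
  rewrite expnS; have : 0 < 2 ^ j.+1 by rewrite expn_gt0.
  move: (2 ^ l) (2 ^ j.+1) => f g g0; htransfer => H u v w h1 h2 h3.
  have {}h3 : v * (2 * f) <= H by rewrite -(leq_pmul2r g0) -mulnA (leq_trans h3) // leq_mul // leq_subr.
  nia.
exists O; split.
- by move=> x /in_hbigU[i _ xc]; exists i => //; have [h _ _] := hco i; apply: h.
- move=> x [i _ Ax]; have [h _] := hO i; apply: h.
  by have [_ h _] := hco i; apply: h.
- by have [_] := hO 0.
Qed.

(** This passage from internal subsets to an internal cover is what a Borel graph offers beyond a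
    countably determined one. *)
Lemma loeb_null H (A : set N) : loeb H A ->
  (forall c, ext c `<=` A -> null H (ext c)) -> null H A.
Proof.
move=> hA hn j; have [c [o [cA Ao h]]] := hA j.+1; exists o => //.
have [c' cc' h'] := hn c cA j.+1.
have : hle (hcnt o H) (hadd (hcnt c' H) (hcnt (hsetD o c) H)).
  apply: hcnt_le => x xo; have [/cc'|nc] := pselect (isin x c); first by left.
  by right; apply/in_hsetD.
move: h h'; rewrite expnS; move: (hcnt _ _) (hcnt _ _) (hcnt _ _); clear; move: H.
by move: (2 ^ j) => e; htransfer; nia.
Qed.

(** Projection does not commute with complements in general. Over a single-valued [X] it does,
    relative to the domain of [X], so the induction on Borel sets goes through. *)
Lemma borel_section_loeb t (X B : set (car M (Prod Nat t))) H : hlt (hnat M 0) H ->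
  internal X -> (forall x y y', X (pr x y) -> X (pr x y') -> y = y') ->
  borel B -> loeb H (dom_set (X `&` B)).
Proof.
move=> H0 hX fX; move: B; apply: borel_ind => [B hB|B hB|B hB].
- by apply: internal_loeb; apply: dom_set_internal; apply: internal_setI.
- have -> : dom_set (X `&` ~` B) = ~` (~` dom_set X `|` dom_set (X `&` B)).
    apply/seteqP; split=> x.
      case=> y [Xy nBy] [|[y' [Xy' By']]]; first by apply; exists y.
      by apply: nBy; rewrite (fX _ _ _ Xy Xy').
    move=> /not_orP[/contrapT[y Xy] nB]; exists y; split=> // By.
    by apply: nB; exists y.
  apply: loeb_setC; rewrite -bigcup2E; apply: loeb_bigU => // -[|[|n]] //=.
  + by apply: internal_loeb; apply: internal_setC; apply: dom_set_internal.
  + by apply: internal_loeb; apply: internal_set0.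
- have -> : dom_set (X `&` \bigcup_n B n) = \bigcup_n dom_set (X `&` B n).
    apply/seteqP; split=> x; first by case=> y [Xy [n _ By]]; exists n => //; exists y.
    by case=> n _ [y [Xy By]]; exists y; split=> //; exists n.
  exact: loeb_bigU.
Qed.

(** For a slow cut there is no infinite gap, so one pair of exponents does not suffice. Points whose
    pairs lie on the graph itself, at distance below 2^(a (n + j)) for any j, have related values
    and hence are within 2^(a n). This makes every internal subset of the domain null, and
    measurability carries it over to the whole domain. *)
Lemma cofinal_borel_neg t (U : set N) (a : nat -> N) (F : car M t -> car M t -> Prop)
    (R : nat -> set (car M (Prod t t))) (f : N -> car M t) :
  increasing a -> U = \bigcup_n below (hpow2 (a n)) ->
  (forall m, internal (R m)) -> (forall m, R m.+1 `<=` R m) ->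
  (forall y y', F y y' <-> forall m, R m (pr y y')) ->
  @borel M (Prod Nat t) (graph f) ->
  ~ reduction (monadic U) F f.
Proof.
move=> ia EU hR decR EF bf red.
have [A hA] := upper_bound a.
have [Fs [X [hX dec cov fn]]] := cd_graph_scheme (borel_cd bf).
pose good u := exists n,
  (forall x y x' y', X u (pr x y) -> X u (pr x' y') -> F y y' -> hlt (hdist x x') (hpow2 (a n))) /\
  (forall x y y', X u (pr x y) -> X u (pr x y') -> y = y').
have ex_good phi : Fs phi -> exists m, good (mkseq phi m).
  move=> Fphi; have [|||n hn] := @saturate_pairs M Nat t (fun m => X (mkseq phi m)) (fun m x y x' y' =>
     (R m (pr y y') -> hlt (hdist x x') (hpow2 (a m))) /\ (x = x' -> y = y')) (fun m => hX _) (dec phi).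
  - by move=> m; internal_tac.
  - move=> m x y x' y' [h fu]; split=> // /decR /h D; apply: hlt_le_trans D _.
    by apply: hpow2_le; apply: increasing_le.
  - move=> x y x' y' /(fn _ Fphi) -> /(fn _ Fphi) ->.
    have [D|] := pselect (forall m, R m (pr (f x) (f x'))).
      have : monadic U x x' by apply/red; apply/EF.
      by rewrite /monadic EU => -[m _ h]; exists m; split=> // ->.
    by move=> /existsNP[m nD]; exists m; split=> // ->.
  exists n, n; split=> [x y x' y' h h' /EF D|x y y' h h'].
    by have [+ _] := hn _ _ _ _ h h'; apply.
  by have [_] := hn _ _ _ _ h h'; apply.
pose Q u := dom_set (X u `&` graph f).
have nullQ u : good u -> null (hpow2 A) (Q u).
  case=> n [g1 g2]; apply: loeb_null.
    by apply: borel_section_loeb => //; apply: hpow2_gt0.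
  move=> c cQ; apply: (@sparse_null M (ext c) A (a n) (fun j => a (n + j))) => //.
  - by exists c.
  - move=> j x x' /cQ[y [Xy [z /pr_inj[xz yz]]]] /cQ[y' [Xy' [z' /pr_inj[xz' yz']]]] D.
    rewrite {}yz -{}xz in Xy; rewrite {}yz' -{}xz' in Xy'.
    apply: (g1 _ _ _ _ Xy Xy'); apply/red; by rewrite /monadic EU; exists (n + j).
  - by move=> j; apply: increasing_addn.
have [//|x [_ hx]] := @null_cover_countable M (seq bool) good (hpow2 A) Q (hpow2_gt0 A).
have [phi Fphi h] := cov x; have [m gm] := ex_good _ Fphi.
by apply: (hx _ gm); exists (f x); split=> //; exists x.
Qed.

End Loeb.

(** * Cuts as sequences of exponents *)

Section Cuts.
Variable M : universe.
Local Notation N := (hyperN M).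
Implicit Types (a b : nat -> N) (U V : set N).

Lemma hle_total (x y : N) : hle x y \/ hlt y x.
Proof. hlia. Qed.

Lemma hle_lt_trans (x y z : N) : hle x y -> hlt y z -> hlt x z.
Proof. hlia. Qed.

Lemma hltW (x y : N) : hlt x y -> hle x y.
Proof. hlia. Qed.

Lemma hpow2S : forall p : N, hpow2 (hadd p (hnat M 1)) = hadd (hpow2 p) (hpow2 p).
Proof. by htransfer => p; rewrite addn1 expnS; lia. Qed.

Lemma hpow2_addn n : forall p : N, hpow2 (hadd p (hnat M n)) = hmul (hpow2 p) (hnat M (2 ^ n)).
Proof. by htransfer => p; rewrite expnD. Qed.

Lemma hpow2_lt_inv : forall p q : N, hlt (hpow2 p) (hpow2 q) -> hlt p q.
Proof. by htransfer => p q; rewrite ltn_exp2l. Qed.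

Lemma hpow2_above : forall c : N, exists e, hlt c (hpow2 e) /\
  hle (hpow2 e) (hadd c (hadd c (hnat M 1))).
Proof.
htransfer => -[|c]; first by exists 0.
exists (trunc_log 2 c.+1).+1; have /andP[h1 h2] := trunc_log_bounds (isT : 1 < 2) (isT : 0 < c.+1).
by split=> //; rewrite expnS; move: h1; move: (2 ^ _) => u; lia.
Qed.

Lemma hpow2_below : forall c : N, hlt (hnat M 0) c ->
  exists e, hle (hpow2 e) c /\ hlt c (hpow2 (hadd e (hnat M 1))).
Proof.
htransfer => c c0; exists (trunc_log 2 c); rewrite addn1.
by have /andP[h1 h2] := trunc_log_bounds (isT : 1 < 2) c0.
Qed.

Lemma additive_cofinal a : increasing a ->
  additive_cut (\bigcup_n below (hpow2 (a n))) /\ countably_cofinal (\bigcup_n below (hpow2 (a n))).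
Proof.
move=> ia; split; first split.
- by move=> x y [n _ xn] yx; exists n => //; move: xn yx; rewrite /below /=; move: (hpow2 _); hlia.
- move=> x y [m _ xm] [n _ yn]; exists (maxn m n).+1 => //.
  have h1 : hle (hpow2 (hadd (a (maxn m n)) (hnat M 1))) (hpow2 (a (maxn m n).+1)).
    by apply: hpow2_le; have := ia _ _ (ltnSn (maxn m n)); hlia.
  have h2 : hle (hpow2 (a m)) (hpow2 (a (maxn m n))).
    by apply: hpow2_le; apply: increasing_le => //; apply: leq_maxl.
  have h3 : hle (hpow2 (a n)) (hpow2 (a (maxn m n))).
    by apply: hpow2_le; apply: increasing_le => //; apply: leq_maxr.
  move: h1 h2 h3 xm yn; rewrite hpow2S /below /=.
  move: (hpow2 _) (hpow2 _) (hpow2 _) (hpow2 _); hlia.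
- by exists (fun n => hpow2 (a n)) => // m n mn; apply: hpow2_lt; apply: ia.
Qed.

Lemma additive_coinitial a : decreasing a ->
  additive_cut (\bigcap_n below (hpow2 (a n))) /\ countably_coinitial (\bigcap_n below (hpow2 (a n))).
Proof.
move=> ia; split; first split.
- by move=> x y hx yx n _; apply: hle_lt_trans yx _; apply: hx.
- move=> x y hx hy n _.
  have h1 : hle (hpow2 (hadd (a n.+1) (hnat M 1))) (hpow2 (a n)).
    by apply: hpow2_le; have := ia _ _ (ltnSn n); hlia.
  move: h1 (hx n.+1 Logic.I) (hy n.+1 Logic.I); rewrite hpow2S /below /=.
  move: (hpow2 _) (hpow2 _); hlia.
- by exists (fun n => hpow2 (a n)) => // m n mn; apply: hpow2_lt; apply: ia.
Qed.

Lemma increasingP a : (forall n, hlt (a n) (a n.+1)) -> increasing a.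
Proof.
move=> h m n /subnKC <-; elim: (n - m.+1) => [|k IH]; first by rewrite addn0.
by rewrite addnS; have := h (m.+1 + k); hlia.
Qed.

Lemma decreasingP a : (forall n, hlt (a n.+1) (a n)) -> decreasing a.
Proof.
move=> h m n /subnKC <-; elim: (n - m.+1) => [|k IH]; first by rewrite addn0.
by rewrite addnS; have := h (m.+1 + k); hlia.
Qed.

(** The next power of 2 above c_n is at most 2 c_n + 1, hence at most twice c_(n+1), and so stays in
    an additive cut. The recursion only makes the exponents strictly increasing. *)
Lemma cofinal_rep U : additive_cut U -> countably_cofinal U ->
  exists2 a, increasing a & U = \bigcup_n below (hpow2 (a n)).
Proof.
move=> [cutU addU] [c ic EU].
have cU n : U (c n) by rewrite EU; exists n.+1 => //; apply: ic.
have [e he] := choice (fun n => hpow2_above (c n)).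
have eU n : U (hpow2 (e n)).
  apply: cutU (addU _ _ (cU n.+1) (cU n.+1)) _.
  by have [_] := he n; have := ic _ _ (ltnSn n); move: (hpow2 _); hlia.
have step (q : N * nat) : exists p, U (hpow2 q.1) -> [/\ hlt q.1 p, hle (e q.2) p & U (hpow2 p)].
  case: q => q i /=; have [h|h] := hle_total (e i) (hadd q (hnat M 1)).
    exists (hadd q (hnat M 1)) => Uq; split=> //; first by hlia.
    by rewrite hpow2S; apply: addU.
  by exists (e i); split=> //; hlia.
have [g hg] := choice step.
pose a := fix a n := if n is m.+1 then g (a m, m) else e 0.
have aU n : U (hpow2 (a n)).
  by elim: n => [|n IH] //=; have [] := hg (a n, n) IH.
have aS n : hlt (a n) (a n.+1) /\ hle (e n) (a n.+1) by have [] := hg (a n, n) (aU n).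
clearbody a; exists a; first exact: increasingP (fun n => proj1 (aS n)).
apply/seteqP; split=> x; last by case=> n _ xn; apply: cutU (aU n) (hltW xn).
rewrite {1}EU => -[n _ xn]; exists n.+1 => //.
have [_ h] := aS n; have [h' _] := he n.
have := hpow2_le h => {}h; apply: hlt_le_trans h.
by move: xn h'; rewrite /below /=; move: (hpow2 _); hlia.
Qed.

Lemma coinitial_rep U : additive_cut U -> countably_coinitial U ->
  exists2 a, decreasing a & U = \bigcap_n below (hpow2 (a n)).
Proof.
move=> [cutU addU] [c ic EU].
have c0 n : hlt (hnat M 0) (c n) by have := ic _ _ (ltnSn n); hlia.
have cU n : ~ U (c n) by rewrite EU => /(_ n Logic.I); rewrite /below /=; hlia.
have [e he] := choice (fun n => hpow2_below (c0 n)).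
have eU n : ~ U (hpow2 (e n)).
  move=> h; apply: (cU n); apply: cutU (addU _ _ h h) _.
  by rewrite -hpow2S; have [_] := he n; move: (hpow2 _); hlia.
have U1 : U (hpow2 (hnat M 0)).
  rewrite EU => n _; rewrite hpow2_nat /below /=.
  by have := ic _ _ (ltnSn n); have := c0 n.+1; hlia.
(* Half of a power of 2 outside an additive cut is again outside; the exponent can be lowered
   because 1 lies in U. *)
have pos p : ~ U (hpow2 p) -> exists p', p = hadd p' (hnat M 1).
  move=> nU; have : p <> hnat M 0 by move=> h; apply: nU; rewrite h.
  by move: p {nU}; htransfer => -[//|p] _; exists p; rewrite addn1.
have step (q : N * nat) : exists p, ~ U (hpow2 q.1) -> [/\ hlt p q.1, hle p (e q.2) & ~ U (hpow2 p)].
  case: q => q i /=; have [h|nU] := pselect (U (hpow2 q)); first by exists q.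
  have [p' Ep] := pos _ nU.
  have nU' : ~ U (hpow2 p') by move=> h; apply: nU; rewrite Ep hpow2S; apply: addU.
  have [h|h] := hle_total p' (e i).
    by exists p' => _; split=> //; rewrite Ep; hlia.
  by exists (e i) => _; split=> //; rewrite ?Ep; hlia.
have [g hg] := choice step.
pose a := fix a n := if n is m.+1 then g (a m, m) else e 0.
have aU n : ~ U (hpow2 (a n)).
  by elim: n => [|n IH] //=; have [] := hg (a n, n) IH.
have aS n : hlt (a n.+1) (a n) /\ hle (a n.+1) (e n) by have [] := hg (a n, n) (aU n).
clearbody a; exists a; first exact: decreasingP (fun n => proj1 (aS n)).
apply/seteqP; split=> x.
  by move=> Ux n _; apply/hltP => h; apply: (aU n); apply: cutU Ux h.
move=> h; rewrite EU => n _.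
have := h n.+1 Logic.I; rewrite /below /=.
have [_ h'] := aS n; have [h'' _] := he n.
by have := hpow2_le h'; hlia.
Qed.

(** An index k at which the first relation fails for every n is the single witness that the converse
    relation asks for at each n. *)
Lemma inc_prec_total a b : inc_prec a b \/ inc_prec b a.
Proof.
have [|nab] := pselect (inc_prec a b); first by left.
right; have [k hk] : exists k, forall n, exists2 n', n < n' & forall k', k < k' ->
    hle (hsub (b k') (b k)) (hsub (a n') (a n)).
  apply: contrapT => nk; apply: nab => k; apply: contrapT => nn; apply: nk; exists k => n.
  apply: contrapT => nn'; apply: nn; exists n => n' lt_n; apply: contrapT => nk'; apply: nn'.
  exists n' => // k' kk'; have [//|h] := hle_total (hsub (b k') (b k)) (hsub (a n') (a n)).
  by exfalso; apply: nk'; exists k' => //; apply: hltW.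
by move=> n; exists k => k' kk'; have [n' nn' h] := hk n; exists n' => //; apply: h.
Qed.

Lemma dec_prec_total a b : dec_prec a b \/ dec_prec b a.
Proof.
have [|nab] := pselect (dec_prec a b); first by left.
right; have [k hk] : exists k, forall n, exists2 n', n < n' & forall k', k < k' ->
    hle (hsub (b k) (b k')) (hsub (a n) (a n')).
  apply: contrapT => nk; apply: nab => k; apply: contrapT => nn; apply: nk; exists k => n.
  apply: contrapT => nn'; apply: nn; exists n => n' lt_n; apply: contrapT => nk'; apply: nn'.
  exists n' => // k' kk'; have [//|h] := hle_total (hsub (b k) (b k')) (hsub (a n) (a n')).
  by exfalso; apply: nk'; exists k' => //; apply: hltW.
by move=> n; exists k => k' kk'; have [n' nn' h] := hk n; exists n' => //; apply: h.
Qed.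

Lemma cofinal_not_coinitial U : countably_cofinal U -> ~ countably_coinitial U.
Proof.
move=> [a ia EU] [b ib EV].
have aU n : U (a n) by rewrite EU; exists n.+1 => //; apply: ia.
have [||x hx] := @saturate M Nat (fun n => [set x : N | hle (a n) x /\ hlt x (b n)]).
- by move=> n; internal_tac.
- move=> n; exists (a n) => i le_in; split; first exact: increasing_le.
  by have := aU n; rewrite EV; apply.
have : U x by rewrite EV => n _; have [] := hx n.
by rewrite EU => -[n _]; have [] := hx n; rewrite /below /=; hlia.
Qed.

Lemma mulN_pow2 (c e : N) : hle (hpow2 e) c -> hlt c (hpow2 (hadd e (hnat M 1))) ->
  mulN c = \bigcup_n below (hpow2 (hadd e (hnat M n))).
Proof.
move=> ec ce; apply/seteqP; split=> x [n _ h].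
  exists n.+1 => //; move: h ce; rewrite /upto /below /= !hpow2_addn; move: (hpow2 e).
  clear ec; have : n < 2 ^ n by apply: ltn_expl.
  rewrite expn1 expnS; move: (2 ^ n) => k kn; move: c x; htransfer => c x p xc cp.
  by apply: leq_ltn_trans xc _; nia.
exists (2 ^ n) => //; move: h ec; rewrite /upto /below /= !hpow2_addn; move: (hpow2 e).
clear ce; move: (2 ^ n) => k; move: c x; htransfer => c x p; nia.
Qed.

Lemma divN_pow2 (c e : N) : hle (hpow2 e) c -> hlt c (hpow2 (hadd e (hnat M 1))) ->
  (forall n, hle (hnat M n) e) ->
  divN c = \bigcap_n below (hpow2 (hsub e (hnat M n))).
Proof.
move=> ec ce einf; apply/seteqP; split=> x h n hn.
  have := h (2 ^ n.+2); rewrite /= expn_gt0 => /(_ isT).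
  move: ce (einf n.+2); rewrite /upto /below /=; clear; move: x c e.
  htransfer => x c e ce en; have -> : 2 ^ (e - n) = 2 ^ (e + 1 - n.+2) * 2.
    by rewrite -expnSr; congr (_ ^ _); lia.
  have : c %/ 2 ^ n.+2 < 2 ^ (e + 1 - n.+2) by rewrite ltn_divLR ?expn_gt0 // -expnD subnK //; lia.
  by move: (c %/ _) (2 ^ (e + 1 - _)) => u v; lia.
have := h n Logic.I; move: ec (einf n) hn; rewrite /upto /below /=; clear.
move=> h1 h2 n1; move: h1 h2; move: x c e; htransfer => x c e ec en xe.
have n2 : n < 2 ^ n by apply: ltn_expl.
rewrite leq_divRL //; apply: leq_trans ec; rewrite -(subnK en) expnD.
by apply: leq_mul; apply: ltnW.
Qed.

Lemma slow_cofinal_rep U : slow U -> countably_cofinal U ->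
  exists e, U = \bigcup_n below (hpow2 (hadd e (hnat M n))).
Proof.
move=> [_ [[_ [c EU]]|[ci _]]] cU; last by have := cofinal_not_coinitial cU ci.
have c0 : hlt (hnat M 0) c.
  apply: contrapT => nc; have [a ia EU'] := cU.
  have : U (a 1) by rewrite EU'; exists 2 => //; apply: ia.
  rewrite EU => -[n _]; have := ia 0 1 isT; rewrite /upto /=.
  have -> : c = hnat M 0 by move: nc; hlia.
  by clear; move: (a 0) (a 1); htransfer; lia.
by have [e [h1 h2]] := hpow2_below c0; exists e; rewrite EU; apply: mulN_pow2.
Qed.

Lemma nonstandard_gt (c : N) : ~ range (hnat M) c -> forall n, hlt (hnat M n) c.
Proof.
move=> nc; elim=> [|n IH].
  have : c <> hnat M 0 by move=> E; apply: nc; exists 0.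
  by clear; move: c; hlia.
have : c <> hnat M n.+1 by move=> E; apply: nc; exists n.+1.
by move: IH; clear; move: c; hlia.
Qed.

Lemma slow_coinitial_rep U : slow U -> countably_coinitial U ->
  exists2 e, (forall n, hle (hnat M n) e) & U = \bigcap_n below (hpow2 (hsub e (hnat M n))).
Proof.
move=> [_ [[cU _]|[_ [c nc EU]]]] ci; first by have := cofinal_not_coinitial cU ci.
have cn := nonstandard_gt nc.
have [e [h1 h2]] := hpow2_below (cn 0).
have en n : hle (hnat M n) e.
  have := cn (2 ^ n); rewrite -hpow2_nat => h.
  have : hlt (hpow2 (hnat M n)) (hpow2 (hadd e (hnat M 1))).
    by move: h h2; move: (hpow2 _) (hpow2 _); hlia.
  by move/hpow2_lt_inv; hlia.
by exists e => //; rewrite EU; apply: divN_pow2.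
Qed.

Lemma slow_cofinal_prec U V :
  slow U -> countably_cofinal U -> additive_cut V -> countably_cofinal V ->
  cofinal_prec U V.
Proof.
move=> sU cU aV cV; have [e EU] := slow_cofinal_rep sU cU; have [b ib EV] := cofinal_rep aV cV.
exists (fun n => hadd e (hnat M n)), b; split=> //.
  by move=> m n mn; clear -mn; move: e; htransfer; lia.
move=> k; exists 0 => n' n0; exists (k + n'); first by lia.
by have := increasing_addn k n' ib; move: (b (k + n')) (b k); clear; move: e; htransfer; lia.
Qed.

Lemma slow_coinitial_prec U V :
  slow U -> countably_coinitial U -> additive_cut V -> countably_coinitial V ->
  coinitial_prec U V.
Proof.
move=> sU cU aV cV; have [e en EU] := slow_coinitial_rep sU cU; have [b ib EV] := coinitial_rep aV cV.
exists (fun n => hsub e (hnat M n)), b; split=> //.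
  by move=> m n mn; have := en n; clear -mn; move: e; htransfer; lia.
move=> k; exists 0 => n' n0; exists (k + n'); first by lia.
by have := decreasing_addn k n' ib; move: (b (k + n')) (b k); clear; move: e; htransfer; lia.
Qed.

(** If no later exponent is infinitely far above a n, all of them stay within finite distance of it,
    and U is 2^(a n) times the standard numbers, which is slow. *)
Lemma fast_cofinal_gaps U a : increasing a -> U = \bigcup_n below (hpow2 (a n)) -> ~ slow U ->
  forall n, exists n', forall j, hle (hadd (a n) (hnat M j)) (a n').
Proof.
move=> ia EU nU n; apply: contrapT => nn; apply: nU.
have {}nn n' : exists j, hlt (a n') (hadd (a n) (hnat M j)).
  apply: contrapT => nj; apply: nn; exists n' => j.
  by have [//|h] := hle_total (hadd (a n) (hnat M j)) (a n'); exfalso; apply: nj; exists j.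
have [h1 h2] := additive_cofinal ia; rewrite EU.
split=> //; left; split=> //; exists (hpow2 (a n)).
have lt1 : hlt (hpow2 (a n)) (hpow2 (hadd (a n) (hnat M 1))) by apply: hpow2_lt; hlia.
have le1 : hle (hpow2 (a n)) (hpow2 (a n)) by move: (hpow2 _); hlia.
rewrite (mulN_pow2 le1 lt1); apply/seteqP; split=> x [m _ xm].
  have [j hj] := nn m; exists j => //; apply: hlt_le_trans xm _; apply: hpow2_le; exact: hltW.
by exists (n + m) => //; apply: hlt_le_trans xm _; apply: hpow2_le; apply: increasing_addn.
Qed.

Lemma fast_coinitial_gaps U a : decreasing a -> U = \bigcap_n below (hpow2 (a n)) -> ~ slow U ->
  forall n, exists n', forall j, hle (hadd (a n') (hnat M j)) (a n).
Proof.
move=> ia EU nU n; apply: contrapT => nn; apply: nU.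
have {}nn n' : exists j, hlt (a n) (hadd (a n') (hnat M j)).
  apply: contrapT => nj; apply: nn; exists n' => j.
  by have [//|h] := hle_total (hadd (a n') (hnat M j)) (a n); exfalso; apply: nj; exists j.
have [h1 h2] := additive_coinitial ia; rewrite EU.
have an j : hle (hnat M j) (a n) by have := decreasing_addn n j ia; hlia.
split=> //; right; split=> //; exists (hpow2 (a n)).
  move=> [m _ Em]; have := an m; have : hlt (a n) (hpow2 (a n)).
    by move: (a n); htransfer => x; apply: ltn_expl.
  by rewrite -Em; hlia.
have lt1 : hlt (hpow2 (a n)) (hpow2 (hadd (a n) (hnat M 1))) by apply: hpow2_lt; hlia.
have le1 : hle (hpow2 (a n)) (hpow2 (a n)) by move: (hpow2 _); hlia.
rewrite (divN_pow2 le1 lt1 an); apply/seteqP; split=> x h m _.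
  apply: hlt_le_trans (h (n + m) Logic.I) _; apply: hpow2_le.
  by have := decreasing_addn n m ia; hlia.
have [j hj] := nn m; apply: hlt_le_trans (h j Logic.I) _; apply: hpow2_le.
by move: hj; hlia.
Qed.

End Cuts.

(** * Borel reductions *)

Lemma dist_eq_mul w u v : (u * w - v * w) + (v * w - u * w) < w -> u = v.
Proof. by rewrite -!mulnBl -mulnDl; case: w => // w; nia. Qed.

Lemma dist_mul_le w B u v : (u * w - v * w) + (v * w - u * w) < B * w + w ->
  (u * w - v * w) + (v * w - u * w) <= B * w.
Proof.
by rewrite -!mulnBl -mulnDl -mulSnr; case: w => [|w]; rewrite ?muln0 // ltn_pmul2r // leq_pmul2r.
Qed.

Lemma dist_mul_lt w B u v : (u * w - v * w) + (v * w - u * w) < B * w ->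
  (u * w - v * w) + (v * w - u * w) + w <= B * w.
Proof.
by rewrite -!mulnBl -mulnDl -mulSnr; case: w => [|w]; rewrite ?muln0 // ltn_pmul2r // leq_pmul2r.
Qed.

Lemma divn_eq_dist w x y : 0 < w -> x %/ w = y %/ w -> (x - y) + (y - x) < w.
Proof.
move=> w0 E; have := divn_eq x w; have := divn_eq y w; rewrite E.
have := ltn_pmod x w0; have := ltn_pmod y w0.
move: (x %% w) (y %% w) (y %/ w * w) => r s t; clear; lia.
Qed.

Lemma divn_neq_between w x y : x %/ w != y %/ w ->
  exists q, (x <= q * w /\ q * w <= y) \/ (y <= q * w /\ q * w <= x).
Proof.
case: w => [|w]; first by rewrite !divn0.
wlog xy : x y / x %/ w.+1 < y %/ w.+1.
  move=> W ne; have [h|h|h] := ltngtP (x %/ w.+1) (y %/ w.+1); first exact: W.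
    have [|q hq] := W y x h; first by rewrite eq_sym.
    by exists q; case: hq; [right|left].
  by rewrite h eqxx in ne.
move=> _; exists (y %/ w.+1); left; split; last exact: leq_trunc_div.
rewrite ltnW //; apply: leq_trans (ltn_ceil x (ltn0Sn w)) _.
by rewrite leq_pmul2r.
Qed.

(** Multiplying by 2^b and dividing by 2^a realises the factor 2^(b - a) for either sign of b - a;
    the rounding costs one binary digit. *)
Lemma scale_up a b p t x y : t + a = p + b -> (x - y) + (y - x) < 2 ^ p ->
  (x * 2 ^ b %/ 2 ^ a - y * 2 ^ b %/ 2 ^ a) + (y * 2 ^ b %/ 2 ^ a - x * 2 ^ b %/ 2 ^ a) < 2 ^ (t + 1).
Proof.
move=> E.
have bound u v : u <= v -> v - u < 2 ^ p -> v * 2 ^ b %/ 2 ^ a - u * 2 ^ b %/ 2 ^ a < 2 ^ (t + 1).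
  move=> uv vu; have := leq_divDl (2 ^ a) (u * 2 ^ b) ((v - u) * 2 ^ b).
  rewrite -mulnDl subnKC //.
  have : (v - u) * 2 ^ b %/ 2 ^ a < 2 ^ t.
    by rewrite ltn_divLR ?expn_gt0 // -expnD E expnD ltn_pmul2r ?expn_gt0.
  by rewrite [t + 1]addn1 expnS; move: (_ %/ _) (_ %/ _) (_ %/ _) (2 ^ t); clear; lia.
have le2 u v : u <= v -> u * 2 ^ b %/ 2 ^ a <= v * 2 ^ b %/ 2 ^ a.
  by move=> uv; apply: leq_div2r; apply: leq_mul.
have [xy|/ltnW xy] := leqP x y => D.
  rewrite (eqP (le2 _ _ xy)) add0n; apply: bound => //; apply: leq_ltn_trans D; apply: leq_addl.
rewrite (eqP (le2 _ _ xy)) addn0; apply: bound => //; apply: leq_ltn_trans D; apply: leq_addr.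
Qed.

Lemma scale_down a b p t x y : t + a = p + b ->
  (x * 2 ^ b %/ 2 ^ a - y * 2 ^ b %/ 2 ^ a) + (y * 2 ^ b %/ 2 ^ a - x * 2 ^ b %/ 2 ^ a) < 2 ^ t ->
  (x - y) + (y - x) < 2 ^ (p + 1).
Proof.
move=> E D.
have a0 : 0 < 2 ^ a by rewrite expn_gt0.
suff : ((x - y) + (y - x)) * 2 ^ b < 2 ^ (p + 1) * 2 ^ b by rewrite ltn_pmul2r ?expn_gt0.
have -> : 2 ^ (p + 1) * 2 ^ b = (2 ^ t).*2 * 2 ^ a.
  by rewrite -mul2n -expnS -!expnD; congr (_ ^ _); lia.
rewrite mulnDl !mulnBl; move: (x * 2 ^ b) (y * 2 ^ b) D => u v D.
have t0 : 0 < 2 ^ t by rewrite expn_gt0.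
have := divn_eq u (2 ^ a); have := divn_eq v (2 ^ a).
have := ltn_pmod u a0; have := ltn_pmod v a0.
move: D; move: (u %/ 2 ^ a) (v %/ 2 ^ a) (u %% _) (v %% _) a0 t0.
move: (2 ^ a) (2 ^ t) => A T q q' r r' A0 T0 D r1 r2 -> ->.
have : ((q - q') + (q' - q)) * A + A <= T * A by rewrite -mulSnr leq_pmul2r.
rewrite mulnDl !mulnBl -muln2 (mulnC T) -mulnA mul2n mulnC -addnn.
move: (q * A) (q' * A) (T * A) => ? ? ?; clear -r1 r2 A0 T0; lia.
Qed.

Definition low_digits (a a' b x : nat) : nat := ((x %/ 2 ^ a) %% 2 ^ (a' - a)) * 2 ^ b.

Lemma low_digits_small a a' b b' x : (a' - a) + 1 <= b' - b ->
  2 * (low_digits a a' b x + 2 ^ b) <= 2 ^ b'.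
Proof.
move=> h; rewrite /low_digits -mulSnr.
have /(leq_mul (leqnn 2)) : ((x %/ 2 ^ a) %% 2 ^ (a' - a)).+1 * 2 ^ b <= 2 ^ (a' - a) * 2 ^ b.
  by rewrite leq_pmul2r ?expn_gt0 // ltn_pmod // expn_gt0.
move/leq_trans; apply; rewrite -expnD -expnS; apply: leq_pexp2l => //; lia.
Qed.

Lemma low_digits_split a a' b x y : a <= a' ->
  x %/ 2 ^ a = y %/ 2 ^ a <->
  x %/ 2 ^ a' = y %/ 2 ^ a' /\ low_digits a a' b x = low_digits a a' b y.
Proof.
move=> aa'; have E z : z %/ 2 ^ a' = (z %/ 2 ^ a) %/ 2 ^ (a' - a).
  by rewrite -divnMA -expnD subnKC.
rewrite /low_digits !E; split=> [->//|[E1 /eqP]].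
rewrite eqn_pmul2r ?expn_gt0 // => /eqP E2.
by rewrite (divn_eq (x %/ 2 ^ a) (2 ^ (a' - a))) E1 E2 -divn_eq.
Qed.

(** * Moving blocks of binary digits *)

Section Stretch.
Variable M : universe.
Local Notation N := (hyperN M).
Implicit Types (a b : nat -> N) (U V : set N).

Definition hlow (a a' b x : N) : N :=
  hmul (hop modn (hdiv x (hpow2 a)) (hpow2 (hsub a' a))) (hpow2 b).

Lemma hlow_small : forall a a' b b' x : N, hle (hadd (hsub a' a) (hnat M 1)) (hsub b' b) ->
  hle (hmul (hnat M 2) (hadd (hlow a a' b x) (hpow2 b))) (hpow2 b').
Proof. by rewrite /hlow; htransfer => a a' b b' x; apply: low_digits_small. Qed.

Lemma hlow_split : forall a a' b x y : N, hle a a' ->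
  hdiv x (hpow2 a) = hdiv y (hpow2 a) <->
  hdiv x (hpow2 a') = hdiv y (hpow2 a') /\ hlow a a' b x = hlow a a' b y.
Proof. by rewrite /hlow; htransfer => a a' b x y; apply: low_digits_split. Qed.

Lemma digit_small : forall (b b' u r v s : N), hle b b' ->
  hle (hmul (hnat M 2) (hadd r (hpow2 b))) (hpow2 b') ->
  hle (hmul (hnat M 2) (hadd s (hpow2 b))) (hpow2 b') ->
  hle (hdist (hadd (hmul u (hpow2 b')) r) (hadd (hmul v (hpow2 b')) s)) (hpow2 b) ->
  u = v.
Proof.
htransfer => b b' u r v s bb hr hs D; apply: (@dist_eq_mul (2 ^ b')).
have : 0 < 2 ^ b by rewrite expn_gt0.
move: D hr hs; move: (2 ^ b') (2 ^ b) (u * _) (v * _); clear; lia.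
Qed.

(** The leading parts and 2^c are multiples of 2^b', while the trailing parts change the distance by
    less than 2^b'; so they cannot carry it across the threshold. *)
Lemma digit_le : forall (b' c u r v s : N), hle b' c ->
  hlt r (hpow2 b') -> hlt s (hpow2 b') ->
  hle (hdist (hadd (hmul u (hpow2 b')) r) (hadd (hmul v (hpow2 b')) s)) (hpow2 c) ->
  hle (hdist (hmul u (hpow2 b')) (hmul v (hpow2 b'))) (hpow2 c).
Proof.
htransfer => b' c u r v s bc hr hs; rewrite -(subnK bc) expnD => D; apply: dist_mul_le.
by move: D hr hs; move: (2 ^ b') (_ * _) (u * _) (v * _); clear; lia.
Qed.

Lemma digit_lt : forall (b' c u r v s : N), hle b' c ->
  hlt r (hpow2 b') -> hlt s (hpow2 b') ->
  hlt (hdist (hmul u (hpow2 b')) (hmul v (hpow2 b'))) (hpow2 c) ->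
  hlt (hdist (hadd (hmul u (hpow2 b')) r) (hadd (hmul v (hpow2 b')) s)) (hpow2 c).
Proof.
htransfer => b' c u r v s bc hr hs; rewrite -(subnK bc) expnD => /dist_mul_lt.
by move: hr hs; move: (2 ^ b') (_ * _) (u * _) (v * _); clear; lia.
Qed.

Lemma hlow_mul : forall a a' b b' x q : N, hle b b' ->
  exists q', hadd (hmul q (hpow2 b')) (hlow a a' b x) = hmul q' (hpow2 b).
Proof.
rewrite /hlow; htransfer => a a' b b' x q bb.
exists (q * 2 ^ (b' - b) + (x %/ 2 ^ a) %% 2 ^ (a' - a)).
by rewrite mulnDl -mulnA -expnD subnK.
Qed.

Definition same_digits (a x y : N) : Prop := hdiv x (hpow2 a) = hdiv y (hpow2 a).

(* [Phi] moves the block of binary digits between [a i.+1] and [a i] to the positions above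
   [b i.+1]; the extra 1 keeps a zero digit on top of each block, so that no carry can occur
   between blocks. *)
Lemma stretch_finite a b (I : nat) :
  (forall i, i < I -> hle (a i.+1) (a i)) ->
  (forall i, i < I -> hle (hadd (hsub (a i) (a i.+1)) (hnat M 1)) (hsub (b i) (b i.+1))) ->
  exists Phi : N -> N,
  [/\ @internal_fun M Nat Nat Phi,
      forall x y, same_digits (a I) x y <-> Phi x = Phi y,
      forall x, exists q, Phi x = hmul q (hpow2 (b I)),
      forall i, i <= I -> forall x y, same_digits (a i) x y ->
        hlt (hdist (Phi x) (Phi y)) (hpow2 (b i)) &
      forall i, i < I -> forall x y, hle (hdist (Phi x) (Phi y)) (hpow2 (b i.+1)) ->
        same_digits (a i) x y].
Proof.
(* Blocks are added from the top downwards; divisibility of the values by 2^(b I) keeps free the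
   positions into which the next block is written. *)
move=> da dab; elim: I da dab => [_ _|I IH da dab].
  exists (fun x => hmul (hdiv x (hpow2 (a 0))) (hpow2 (b 0))); split=> //.
  - by internal_tac.
  - rewrite /same_digits => x y; split=> [->//|].
    move: (hdiv _ _) (hdiv _ _) (b 0); htransfer => u v w /eqP.
    by rewrite eqn_pmul2r ?expn_gt0 // => /eqP.
  - by move=> x; exists (hdiv x (hpow2 (a 0))).
  - move=> i; rewrite leqn0 => /eqP -> x y ->; have := hpow2_gt0 (b 0); hlia.
have [||Phi [iPhi P0 Pm P1 P2]] := IH; try by move=> i iI; [apply: da || apply: dab]; lia.
have a1 := da I (ltnSn I); have b1 := dab I (ltnSn I).
have small x := hlow_small x b1.
pose r x := hlow (a I.+1) (a I) (b I.+1) x.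
have bb : hle (b I.+1) (b I) by move: b1; hlia.
have bi i : i <= I -> hle (b I) (b i).
  have h : forall k, hle (b I) (b (I - k)).
    elim=> [|k IHk]; first by rewrite subn0; hlia.
    have [kI|kI] := ltnP k I; last by move: IHk; rewrite (_ : I - k.+1 = I - k) //; lia.
    have kI' : I - k.+1 < I.+1 by lia.
    by have := dab _ kI'; rewrite (_ : (I - k.+1).+1 = I - k); [hlia|lia].
  by move=> iI; have := h (I - i); rewrite subKn.
have [q hq] := choice Pm.
have rlt x : hlt (r x) (hpow2 (b I)).
  by have := hlow_small x b1; rewrite -/(r x); have := hpow2_gt0 (b I.+1); hlia.
have key x y : hle (hdist (hadd (Phi x) (r x)) (hadd (Phi y) (r y))) (hpow2 (b I.+1)) -> Phi x = Phi y.
  move=> D; rewrite !hq (_ : q x = q y) //; move: D; rewrite !hq.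
  by apply: digit_small => //; apply: hlow_small.
exists (fun x => hadd (Phi x) (r x)); split.
- by rewrite /r /hlow; internal_tac.
- move=> x y; split=> [/(hlow_split (b I.+1) x y a1)[/P0 -> E]|E]; first by rewrite /r E.
  have EPhi : Phi x = Phi y by apply: key; rewrite E hdistxx; have := hpow2_gt0 (b I.+1); hlia.
  apply/(hlow_split (b I.+1) x y a1); split; first exact/P0.
  by move: E; rewrite EPhi -/(r x) -/(r y); move: (r x) (r y) (Phi y); clear; hlia.
- by move=> x; rewrite hq; apply: hlow_mul.
- move=> i; rewrite leq_eqVlt => /orP[/eqP->|iI] x y.
    move=> /(hlow_split (b I.+1) x y a1)[/P0 -> E].
    by rewrite /r E hdistxx; apply: hpow2_gt0.
  move=> /(P1 _ iI); rewrite !hq; apply: digit_lt => //; exact: bi.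
- move=> i; rewrite ltnS leq_eqVlt => /orP[/eqP->|iI] x y.
    by move=> /key /P0.
  move=> D; apply: (P2 _ iI); move: D; rewrite !hq; apply: digit_le => //; exact: bi.
Qed.

(** Functions are quantified through internal graphs: totality, single-valuedness and the two
    estimates are internal conditions, so maps serving finitely many exponents merge into one map.
    Four sequences of exponents allow both the decreasing and the increasing case. *)
Lemma saturate_fun (al be ga de : nat -> N) :
  (forall n, exists2 Phi : N -> N, @internal_fun M Nat Nat Phi & forall i, i <= n -> forall x y,
     (same_digits (al i) x y -> hlt (hdist (Phi x) (Phi y)) (hpow2 (be i))) /\
     (hle (hdist (Phi x) (Phi y)) (hpow2 (ga i)) -> same_digits (de i) x y)) ->
  exists2 Phi : N -> N, @internal_fun M Nat Nat Phi & forall i x y,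
     (same_digits (al i) x y -> hlt (hdist (Phi x) (Phi y)) (hpow2 (be i))) /\
     (hle (hdist (Phi x) (Phi y)) (hpow2 (ga i)) -> same_digits (de i) x y).
Proof.
move=> fin.
have [||F hF] := @saturate M (Pow (Prod Nat Nat)) (fun i => [set F : car M (Pow (Prod Nat Nat)) |
   (forall x : N, exists y : N, isin (pr y x) F) /\
   forall x y x' y' : N, isin (pr x' x) F -> isin (pr y' y) F ->
     (x = y -> x' = y') /\
     (hdiv x (hpow2 (al i)) = hdiv y (hpow2 (al i)) -> hlt (hdist x' y') (hpow2 (be i))) /\
     (hle (hdist x' y') (hpow2 (ga i)) -> hdiv x (hpow2 (de i)) = hdiv y (hpow2 (de i)))]).
- by move=> i; internal_tac.
- move=> n; have [Phi [F hF] H] := fin n; exists F => i iN; split.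
    by move=> x; exists (Phi x); apply/hF.
  by move=> x y x' y' /hF -> /hF ->; have [h1 h2] := H i iN x y; split=> [->|].
have [tot fn] := hF 0; have [Phi hPhi] := choice tot.
exists Phi.
  exists F => y x; split=> [->|h]; first exact: hPhi.
  by have [+ _] := fn x x y (Phi x) h (hPhi x); apply.
move=> i x y; have [_ h] := hF i.
by have [_ []] := h x y _ _ (hPhi x) (hPhi y).
Qed.

Lemma stretch_decreasing a b : decreasing a ->
  (forall i, hlt (hsub (a i) (a i.+1)) (hsub (b i) (b i.+1))) ->
  exists2 Phi : N -> N, @internal_fun M Nat Nat Phi & forall i x y,
     (same_digits (a i) x y -> hlt (hdist (Phi x) (Phi y)) (hpow2 (b i))) /\
     (hle (hdist (Phi x) (Phi y)) (hpow2 (b i.+1)) -> same_digits (a i) x y).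
Proof.
move=> ia ab; apply: (@saturate_fun a b (fun i => b i.+1) a) => n.
have [||Phi [iPhi _ _ P1 P2]] := @stretch_finite a b n.+1.
- by move=> i _; have := ia _ _ (ltnSn i); hlia.
- by move=> i _; have := ab i; hlia.
by exists Phi => // i iN x y; split; [apply: P1; lia|apply: P2; lia].
Qed.

Lemma stretch_increasing a b : increasing a ->
  (forall i, hlt (hsub (a i.+1) (a i)) (hsub (b i.+1) (b i))) ->
  exists2 Phi : N -> N, @internal_fun M Nat Nat Phi & forall i x y,
     (same_digits (a i) x y -> hlt (hdist (Phi x) (Phi y)) (hpow2 (b i))) /\
     (hle (hdist (Phi x) (Phi y)) (hpow2 (b i)) -> same_digits (a i.+1) x y).
Proof.
move=> ia ab; apply: (@saturate_fun a b b (fun i => a i.+1)) => n.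
(* The finite construction proceeds from large exponents to small ones, so the first n + 2 terms are
   read backwards. *)
have rv i : i < n.+1 -> (n.+1 - i.+1).+1 = n.+1 - i by lia.
have [||Phi [iPhi _ _ P1 P2]] := @stretch_finite (fun i => a (n.+1 - i)) (fun i => b (n.+1 - i)) n.+1.
- by move=> i iN; rewrite -(rv i iN); have := ia _ _ (ltnSn (n.+1 - i.+1)); hlia.
- by move=> i iN; rewrite -(rv i iN); have := ab (n.+1 - i.+1); hlia.
exists Phi => // i iN x y.
have Ei : n.+1 - (n.+1 - i) = i by lia.
have Ei' : n.+1 - (n - i) = i.+1 by lia.
have Ei'' : n.+1 - (n - i).+1 = i by lia.
split.
- by have := @P1 (n.+1 - i) (leq_subr _ _) x y; rewrite Ei.
- by have := @P2 (n - i) _ x y; rewrite Ei' Ei''; apply; lia.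
Qed.

End Stretch.

(** * Grid points, scaling maps and the resulting Borel reductions *)

Section Reductions.
Variable M : universe.
Local Notation N := (hyperN M).
Implicit Types (a b : nat -> N) (U V : set N).

(** Saturation moves the quantifier on [w] inside a decreasing intersection of internal sets, so
    this projection remains Borel. *)
Lemma borel_projection s t (T : nat -> nat -> set (car M (Prod s t))) :
  (forall n m, internal (T n m)) -> (forall n m, T n m.+1 `<=` T n m) ->
  borel [set z | exists w, exists n, forall m, T n m (pr z w)].
Proof.
move=> hT dec.
have -> : [set z | exists w, exists n, forall m, T n m (pr z w)] =
    \bigcup_n \bigcap_m [set z | exists w, T n m (pr z w)].
  apply/seteqP; split=> z; first by case=> w [n h]; exists n => // m _; exists w.
  case=> n _ h; have [|||w hw] := @saturate_dec M t (fun m => [set w | T n m (pr z w)]).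
  - by move=> m; internal_tac.
  - by move=> m w; apply: dec.
  - by move=> m; apply: h.
  - by exists w, n.
apply: borel_bigU => n; apply: borel_bigI => m; apply: internal_borel.
by internal_tac.
Qed.

(* Digitwise agreement [app] and nearness [E] differ only because of carries, in the classes which
   contain a grid point; moving those classes to their grid point reconciles the two relations. *)
Lemma carry_reduction (E app F : N -> N -> Prop) (G : set N) (Phi : N -> N)
    (T : nat -> nat -> set (car M (Prod Nat Nat))) :
  (forall x, E x x) -> (forall x y, E x y -> E y x) -> (forall x y z, E x y -> E y z -> E x z) ->
  (forall n m, internal (T n m)) -> (forall n m, T n m.+1 `<=` T n m) ->
  (forall x w, (exists n, forall m, T n m (pr x w)) <-> G w /\ E x w) ->
  (forall w w', G w -> G w' -> E w w' -> w = w') ->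
  (forall x, app x x) -> (forall x y, app x y -> E x y) ->
  (forall x y, E x y -> app x y \/ exists2 w, G w & E y w) ->
  @internal_fun M Nat Nat Phi -> (forall x y, app x y <-> F (Phi x) (Phi y)) ->
  @borel_le M Nat Nat E F.
Proof.
move=> Er Es Et hT dT TE uG appr appE Eapp iPhi red.
(* By [uG] a class has at most one grid point, so this choice is in fact a definable value. *)
pose z x := if pselect (exists2 w, G w & E x w) is left h then projT1 (cid2 h) else x.
have zP x : (G (z x) \/ (~ (exists2 w, G w & E x w) /\ z x = x)) /\ E x (z x).
  rewrite /z; case: pselect => [h|h]; last by split=> //; right.
  by case: cid2 => w /= Gw Ew; split=> //; left.
have zE x y : E x y <-> app (z x) (z y).
  have [hx Ex] := zP x; have [hy Ey] := zP y.
  split=> [xy|/appE zxy]; last by apply: Et Ex (Et _ _ _ zxy (Es _ _ Ey)).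
  case: hx => [Gx|[nx Zx]]; case: hy => [Gy|[ny Zy]].
  - by rewrite (uG (z x) (z y)) //; apply: Et (Es _ _ Ex) (Et _ _ _ xy Ey).
  - by exfalso; apply: ny; exists (z x) => //; apply: Et (Es _ _ xy) Ex.
  - by exfalso; apply: nx; exists (z y) => //; apply: Et xy Ey.
  - by rewrite Zx Zy; have [//|] := Eapp _ _ xy.
exists (fun x => Phi (z x)); last by move=> x y; rewrite zE red.
pose S n m := [set q : car M (Prod (Prod Nat Nat) Nat) |
  exists x y w, q = pr (pr x y) w /\ T n m (pr x w) /\ y = Phi w].
pose C n m := [set q : car M (Prod (Prod Nat Nat) Nat) |
  exists x y w, q = pr (pr x y) w /\ T n m (pr x w)].
pose near (D : nat -> nat -> set (car M (Prod (Prod Nat Nat) Nat))) :=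
  [set q | exists w, exists n, forall m, D n m (pr q w)].
have nearS x y : near S (pr x y) <-> exists w, [/\ G w, E x w & y = Phi w].
  split=> [[w [n h]]|[w [Gw Ew ->]]].
    have h' m : T n m (pr x w) /\ y = Phi w by have [? [? [? [/pr_inj[/pr_inj[-> ->] ->]]]]] := h m.
    have [Gw Ew] : G w /\ E x w by apply/TE; exists n => m; have [] := h' m.
    by exists w; split=> //; have [] := h' 0.
  have /TE[n h] : G w /\ E x w by [].
  by exists w, n => m; exists x, (Phi w), w; split=> //; split=> //; apply: h.
have nearC x y : near C (pr x y) <-> exists2 w, G w & E x w.
  split=> [[w [n h]]|[w Gw Ew]].
    have h' m : T n m (pr x w) by have [? [? [? [/pr_inj[/pr_inj[-> _] ->]]]]] := h m.
    have [Gw Ew] : G w /\ E x w by apply/TE; exists n.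
    by exists w.
  have /TE[n h] : G w /\ E x w by [].
  by exists w, n => m; exists x, y, w; split.
(* [near S] is the graph over the classes with a grid point; elsewhere [z x] is x. In [C] the
   coordinate y is unrestricted, so that its projection can be removed from a set of pairs. *)
suff -> : graph (fun x => Phi (z x)) = near S `|` (graph Phi `&` ~` near C).
  apply: borel_setU.
    apply: borel_projection => n m; first by rewrite /S; internal_tac.
    by move=> q [x [y [w [-> [h ->]]]]]; exists x, (Phi w), w; split=> //; split=> //; apply: dT.
  apply: borel_setI; first by apply: internal_borel; apply: internal_fun_graph.
  apply: borel_setC; apply: borel_projection => n m; first by rewrite /C; internal_tac.
  by move=> q [x [y [w [-> h]]]]; exists x, y, w; split=> //; apply: dT.
apply/seteqP; split=> q.
  case=> x ->; have [[Gx|[nx Zx]] Ex] := zP x; first by left; apply/nearS; exists (z x).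
  by right; split; [exists x; rewrite Zx|move/nearC].
have [x [y ->]] := pr_surj q.
case=> [/nearS[w [Gw Ew ->]]|[[x' /pr_inj[<- ->]] /nearC nC]]; exists x.
  have [[Gx|[nx _]] Ex] := zP x; last by exfalso; apply: nx; exists w.
  by rewrite (uG w (z x)) //; apply: Et (Es _ _ Ew) Ex.
by have [[Gx|[_ ->//]] Ex] := zP x; exfalso; apply: nC; exists (z x).
Qed.

Lemma same_digits_near : forall a x y : N, same_digits a x y -> hlt (hdist x y) (hpow2 a).
Proof.
by rewrite /same_digits; htransfer => a x y; apply: divn_eq_dist; rewrite expn_gt0.
Qed.

Definition grid (p w : N) : Prop := exists q, w = hmul q (hpow2 p).

Lemma not_same_digits_between : forall a x y : N, ~ same_digits a x y ->
  exists w, grid a w /\ ((hle x w /\ hle w y) \/ (hle y w /\ hle w x)).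
Proof.
rewrite /same_digits /grid; htransfer => a x y /eqP /divn_neq_between[q hq].
by exists (q * 2 ^ a); split=> //; exists q.
Qed.

Lemma grid_le : forall p p' w : N, hle p p' -> grid p' w -> grid p w.
Proof.
rewrite /grid; htransfer => p p' w pp [q ->]; exists (q * 2 ^ (p' - p)).
by rewrite -mulnA -expnD subnK.
Qed.

Lemma grid_eq : forall p w w' : N, grid p w -> grid p w' -> hlt (hdist w w') (hpow2 p) -> w = w'.
Proof.
by rewrite /grid; htransfer => p w w' [q ->] [q' ->] /dist_eq_mul ->.
Qed.

Lemma monadic_refl U : U (hnat M 0) -> forall x, monadic U x x.
Proof. by move=> U0 x; rewrite /monadic hdistxx. Qed.

Lemma monadic_sym U x y : monadic U x y -> monadic U y x.
Proof. by rewrite /monadic hdistC. Qed.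

Lemma monadic_trans U x y z : additive_cut U -> monadic U x y -> monadic U y z -> monadic U x z.
Proof.
move=> [cutU addU] h1 h2; apply: cutU (addU _ _ h1 h2) _; clear; hlia.
Qed.

Lemma hscale_up : forall a b p t x y : N, hadd t a = hadd p b -> hlt (hdist x y) (hpow2 p) ->
  hlt (hdist (hdiv (hmul x (hpow2 b)) (hpow2 a)) (hdiv (hmul y (hpow2 b)) (hpow2 a)))
    (hpow2 (hadd t (hnat M 1))).
Proof. by htransfer => a b p t x y; apply: scale_up. Qed.

Lemma hscale_down : forall a b p t x y : N, hadd t a = hadd p b ->
  hlt (hdist (hdiv (hmul x (hpow2 b)) (hpow2 a)) (hdiv (hmul y (hpow2 b)) (hpow2 a))) (hpow2 t) ->
  hlt (hdist x y) (hpow2 (hadd p (hnat M 1))).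
Proof. by htransfer => a b p t x y; apply: scale_down. Qed.

(* Here [da] and [db] are the distances between the terms of two monotone sequences of exponents:
   either the two cuts of exponents are translates of each other, or along suitable subsequences
   the gaps of the second sequence are larger. *)
Lemma gap_dichotomy (da db : nat -> nat -> N) :
  (forall n m n', n <= m -> m < n' -> hle (da m n') (da n n')) ->
  (forall k k1 k2, k1 <= k2 -> hle (db k k1) (db k k2)) ->
  (forall k, exists n, forall n', n < n' -> exists2 k', k < k' & hle (da n n') (db k k')) ->
  (exists k n, (forall n', n < n' -> exists2 k', k < k' & hle (da n n') (db k k')) /\
     (forall k', exists2 n', n < n' & hle (db k k') (da n n'))) \/
  (exists nu ka : nat -> nat, [/\ forall i, nu i < nu i.+1, forall i, ka i < ka i.+1 &
     forall i, hlt (da (nu i) (nu i.+1)) (db (ka i) (ka i.+1))]).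
Proof.
move=> dam dbm prec.
pose work (p : nat * nat) := forall n', p.1 < n' -> exists2 k', p.2 < k' & hle (da p.1 n') (db p.2 k').
have [[k [n [h1 h2]]]|nex] := pselect (exists k n, work (n, k) /\
    (forall k', exists2 n', n < n' & hle (db k k') (da n n'))).
  by left; exists k, n.
right.
have step (p : nat * nat) : exists p' : nat * nat, work p ->
    [/\ work p', p.1 < p'.1, p.2 < p'.2 & hlt (da p.1 p'.1) (db p.2 p'.2)].
  case: p => n k; have [wnk|nw] := pselect (work (n, k)); last by exists (n, k).
  (* Outside the first alternative, some gap from k exceeds all gaps from n; [prec] then restores
     the invariant [work] at a later pair. *)
  have [k' hk'] : exists k', forall n', n < n' -> hlt (da n n') (db k k').
    apply: contrapT => nk'; apply: nex; exists k, n; split=> // k'.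
    apply: contrapT => nn'; apply: nk'; exists k' => n' lt_n; apply: contrapT => h.
    by apply: nn'; exists n' => //; apply: contrapT => /hltP.
  pose k1 := maxn k' k.+1; have [n1 hn1] := prec k1.
  exists (maxn n1 n.+1, k1) => _; split=> /=.
  - move=> n' /= lt_n; have [|k2 lt_k h] := hn1 n'; first by lia.
    by exists k2 => //=; apply: hle_trans h; apply: dam => //; lia.
  - by lia.
  - by rewrite /k1; lia.
  - by apply: hlt_le_trans (hk' _ _) (dbm _ _ _ _); rewrite /k1; lia.
have [g hg] := choice step.
have [n0 hn0] := prec 0.
pose p := fix p i := if i is j.+1 then g (p j) else (n0, 0).
have wp i : work (p i) by elim: i => [//|i IH]; have [] := hg _ IH.
exists (fun i => (p i).1), (fun i => (p i).2).
by split=> i; have [] := hg _ (wp i).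
Qed.

Lemma strict_mono_ge (nu : nat -> nat) : (forall i, nu i < nu i.+1) -> forall i, i <= nu i.
Proof. by move=> h; elim=> // i IH; have := h i; lia. Qed.

Lemma strict_mono_lt (nu : nat -> nat) : (forall i, nu i < nu i.+1) -> forall i j, i < j -> nu i < nu j.
Proof.
move=> h i j /subnKC <-; elim: (j - i.+1) => [|k IH]; first by rewrite addn0.
by rewrite addnS; apply: ltn_trans IH (h _).
Qed.

Lemma cofinal_subseq a (nu : nat -> nat) : increasing a -> (forall i, nu i < nu i.+1) ->
  \bigcup_n below (hpow2 (a n)) = \bigcup_n below (hpow2 (a (nu n))).
Proof.
move=> ia hnu; apply/seteqP; split=> x [n _ xn]; last by exists (nu n).
exists n => //; apply: hlt_le_trans xn _; apply: hpow2_le; apply: increasing_le => //.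
exact: strict_mono_ge.
Qed.

Lemma coinitial_subseq a (nu : nat -> nat) : decreasing a -> (forall i, nu i < nu i.+1) ->
  \bigcap_n below (hpow2 (a n)) = \bigcap_n below (hpow2 (a (nu n))).
Proof.
move=> ia hnu; apply/seteqP; split=> x h n _; first exact: h.
apply: hlt_le_trans (h n Logic.I) _; apply: hpow2_le; apply: decreasing_le => //.
exact: strict_mono_ge.
Qed.

Lemma stretch_cofinal_le U V a b : increasing a ->
  U = \bigcup_n below (hpow2 (a n)) -> V = \bigcup_n below (hpow2 (b n)) ->
  (forall i, hlt (hsub (a i.+1) (a i)) (hsub (b i.+1) (b i))) ->
  borel_le (monadic U) (monadic V).
Proof.
move=> ia EU EV gaps.
have [Phi iPhi hPhi] := stretch_increasing ia gaps.
have [aU _] := additive_cofinal ia; rewrite -EU in aU.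
have U0 : U (hnat M 0) by rewrite EU; exists 0 => //; apply: hpow2_gt0.
apply: (@carry_reduction _ (fun x y => exists n, same_digits (a n) x y) _
  [set w | forall n, grid (a n) w] Phi
  (fun n m => [set z | exists x w,
     z = pr x w /\ (grid (a m) w /\ hlt (hdist x w) (hpow2 (a n)))])) => //.
- exact: monadic_refl.
- exact: monadic_sym.
- by move=> x y z; apply: monadic_trans.
- by move=> n m; rewrite /grid; internal_tac.
- move=> n m z [x [w [-> [g D]]]]; exists x, w; split=> //; split=> //.
  by apply: grid_le g; apply: increasing_le.
- move=> x w; rewrite /monadic EU; split=> [[n h]|[g [n _ D]]]; last by exists n => m; exists x, w.
  have h' m : grid (a m) w /\ hlt (hdist x w) (hpow2 (a n)).
    by have [? [? [/pr_inj[-> ->]]]] := h m.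
  by split=> [m|]; [have [] := h' m|exists n => //; have [] := h' 0].
- move=> w w' g g'; rewrite /monadic EU => -[n _ D]; exact: grid_eq (g n) (g' n) D.
- by move=> x; exists 0.
- by move=> x y [n /same_digits_near D]; rewrite /monadic EU; exists n.
- move=> x y; rewrite {1}/monadic EU => -[n _ D].
  have [|nex] := pselect (exists m, same_digits (a m) x y); [by left|right].
  have ns m : ~ same_digits (a m) x y by move=> h; apply: nex; exists m.
  (* Disagreement at every level m puts a multiple of 2^(a m) between x and y. Since x and y are
     within 2^(a n), only one multiple of 2^(a n) fits there, so these points coincide for all m
     above n. *)
  have [w [gw bw]] := not_same_digits_between (ns n).
  exists w.
    move=> m; have [w' [gw' bw']] := not_same_digits_between (ns (maxn n m)).
    have gn' : grid (a n) w' by apply: grid_le gw'; apply: increasing_le => //; lia.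
    rewrite (@grid_eq (a n) w w') //; first by apply: grid_le gw'; apply: increasing_le => //; lia.
    by move: D bw bw'; rewrite /below /=; hlia.
  by exists n => //; move: D bw; rewrite /below /=; hlia.
- move=> x y; rewrite /monadic EV; split=> [[n h]|[k _ D]].
    by exists n => //; have [P _] := hPhi n x y; apply: P.
  by exists k.+1; have [_] := hPhi k x y; apply; apply: hltW.
Qed.

Lemma cofinal_prec_borel_le U V : cofinal_prec U V -> borel_le (monadic U) (monadic V).
Proof.
move=> [a [b [ia ib ab EU EV]]].
have [|||] := @gap_dichotomy (fun n n' => hsub (a n') (a n)) (fun k k' => hsub (b k') (b k)) _ _ ab.
- by move=> n m n' nm _; have := increasing_le ia nm; hlia.
- by move=> k k1 k2 kk; have := increasing_le ib kk; hlia.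
(* The gaps from n and from k are cofinal in each other, so scaling by 2^(b k - a n) is already a
   reduction. *)
- move=> [k [n [h1 h2]]].
  apply: (@internal_fun_le _ _ _ _ _ (fun x => hdiv (hmul x (hpow2 (b k))) (hpow2 (a n)))).
    by internal_tac.
  move=> x y; rewrite /monadic EU EV; split=> [[m _ D]|[k' _ D]].
    have nm : n < maxn n.+1 m by lia.
    have [k' kk' h] := h1 _ nm.
    have an := increasing_le ia (ltnW nm).
    exists k'.+1 => //.
    set m' := maxn n.+1 m in nm h an *.
    apply: hlt_le_trans (@hscale_up (a n) (b k) (a m') (hadd (b k) (hsub (a m') (a n))) x y _ _) _.
    + by move: an; hlia.
    + by apply: hlt_le_trans D _; apply: hpow2_le; apply: increasing_le => //; lia.
    + apply: hpow2_le; have := increasing_le ib (ltnW kk'); have := ib _ _ (ltnSn k').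
      by move: h; hlia.
  have [n' nn' h] := h2 k'.
  have an := increasing_le ia (ltnW nn').
  exists n'.+1 => //.
  apply: hlt_le_trans (@hscale_down (a n) (b k) (a n') (hadd (b k) (hsub (a n') (a n))) x y _ _) _.
  + by move: an; hlia.
  + by apply: hlt_le_trans D _; apply: hpow2_le; move: h; hlia.
  + by apply: hpow2_le; have := ia _ _ (ltnSn n'); hlia.
move=> [nu [ka [hnu hka gaps]]].
rewrite (cofinal_subseq ia hnu) in EU; rewrite (cofinal_subseq ib hka) in EV.
apply: (stretch_cofinal_le (a := fun i => a (nu i)) (b := fun i => b (ka i))) => // i j ij.
by apply: ia; apply: strict_mono_lt.
Qed.

Lemma stretch_coinitial_le U V a b : decreasing a ->
  U = \bigcap_n below (hpow2 (a n)) -> V = \bigcap_n below (hpow2 (b n)) ->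
  (forall i, hlt (hsub (a i) (a i.+1)) (hsub (b i) (b i.+1))) ->
  borel_le (monadic U) (monadic V).
Proof.
move=> ia EU EV gaps.
have [Phi iPhi hPhi] := stretch_decreasing ia gaps.
have [aU _] := additive_coinitial ia; rewrite -EU in aU.
have U0 : U (hnat M 0) by rewrite EU => n _; apply: hpow2_gt0.
apply: (@carry_reduction _ (fun x y => forall n, same_digits (a n) x y) _
  [set w | exists n, grid (a n) w] Phi
  (fun n m => [set z | exists x w,
     z = pr x w /\ (grid (a n) w /\ hlt (hdist x w) (hpow2 (a m)))])) => //.
- exact: monadic_refl.
- exact: monadic_sym.
- by move=> x y z; apply: monadic_trans.
- by move=> n m; rewrite /grid; internal_tac.
- move=> n m z [x [w [-> [g D]]]]; exists x, w; split=> //; split=> //.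
  by apply: hlt_le_trans D _; apply: hpow2_le; apply: decreasing_le.
- move=> x w; rewrite /monadic EU; split=> [[n h]|[[n g] D]]; last first.
    by exists n => m; exists x, w; split=> //; split=> //; apply: D.
  have h' m : grid (a n) w /\ hlt (hdist x w) (hpow2 (a m)).
    by have [? [? [/pr_inj[-> ->]]]] := h m.
  by split=> [|m _]; [exists n; have [] := h' 0|have [] := h' m].
- move=> w w' [n g] [n' g']; rewrite /monadic EU => D.
  apply: (@grid_eq (a (maxn n n'))); last exact: D.
    by apply: grid_le g; apply: decreasing_le => //; lia.
  by apply: grid_le g'; apply: decreasing_le => //; lia.
- by move=> x y h; rewrite /monadic EU => n _; apply: same_digits_near.
- move=> x y; rewrite {1}/monadic EU => D.
  have [|/existsNP[m ns]] := pselect (forall m, same_digits (a m) x y); [by left|right].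
  have [w [gw bw]] := not_same_digits_between ns.
  exists w; first by exists m.
  by move=> n _; have := D n Logic.I; move: bw; rewrite /below /=; hlia.
- move=> x y; rewrite /monadic EV; split=> [h n _|D n].
    by have [P _] := hPhi n x y; apply: P.
  by have [_] := hPhi n x y; apply; apply: hltW; apply: D.
Qed.

Lemma coinitial_prec_borel_le U V : coinitial_prec U V -> borel_le (monadic U) (monadic V).
Proof.
move=> [a [b [ia ib ab EU EV]]].
have [|||] := @gap_dichotomy (fun n n' => hsub (a n) (a n')) (fun k k' => hsub (b k) (b k')) _ _ ab.
- by move=> n m n' nm _; have := decreasing_le ia nm; hlia.
- by move=> k k1 k2 kk; have := decreasing_le ib kk; hlia.
- move=> [k [n [h1 h2]]].
  apply: (@internal_fun_le _ _ _ _ _ (fun x => hdiv (hmul x (hpow2 (b k))) (hpow2 (a n)))).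
    by internal_tac.
  have tE n' : n < n' -> hadd (hsub (b k) (hsub (a n) (a n'))) (a n) = hadd (a n') (b k).
    move=> nn'; have [k' kk' h] := h1 _ nn'.
    by have := decreasing_le ia (ltnW nn'); move: h; hlia.
  move=> x y; rewrite /monadic EU EV; split=> D m _.
    have [n' nn' h] := h2 (maxn k m).+1.
    apply: hlt_le_trans (@hscale_up (a n) (b k) (a n') _ x y (tE _ nn') (D n' Logic.I)) _.
    apply: hpow2_le; have km : m < (maxn k m).+1 by lia.
    have kk : k <= (maxn k m).+1 by lia.
    by have := decreasing_le ib kk; have := ib _ _ km; move: h; hlia.
  have nn' : n < (maxn n m).+1 by lia.
  have [k' kk' h] := h1 _ nn'.
  apply: hlt_le_trans (@hscale_down (a n) (b k) (a (maxn n m).+1) _ x y (tE _ nn') _) _.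
  + apply: hlt_le_trans (D k' Logic.I) _; apply: hpow2_le.
    by have := decreasing_le ib (ltnW kk'); move: h; hlia.
  + by apply: hpow2_le; have mm : m < (maxn n m).+1 by [lia]; have := ia _ _ mm; hlia.
move=> [nu [ka [hnu hka gaps]]].
rewrite (coinitial_subseq ia hnu) in EU; rewrite (coinitial_subseq ib hka) in EV.
apply: (stretch_coinitial_le (a := fun i => a (nu i)) (b := fun i => b (ka i))) => // i j ij.
by apply: ia; apply: strict_mono_lt.
Qed.

End Reductions.

(** * Smoothness of the slow cofinal cuts *)

Lemma divn_dist_le w k x y : 0 < w -> (x - y) + (y - x) < w * k ->
  (x %/ w - y %/ w) + (y %/ w - x %/ w) <= k.
Proof.
move=> w0; wlog xy : x y / x <= y.
  move=> W; have [h|/ltnW h] := leqP x y; first exact: W.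
  by rewrite addnC [X in _ -> X <= _]addnC; apply: W.
rewrite (eqP xy) (eqP (leq_div2r w xy)) !add0n => D.
have := leq_divDl w x (y - x); rewrite subnKC //.
have : (y - x) %/ w < k by rewrite ltn_divLR // mulnC.
by move: (_ %/ _) (_ %/ _) (_ %/ _); clear; lia.
Qed.

Lemma divn_dist_lt w n x y : 0 < w -> (x %/ w - y %/ w) + (y %/ w - x %/ w) <= n ->
  (x - y) + (y - x) < w * n.+1.
Proof.
move=> w0; wlog xy : x y / x <= y.
  move=> W; have [h|/ltnW h] := leqP x y; first exact: W.
  by rewrite addnC [X in _ -> X < _]addnC; apply: W.
rewrite (eqP xy) (eqP (leq_div2r w xy)) !add0n => D.
rewrite ltn_subLR // mulnC; apply: leq_trans (ltn_ceil y w0) _.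
apply: leq_trans (leq_add (leq_trunc_div x w) (leqnn _)).
by rewrite -mulnDl leq_pmul2r //; move: D; move: (_ %/ _) (_ %/ _); clear; lia.
Qed.

Section Smooth.
Variable M : universe.
Local Notation N := (hyperN M).
Implicit Types (U V : set N).

Lemma cd_family t (T : countType) (Y : T -> set (car M t)) (A : set (car M t)) :
  (forall i, internal (Y i)) ->
  (forall x y, (forall i, Y i x <-> Y i y) -> A x -> A y) -> countably_determined A.
Proof.
move=> hY dY; apply/cdP; exists (fun n => if unpickle n is Some i then Y i else set0).
  by move=> n; case: unpickle => [i|] //; apply: internal_set0.
move=> x y xy; apply: dY => i.
by have := xy (pickle i); rewrite pickleK.
Qed.

Definition finite_dist (x y : N) : Prop := exists n, hle (hdist x y) (hnat M n).

Definition residue (n : nat) (x : N) : N := hop modn x (hnat M (2 ^ n)).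

Definition same_residues (x y : N) : Prop := forall n, residue n x = residue n y.

Lemma finite_dist_sym x y : finite_dist x y -> finite_dist y x.
Proof. by case=> n h; exists n; rewrite hdistC. Qed.

Lemma finite_dist_trans x y z : finite_dist x y -> finite_dist y z -> finite_dist x z.
Proof.
case=> m h [n h']; exists (m + n).
have E : forall m n, hnat M (m + n) = hadd (hnat M m) (hnat M n) by move=> m' n'; htransfer.
by rewrite E; move: h h'; hlia.
Qed.

Lemma hle_natP n : forall x : N, hle x (hnat M n) -> exists2 k, k <= n & x = hnat M k.
Proof.
elim: n => [|n IH] x h.
  by exists 0 => //; hlia.
have [/IH[k kn ->]|E] : hle x (hnat M n) \/ x = hnat M n.+1 by hlia.
  by exists k => //; apply: leqW.
by exists n.+1.
Qed.

Lemma residue_standard n x : exists k, residue n x = hnat M k.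
Proof.
have [|k _ ->] := @hle_natP (2 ^ n) (residue n x); last by exists k.
by rewrite /residue; move: x; htransfer => x; rewrite ltnW // ltn_pmod ?expn_gt0.
Qed.

(** A distance of at most n is below 2^n, so it is divisible by 2^n only if it vanishes. *)
Lemma same_residues_eq x y : finite_dist x y -> same_residues x y -> x = y.
Proof.
move=> [n D] /(_ n); rewrite /residue; move: x y D; htransfer => x y D E.
have n2 : n < 2 ^ n by apply: ltn_expl.
wlog xy : x y D E / x <= y.
  by move=> W; have [h|/ltnW h] := leqP x y; [exact: W|symmetry; apply: W => //; rewrite addnC].
have : (y - x) %% 2 ^ n = 0 by apply/eqP; rewrite -/(dvdn _ _) -eqn_mod_dvd // E.
rewrite modn_small; first by move: D xy; clear; lia.
by move: D xy n2; move: (2 ^ n); clear; lia.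
Qed.

Lemma residue_add n m : forall x y : N, residue n x = residue n y ->
  residue n (hadd x (hnat M m)) = residue n (hadd y (hnat M m)).
Proof. by rewrite /residue; htransfer => x y /eqP E; apply/eqP; rewrite eqn_modDr. Qed.

Lemma residue_sub n m : forall x y : N, residue n (hadd x (hnat M m)) = residue n (hadd y (hnat M m)) ->
  residue n x = residue n y.
Proof. by rewrite /residue; htransfer => x y /eqP; rewrite eqn_modDr => /eqP. Qed.

(** Closing the orbit of x under equality of residues makes it depend on countably many internal
    properties of x only, while it remains an invariant of the finite-distance class. *)
Definition residue_class (x : N) : set N := [set y | exists2 x', finite_dist x x' & same_residues x' y].

Lemma residue_class_eq x y : finite_dist x y -> residue_class x = residue_class y.
Proof.
move=> xy; apply/seteqP; split=> z [x' h r]; exists x' => //.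
  by apply: finite_dist_trans h; apply: finite_dist_sym.
exact: finite_dist_trans h.
Qed.

(* The standard bounds matter only for standard [x], where [x - k] may be truncated. *)
Lemma residue_class_type x y : same_residues x y -> (forall k, hlt x (hnat M k) <-> hlt y (hnat M k)) ->
  residue_class x `<=` residue_class y.
Proof.
move=> xy small z [x' [n D] r].
have [h|h] := hle_total x x'.
  have [k _ E] : exists2 k, k <= n & hsub x' x = hnat M k by apply: hle_natP; move: D h; hlia.
  exists (hadd y (hnat M k)); first by exists k; hlia.
  move=> i; rewrite -r (_ : x' = hadd x (hnat M k)); first exact/residue_add.
  by rewrite -E; move: h; hlia.
have [k _ E] : exists2 k, k <= n & hsub x x' = hnat M k by apply: hle_natP; move: D h; hlia.
have yk : ~ hlt y (hnat M k).
  by move/small; rewrite -E; move: h; hlia.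
exists (hsub y (hnat M k)); first by exists k; hlia.
move=> i; rewrite -r; apply/esym/(@residue_sub i k).
rewrite (_ : hadd (hsub y (hnat M k)) (hnat M k) = y).
  by rewrite -E (_ : hadd _ _ = x) //; move: h; hlia.
by move: yk; hlia.
Qed.

(** Choice is applied to the set and not to a point of it, so equal classes receive equal
    elements. *)
Definition element (A : set N) : N :=
  if pselect (exists y, A y) is left h then projT1 (cid h) else hnat M 0.

Definition class_rep (x : N) : N := element (residue_class x).

Lemma class_repP x : exists y, finite_dist x y /\ same_residues y (class_rep x).
Proof.
have : residue_class x (class_rep x).
  rewrite /class_rep /element; case: pselect => [h|[]]; first by case: cid.
  by exists x; exists x => //; exists 0; rewrite hdistxx; hlia.
by case=> y h r; exists y.
Qed.

(** [class_rep x] may be infinitely far from x. Only its residues are used: they select exactly one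
    point at finite distance from x. *)
Definition finite_transversal (x : N) : N := projT1 (cid (class_repP x)).

Lemma finite_transversalP x y : y = finite_transversal x <->
  finite_dist x y /\ same_residues y (class_rep x).
Proof.
rewrite /finite_transversal; case: cid => z /= [d r]; split=> [->//|[d' r']].
apply: same_residues_eq; last by move=> n; rewrite r' r.
by apply: finite_dist_trans d; apply: finite_dist_sym.
Qed.

Lemma finite_transversal_eq x y : finite_dist x y <-> finite_transversal x = finite_transversal y.
Proof.
have [dx rx] := (proj1 (finite_transversalP x _) erefl).
have [dy ry] := (proj1 (finite_transversalP y _) erefl).
split=> [xy|E].
  apply/finite_transversalP; split; first by apply: finite_dist_trans dx; apply: finite_dist_sym.
  by rewrite /class_rep -(residue_class_eq xy).
by apply: finite_dist_trans dx _; rewrite E; apply: finite_dist_sym.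
Qed.

(** Division by 2^e turns E_U into finite distance, for which [finite_transversal] picks
    representatives. The factor [d] spreads them out so that [F] cannot identify two of them. *)
Lemma slow_cofinal_cd_le U (e d : N) (F : N -> N -> Prop) :
  U = \bigcup_n below (hpow2 (hadd e (hnat M n))) -> hlt (hnat M 0) d ->
  (forall y y' : N, F (hmul y d) (hmul y' d) <-> y = y') ->
  @cd_le M Nat Nat (monadic U) F.
Proof.
move=> EU d0 hF.
have mulI : forall y y' : N, hmul y d = hmul y' d -> y = y'.
  by move: d d0 {hF}; htransfer => d d0 y y' /eqP; rewrite eqn_pmul2r // => /eqP.
pose u x := hdiv x (hpow2 e).
have uE x y : monadic U x y <-> finite_dist (u x) (u y).
  rewrite /monadic EU; split=> [[n _]|[n]].
    rewrite /below /u /= => D; exists (2 ^ n).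
    move: D; clear; move: x y e; htransfer => x y e; rewrite expnD.
    by apply: divn_dist_le; rewrite expn_gt0.
  rewrite /u => D; exists n.+1 => //; rewrite /below /=.
  move: D; clear; move: x y e; htransfer => x y e D.
  apply: leq_trans (divn_dist_lt _ D) _; first by rewrite expn_gt0.
  by rewrite expnD leq_mul2l (ltnW (ltn_expl n.+1 (isT : 1 < 2))) orbT.
exists (fun x => hmul (finite_transversal (u x)) d); last first.
  by move=> x y; rewrite uE hF finite_transversal_eq.
have iu : @internal_fun M Nat Nat u by rewrite /u; internal_tac.
(* Two Booleans select the kind of condition: distance of the value from [u x], residues of the
   value, residues of [u x], and standard size of [u x]. *)
pose Y (i : bool * bool * (nat * nat)) : set (car M (Prod Nat Nat)) := match i with
  | (true, true, (n, _)) =>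
      [set z | exists x y, z = pr x (hmul y d) /\ hle (hdist (u x) y) (hnat M n)]
  | (true, false, (n, k)) =>
      [set z | exists x y, z = pr x (hmul y d) /\ hop modn y (hnat M (2 ^ n)) = hnat M k]
  | (false, true, (n, k)) =>
      [set z | exists x y, z = pr x y /\ hop modn (u x) (hnat M (2 ^ n)) = hnat M k]
  | (false, false, (n, _)) => [set z | exists x y, z = pr x y /\ hlt (u x) (hnat M n)]
  end.
apply: (@cd_family _ _ Y).
  by case=> [[[] []] [n k]]; rewrite /Y; internal_tac.
move=> z1 z2 h [x1 E1]; rewrite {z1}E1 in h.
set y1 := finite_transversal (u x1) in h.
have [[n D1] r1] : finite_dist (u x1) y1 /\ same_residues y1 (class_rep (u x1)).
  exact/finite_transversalP.
have [x2 [y2 [Ez D2]]] : Y (true, true, (n, 0)) z2 by apply/h; exists x1, y1.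
rewrite {z2}Ez in h *.
have resy : same_residues y2 y1.
  move=> m; have [k Ek] := residue_standard m y1; rewrite Ek.
  have : Y (true, false, (m, k)) (pr x2 (hmul y2 d)) by apply/h; exists x1, y1.
  by case=> [x [y [/pr_inj[_ /mulI ->]]]].
have resu : same_residues (u x1) (u x2).
  move=> m; have [k Ek] := residue_standard m (u x1); rewrite Ek.
  have : Y (false, true, (m, k)) (pr x2 (hmul y2 d)) by apply/h; exists x1, (hmul y1 d).
  by case=> [x [y [/pr_inj[-> _]]]].
have small k : hlt (u x1) (hnat M k) <-> hlt (u x2) (hnat M k).
  have hk := h (false, false, (k, 0)); split=> l.
    have /hk : Y (false, false, (k, 0)) (pr x1 (hmul y1 d)) by exists x1, (hmul y1 d).
    by case=> [x [y [/pr_inj[-> _]]]].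
  have /hk : Y (false, false, (k, 0)) (pr x2 (hmul y2 d)) by exists x2, (hmul y2 d).
  by case=> [x [y [/pr_inj[-> _]]]].
exists x2; congr (pr _ (hmul _ d)); apply/finite_transversalP; split; first by exists n.
have Ec : residue_class (u x1) = residue_class (u x2).
  apply/seteqP; split; first exact: residue_class_type.
  by apply: residue_class_type => [m|k]; [rewrite resu|rewrite small].
by rewrite /class_rep -Ec => m; rewrite resy r1.
Qed.

Lemma internal_max : forall (B : car M (Pow Nat)) (z : N), (forall x : N, isin x B -> hle x z) ->
  exists b : N, (forall x : N, isin x B -> hle x b) /\ ((exists x : N, isin x B) -> isin b B).
Proof.
htransfer => B z Bz; have [[x0 Bx0]|ne] := pselect (exists x, B x); last first.
  by exists 0; split=> [x Bx|//]; exfalso; apply: ne; exists x.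
have ex : exists x, `[< B x >] by exists x0; apply/asboolP.
have ub x : `[< B x >] -> x <= z by move/asboolP/Bz.
case: (ex_maxnP ex ub) => b /asboolP Bb hb; exists b; split=> // x Bx.
by apply: hb; apply/asboolP.
Qed.

Lemma additive_cut0 U : additive_cut U -> U <> set0 -> U (hnat M 0).
Proof.
move=> [cutU _] U0; apply: contrapT => n0; apply: U0; apply/seteqP; split=> // x Ux.
by apply: n0; apply: cutU Ux _; hlia.
Qed.

Lemma not_full U : U <> setT -> exists x, ~ U x.
Proof.
move=> UT; apply: contrapT => h; apply: UT; apply/seteqP; split=> // x _.
by apply: contrapT => nx; apply: h; exists x.
Qed.

(** Either the approximations along some branch never fall inside U, and points of them outside U
    are coinitial in the complement; or every branch has an approximation inside U, and the maxima
    of these countably many internal sets are cofinal. The cut {0} is set apart because 1 in U is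
    what makes the cofinal sequence strictly increasing. *)
Lemma cd_cut_cases U : additive_cut U -> @countably_determined M Nat U ->
  U <> set0 -> U <> setT -> U <> [set hnat M 0] -> countably_cofinal U \/ countably_coinitial U.
Proof.
move=> [cutU addU] [F [X [hX dec EU]]] U0 UT U1.
have ltU x y : U x -> ~ U y -> hlt x y.
  by move=> Ux nUy; apply/hltP => h; apply: nUy; apply: cutU Ux h.
have [z0 nz0] := not_full UT.
have Uzero : U (hnat M 0) by apply: additive_cut0.
have Uone : U (hnat M 1).
  apply: contrapT => n1; apply: U1; apply/seteqP; split=> x; last by move=> ->.
  by move=> Ux; have := ltU _ _ Ux n1; rewrite /=; hlia.
have [[f [Ff hf]]|nf] := pselect (exists f, F f /\ forall m, exists x, X (mkseq f m) x /\ ~ U x).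
  right; have [y hy] := choice hf.
  have yU m : ~ U (y m) by have [] := hy m.
  have below_y z : ~ U z -> exists m, hlt (y m) z.
    (* If every [y m] were at least z, saturation would give a point of the branch, hence of U, that
       is at least z. *)
    move=> nUz; apply: contrapT => nm.
    have [|||x hx] := @saturate_dec M Nat (fun m => [set x : N | X (mkseq f m) x /\ hle z x]).
    - by move=> m; internal_tac.
    - by move=> m x [h zx]; split=> //; apply: dec h; rewrite mkseqS; apply: prefix_rcons.
    - move=> m; exists (y m); split; first by have [] := hy m.
      by apply: contrapT => /hltP h; apply: nm; exists m.
    apply: nUz; apply: cutU (_ : U x) _; last by have [] := hx 0.
    by rewrite EU; exists f => // m _; have [] := hx m.
  have step (q : N * nat) : exists z, ~ U q.1 -> [/\ ~ U z, hlt z q.1 & hlt z (y q.2)].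
    case: q => c i /=; have [h|h] := hle_total c (y i).
      have [Uc|nUc] := pselect (U c); first by exists c.
      by have [m hm] := below_y _ nUc; exists (y m) => _; split=> //; move: h hm; hlia.
    by have [m hm] := below_y _ (yU i); exists (y m) => _; split=> //; move: h hm; hlia.
  have [g hg] := choice step.
  pose c := fix c n := if n is m.+1 then g (c m, m) else z0.
  have cU n : ~ U (c n) by elim: n => [//|n IH]; have [] := hg (c n, n) IH.
  have cS n : hlt (c n.+1) (c n) /\ hlt (c n.+1) (y n) by have [] := hg (c n, n) (cU n).
  clearbody c; exists c; first exact: decreasingP (fun n => proj1 (cS n)).
  apply/seteqP; split=> x; first by move=> Ux n _; apply: ltU.
  move=> h; apply: contrapT => nUx; have [m hm] := below_y _ nUx.
  by have := h m.+1 Logic.I; have [_] := cS m; move: hm; rewrite /below /=; hlia.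
left.
pose B n := if unpickle n is Some u then if pselect (X u `<=` U) then X u else set0 else set0.
have BU n : B n `<=` U.
  by rewrite /B; case: unpickle => [u|]; [case: pselect => ? // x []|move=> x []].
have hB n : @internal M Nat (B n).
  by rewrite /B; case: unpickle => [u|]; [case: pselect => ?; [exact: hX|]|]; apply: internal_set0.
have UB x : U x -> exists n, B n x.
  rewrite EU => -[f Ff h].
  have [m hm] : exists m, X (mkseq f m) `<=` U.
    apply: contrapT => nm; apply: nf; exists f; split=> // m; apply: contrapT => nx.
    by apply: nm; exists m => z Xz; apply: contrapT => nUz; apply: nx; exists z.
  by exists (pickle (mkseq f m)); rewrite /B pickleK; case: pselect => // ?; apply: h.
have max n : exists b, U b /\ forall x, B n x -> hle x b.
  have [code _ Ecode] := hB n.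
  have [|b [h1 h2]] := @internal_max code z0.
    by move=> x xc; apply: hltW; apply: ltU => //; apply: (BU n); rewrite -Ecode.
  have [ex|nex] := pselect (exists x : N, isin x code).
    exists b; split; first by apply: (BU n); rewrite -Ecode; apply: h2.
    by rewrite -Ecode.
  by exists (hnat M 0); split=> // x; rewrite -Ecode => Bx; exfalso; apply: nex; exists x.
have [b hb] := choice max.
pose c := fix c n := if n is m.+1 then hadd (hadd (c m) (b m)) (hnat M 1) else hnat M 0.
have cU n : U (c n).
  elim: n => [//|n IH]; apply: (addU _ _ _ Uone); apply: addU => //; by have [] := hb n.
have cS n : c n.+1 = hadd (hadd (c n) (b n)) (hnat M 1) by [].
clearbody c; exists c; first by apply: increasingP => n; rewrite cS; hlia.
apply/seteqP; split=> x; last by case=> n _ h; apply: cutU (cU n) (hltW h).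
move=> /UB[n Bx]; exists n.+1 => //; rewrite /below /= cS.
by have [_ /(_ _ Bx)] := hb n; hlia.
Qed.

End Smooth.

(** * Fast cuts *)

Section Scales.
Variable M : universe.
Local Notation N := (hyperN M).
Implicit Types (a b : nat -> N) (U V : set N).

Lemma monadic_scale U d : additive_cut U -> U (hnat M 0) -> ~ U d ->
  forall y y', monadic U (hmul y d) (hmul y' d) <-> y = y'.
Proof.
move=> [cutU _] U0 nd y y'; split=> [h|->]; last by rewrite /monadic hdistxx.
apply: contrapT => ne; apply: nd; apply: cutU h _.
by move: y y' d ne; htransfer => y y' d ne; nia.
Qed.

Lemma eqN_monadic U : additive_cut U -> U <> set0 -> U <> setT -> borel_le (eqN M) (monadic U).
Proof.
move=> aU U0 UT; have [d nd] := not_full UT.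
apply: (@internal_fun_le _ _ _ _ _ (fun x => hmul x d)); first by internal_tac.
by move=> x y; rewrite monadic_scale //; apply: additive_cut0.
Qed.

Lemma fast_cofinal_rep U : additive_cut U -> countably_cofinal U -> ~ slow U ->
  exists a, [/\ increasing a, U = \bigcup_n below (hpow2 (a n)) &
    forall i j, hle (hadd (a i) (hnat M j)) (a i.+1)].
Proof.
move=> aU cU nU; have [a ia EU] := cofinal_rep aU cU.
have [g hg] := choice (fast_cofinal_gaps ia EU nU).
pose nu := fix nu i := if i is j.+1 then g (nu j) else 0.
have nuS i : nu i < nu i.+1.
  rewrite ltnNge; apply/negP => /(increasing_le ia); have := hg (nu i) 1; rewrite /=; hlia.
exists (fun i => a (nu i)); split.
- by move=> i j ij; apply: ia; apply: strict_mono_lt.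
- by rewrite EU; apply: cofinal_subseq.
- by move=> i j; apply: hg.
Qed.

Lemma fast_coinitial_rep U : additive_cut U -> countably_coinitial U -> ~ slow U ->
  exists a, [/\ decreasing a, U = \bigcap_n below (hpow2 (a n)) &
    forall i j, hle (hadd (a i.+1) (hnat M j)) (a i)].
Proof.
move=> aU cU nU; have [a ia EU] := coinitial_rep aU cU.
have [g hg] := choice (fast_coinitial_gaps ia EU nU).
pose nu := fix nu i := if i is j.+1 then g (nu j) else 0.
have nuS i : nu i < nu i.+1.
  rewrite ltnNge; apply/negP => /(decreasing_le ia); have := hg (nu i) 1; rewrite /=; hlia.
exists (fun i => a (nu i)); split.
- by move=> i j ij; apply: ia; apply: strict_mono_lt.
- by rewrite EU; apply: coinitial_subseq.
- by move=> i j; apply: hg.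
Qed.

Lemma gaps_fast_cofinal a : (forall i j, hle (hadd (a i) (hnat M j)) (a i.+1)) ->
  [/\ increasing a, countably_cofinal (\bigcup_n below (hpow2 (a n))) &
      fast (\bigcup_n below (hpow2 (a n)))].
Proof.
move=> gap; have ia : increasing a by apply: increasingP => n; have := gap n 1; hlia.
have [aU cU] := additive_cofinal ia; split=> //; split=> //; first by left.
move=> /slow_cofinal_rep/(_ cU)[e E].
have [i _ h] : (\bigcup_n below (hpow2 (a n))) (hpow2 e).
  by rewrite E; exists 1 => //; apply: hpow2_lt; hlia.
have [n _ h'] : (\bigcup_n below (hpow2 (hadd e (hnat M n)))) (hpow2 (a i.+1)).
  by rewrite -E; exists i.+2 => //; apply: hpow2_lt; apply: ia.
have := hpow2_lt_inv h; have := hpow2_lt_inv h'; have := gap i n; hlia.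
Qed.

Lemma gaps_fast_coinitial a : (forall i j, hle (hadd (a i.+1) (hnat M j)) (a i)) ->
  [/\ decreasing a, countably_coinitial (\bigcap_n below (hpow2 (a n))) &
      fast (\bigcap_n below (hpow2 (a n)))].
Proof.
move=> gap; have ia : decreasing a by apply: decreasingP => n; have := gap n 1; hlia.
have [aU cU] := additive_coinitial ia; split=> //; split=> //; first by right.
move=> /slow_coinitial_rep/(_ cU)[e en E].
have [i hi] : exists i, hle (a i) e.
  apply: contrapT => ni; have : (\bigcap_n below (hpow2 (a n))) (hpow2 e).
    by move=> i _; apply: hpow2_lt; apply/hltP => h; apply: ni; exists i.
  by rewrite E => /(_ 0 Logic.I) /hpow2_lt_inv; hlia.
have : (\bigcap_n below (hpow2 (a n))) (hpow2 (a i.+1)).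
  rewrite E => n _; apply: hpow2_lt; have := gap i n.+1; have := en n; move: hi; hlia.
by move=> /(_ i.+1 Logic.I); rewrite /below /=; hlia.
Qed.

(** A standard n meets the first n + 1 conditions because each [de i] is infinite. The square makes
    room for all standard multiples of d inside one gap. *)
Lemma infinite_square_below (de : nat -> N) : (forall i j, hle (hnat M j) (de i)) ->
  exists d, (forall j, hle (hnat M j) d) /\ forall i, hle (hmul d d) (de i).
Proof.
move=> inf.
have [||d hd] := @saturate M Nat
    (fun i => [set d : N | hle (hnat M i) d /\ hle (hmul d d) (de i)]).
- by move=> i; internal_tac.
- move=> n; exists (hnat M n) => i iN; split; first by htransfer.
  have -> : hmul (hnat M n) (hnat M n) = hnat M (n * n) by htransfer.
  exact: inf.
- by exists d; split=> i; have [] := hd i.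
Qed.

(** Exponent sequences with constant gap d. The decreasing one starts at d * d, which exceeds every
    standard multiple of an infinite d, so the subtraction is never truncated. *)
Definition inc_scale (d : N) (n : nat) : N := hmul (hnat M n) d.
Definition dec_scale (d : N) (n : nat) : N := hsub (hmul d d) (hmul (hnat M n) d).

Lemma inc_scaleS d n : inc_scale d n.+1 = hadd (inc_scale d n) d.
Proof. by rewrite /inc_scale; move: d; htransfer => d; lia. Qed.

Lemma dec_scaleS d n : (forall j, hle (hnat M j) d) -> dec_scale d n = hadd (dec_scale d n.+1) d.
Proof. by move=> /(_ n.+1); rewrite /dec_scale; move: d; htransfer => d; nia. Qed.

Lemma dec_scaleE d n : (forall j, hle (hnat M j) d) ->
  hsub (dec_scale d 0) (dec_scale d n) = inc_scale d n.
Proof. by move=> /(_ n.+1); rewrite /dec_scale /inc_scale; move: d; htransfer => d; nia. Qed.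

Lemma inc_scale_lt d n : (forall j, hle (hnat M j) d) -> hlt (inc_scale d n) (hmul d d).
Proof. by move=> /(_ n.+1); rewrite /inc_scale; move: d; htransfer => d; nia. Qed.

Lemma inc_scale0 d : inc_scale d 0 = hnat M 0.
Proof. by rewrite /inc_scale; move: d; htransfer. Qed.

Lemma inc_scale_gaps d : (forall j, hle (hnat M j) d) ->
  forall i j, hle (hadd (inc_scale d i) (hnat M j)) (inc_scale d i.+1).
Proof. by move=> inf i j; rewrite inc_scaleS; have := inf j; move: (inc_scale d i); hlia. Qed.

Lemma dec_scale_gaps d : (forall j, hle (hnat M j) d) ->
  forall i j, hle (hadd (dec_scale d i.+1) (hnat M j)) (dec_scale d i).
Proof.
by move=> inf i j; rewrite (dec_scaleS i inf); have := inf j; move: (dec_scale d i.+1); hlia.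
Qed.

Lemma square_infinite d : (forall j, hle (hnat M j) d) -> hle d (hmul d d).
Proof. by move=> /(_ 1); move: d; htransfer => d; nia. Qed.

(** Any finite number of steps of the scale adds up to less than d * d, hence to less than a single
    gap of [a]. *)
Lemma inc_prec_scale a d : (forall j, hle (hnat M j) d) -> increasing a ->
  (forall i, hle (hmul d d) (hsub (a i.+1) (a i))) ->
  inc_prec (inc_scale d) a /\ ~ inc_prec a (inc_scale d).
Proof.
move=> inf ia gap; split.
  move=> k; exists 0 => n _; exists (k + n.+1); first by lia.
  suff : hle (hadd (a k) (inc_scale d n)) (a (k + n.+1)).
    by rewrite inc_scale0; move: (inc_scale d n); hlia.
  have {}gap i : hle (hadd (a i) d) (a i.+1).
    by have := square_infinite inf; have := gap i; have := ia _ _ (ltnSn i); move: (hmul d d); hlia.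
  have h m : hle (hadd (a k) (inc_scale d m)) (a (k + m)).
    elim: m => [|m IH]; first by rewrite addn0 inc_scale0; hlia.
    by rewrite inc_scaleS addnS; have := gap (k + m); move: IH; move: (inc_scale d m); hlia.
  by rewrite addnS; have := h n; have := ia _ _ (ltnSn (k + n)); move: (inc_scale d n); hlia.
move=> /(_ 0)[n /(_ n.+1 (ltnSn n))[k' _]]; rewrite inc_scale0.
have := gap n; have := inc_scale_lt k' inf; move: (hmul d d) (inc_scale d k'); hlia.
Qed.

(** A single step of the scale exceeds every term of [a], hence every difference of its terms. *)
Lemma inc_scale_prec a d : (forall n, hlt (a n) d) ->
  inc_prec a (inc_scale d) /\ ~ inc_prec (inc_scale d) a.
Proof.
move=> bd; split.
  move=> k; exists 0 => n _; exists k.+1 => //; rewrite inc_scaleS.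
  by have := bd n; move: (inc_scale d k); hlia.
move=> /(_ 0)[n /(_ n.+1 (ltnSn n))[k' _]]; rewrite inc_scaleS.
by have := bd k'; move: (inc_scale d n); hlia.
Qed.

Lemma dec_prec_scale a d : (forall j, hle (hnat M j) d) -> decreasing a ->
  (forall i, hle (hmul d d) (hsub (a i) (a i.+1))) ->
  dec_prec (dec_scale d) a /\ ~ dec_prec a (dec_scale d).
Proof.
move=> inf ia gap; split.
  move=> k; exists 0 => n n0; exists (k + n); first by lia.
  rewrite dec_scaleE //.
  have {}gap i : hle (hadd (a i.+1) d) (a i).
    by have := square_infinite inf; have := gap i; have := ia _ _ (ltnSn i); move: (hmul d d); hlia.
  have h m : hle (hadd (a (k + m)) (inc_scale d m)) (a k).
    elim: m => [|m IH]; first by rewrite addn0 inc_scale0; hlia.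
    by rewrite inc_scaleS addnS; have := gap (k + m); move: IH; move: (inc_scale d m); hlia.
  by have := h n; move: (inc_scale d n); hlia.
move=> /(_ 0)[n /(_ n.+1 (ltnSn n))[k' _]]; rewrite dec_scaleE //.
have := gap n; have := inc_scale_lt k' inf; move: (hmul d d) (inc_scale d k'); hlia.
Qed.

Lemma dec_scale_prec a d : (forall j, hle (hnat M j) d) -> (forall n, hlt (a n) d) ->
  dec_prec a (dec_scale d) /\ ~ dec_prec (dec_scale d) a.
Proof.
move=> inf bd; split.
  move=> k; exists 0 => n _; exists k.+1 => //; rewrite (dec_scaleS k inf).
  by have := bd 0; move: (dec_scale d k.+1); hlia.
move=> /(_ 0)[n /(_ n.+1 (ltnSn n))[k' _]]; rewrite (dec_scaleS n inf).
by have := bd 0; move: (dec_scale d n.+1); hlia.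
Qed.

Lemma cofinal_borel_lt a b : increasing a -> increasing b -> inc_prec a b -> ~ inc_prec b a ->
  borel_lt (monadic (\bigcup_n below (hpow2 (a n)))) (monadic (\bigcup_n below (hpow2 (b n)))).
Proof.
move=> ia ib ab nba; split; first by apply: cofinal_prec_borel_le; exists a, b.
by move=> /borel_le_cd[f cdf red]; apply: nba; apply: cofinal_neg cdf red.
Qed.

Lemma coinitial_borel_lt a b : decreasing a -> decreasing b -> dec_prec a b -> ~ dec_prec b a ->
  borel_lt (monadic (\bigcap_n below (hpow2 (a n)))) (monadic (\bigcap_n below (hpow2 (b n)))).
Proof.
move=> ia ib ab nba; split; first by apply: coinitial_prec_borel_le; exists a, b.
by move=> /borel_le_cd[f cdf red]; apply: nba; apply: coinitial_neg cdf red.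
Qed.

Lemma family_bounds (a : nat -> nat -> N) :
  (forall n j, exists i, hle (hnat M j) (a n i)) ->
  exists d, (forall j, hle (hnat M j) d) /\ forall n i, hlt (a n i) d.
Proof.
move=> inf; have [A hA] := upper_bound (fun k => if unpickle k is Some (n, i) then a n i else hnat M 0).
have {}hA n i : hle (a n i) A by have := hA (pickle (n, i)); rewrite pickleK.
exists (hadd A (hnat M 1)); split=> [j|n i]; last by move: (hA n i); move: (a n i); hlia.
by have [i] := inf 0 j; move: (hA 0 i); move: (a 0 i); hlia.
Qed.

Lemma family_gaps (de : nat -> nat -> N) : (forall n i j, hle (hnat M j) (de n i)) ->
  exists d, (forall j, hle (hnat M j) d) /\ forall n i, hle (hmul d d) (de n i).
Proof.
move=> inf.
have [|d [h1 h2]] := @infinite_square_below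
    (fun k => if unpickle k is Some (n, i) then de n i else de 0 0).
  by move=> k j; case: unpickle => [[n i]|].
by exists d; split=> // n i; have := h2 (pickle (n, i)); rewrite pickleK.
Qed.

Lemma cofinal_fast_unbounded (W : nat -> set N) :
  (forall n, countably_cofinal (W n) /\ fast (W n)) ->
  exists U' V' : set N,
    [/\ countably_cofinal U' /\ fast U', countably_cofinal V' /\ fast V' &
        forall n, borel_lt (monadic U') (monadic (W n)) /\ borel_lt (monadic (W n)) (monadic V')].
Proof.
move=> hW.
have /choice[a ha] : forall n, exists a, [/\ increasing a, W n = \bigcup_i below (hpow2 (a i)) &
    forall i j, hle (hadd (a i) (hnat M j)) (a i.+1)].
  by move=> n; have [c [h1 _ h2]] := hW n; apply: fast_cofinal_rep.
have [|d [infd hd]] := @family_gaps (fun n i => hsub (a n i.+1) (a n i)).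
  by move=> n i j; have [_ _ g] := ha n; have := g i j; move: (a n i) (a n i.+1); hlia.
have [|D [infD hD]] := @family_bounds a.
  by move=> n j; exists (0 + j); have [ia _ _] := ha n; have := increasing_addn 0 j ia;
    move: (a n 0) (a n (0 + j)); hlia.
have [id cd fd] := gaps_fast_cofinal (inc_scale_gaps infd).
have [iD cD fD] := gaps_fast_cofinal (inc_scale_gaps infD).
exists (\bigcup_n below (hpow2 (inc_scale d n))), (\bigcup_n below (hpow2 (inc_scale D n))).
split=> // n; have [ia -> g] := ha n; split; apply: cofinal_borel_lt => //.
- by case: (inc_prec_scale infd ia (hd n)).
- by case: (inc_prec_scale infd ia (hd n)).
- by case: (inc_scale_prec (hD n)).
- by case: (inc_scale_prec (hD n)).
Qed.

Lemma coinitial_fast_unbounded (W : nat -> set N) :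
  (forall n, countably_coinitial (W n) /\ fast (W n)) ->
  exists U' V' : set N,
    [/\ countably_coinitial U' /\ fast U', countably_coinitial V' /\ fast V' &
        forall n, borel_lt (monadic U') (monadic (W n)) /\ borel_lt (monadic (W n)) (monadic V')].
Proof.
move=> hW.
have /choice[a ha] : forall n, exists a, [/\ decreasing a, W n = \bigcap_i below (hpow2 (a i)) &
    forall i j, hle (hadd (a i.+1) (hnat M j)) (a i)].
  by move=> n; have [c [h1 _ h2]] := hW n; apply: fast_coinitial_rep.
have [|d [infd hd]] := @family_gaps (fun n i => hsub (a n i) (a n i.+1)).
  by move=> n i j; have [_ _ g] := ha n; have := g i j; move: (a n i) (a n i.+1); hlia.
have [|D [infD hD]] := @family_bounds a.
  by move=> n j; exists 0; have [ia _ _] := ha n; have := decreasing_addn 0 j ia;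
    move: (a n 0) (a n (0 + j)); hlia.
have [id cd fd] := gaps_fast_coinitial (dec_scale_gaps infd).
have [iD cD fD] := gaps_fast_coinitial (dec_scale_gaps infD).
exists (\bigcap_n below (hpow2 (dec_scale d n))), (\bigcap_n below (hpow2 (dec_scale D n))).
split=> // n; have [ia -> g] := ha n; split; apply: coinitial_borel_lt => //.
- by case: (dec_prec_scale infd ia (hd n)).
- by case: (dec_prec_scale infd ia (hd n)).
- by case: (dec_scale_prec infD (hD n)).
- by case: (dec_scale_prec infD (hD n)).
Qed.

Lemma monadic_coinitial_approx V b : decreasing b -> V = \bigcap_n below (hpow2 (b n)) ->
  exists R : nat -> set (car M (Prod Nat Nat)),
  [/\ forall m, internal (R m), forall m, R m.+1 `<=` R m &
      forall y y', monadic V y y' <-> forall m, R m (pr y y')].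
Proof.
move=> ib EV.
exists (fun m => [set z | exists y y', z = pr y y' /\ hlt (hdist y y') (hpow2 (b m))]); split.
- by move=> m; internal_tac.
- move=> m z [y [y' [-> h]]]; exists y, y'; split=> //; apply: hlt_le_trans h _.
  by apply: hpow2_le; apply: decreasing_le.
- move=> y y'; rewrite /monadic EV; split=> h m; first by exists y, y'; split=> //; apply: h.
  by move=> _; have [? [? [/pr_inj[-> ->]]]] := h m.
Qed.

Lemma monadic_cofinal_approx V b : increasing b -> V = \bigcup_n below (hpow2 (b n)) ->
  exists R : nat -> set (car M (Prod Nat Nat)),
  [/\ forall m, internal (R m), forall m, R m `<=` R m.+1 &
      forall y y', monadic V y y' <-> exists m, R m (pr y y')].
Proof.
move=> ib EV.
exists (fun m => [set z | exists y y', z = pr y y' /\ hlt (hdist y y') (hpow2 (b m))]); split.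
- by move=> m; internal_tac.
- move=> m z [y [y' [-> h]]]; exists y, y'; split=> //; apply: hlt_le_trans h _.
  by apply: hpow2_le; apply: increasing_le.
- move=> y y'; rewrite /monadic EV; split=> [[m _ h]|[m [? [? [/pr_inj[-> ->] h]]]]]; last by exists m.
  by exists m, y, y'.
Qed.

Definition diagonal : set (car M (Prod Nat Nat)) := [set z | exists y, z = pr y y].

Lemma diagonal_internal : internal diagonal.
Proof. by rewrite /diagonal; internal_tac. Qed.

Lemma diagonalP (y y' : N) : diagonal (pr y y') <-> y = y'.
Proof. by split=> [[? /pr_inj[-> ->]]|->]; [|exists y']. Qed.

End Scales.

Theorem theorem8p3 (M : universe) (U V : set (hyperN M))
    (addU : additive_cut U) (addV : additive_cut V)
    (cdU : countably_determined U) (cdV : countably_determined V)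
    (U_neq0 : U <> set0) (U_neqT : U <> setT)
    (V_neq0 : V <> set0) (V_neqT : V <> setT) :
  borel_le (eqN M) (monadic U) /\
  (* (i) *)
  ((countably_cofinal U /\ countably_cofinal V) \/
   (countably_coinitial U /\ countably_coinitial V) ->
   [/\ borel_le (monadic U) (monadic V) \/ borel_le (monadic V) (monadic U),
       borel_le (monadic U) (monadic V) <-> cd_le (monadic U) (monadic V),
       cd_le (monadic U) (monadic V) <-> cut_prec U V &
       slow U -> cd_le (monadic U) (monadic V)]) /\
  (* (ii) *)
  (countably_cofinal U -> countably_coinitial V ->
   [/\ ~ cd_le (monadic V) (monadic U),
       ~ borel_le (monadic U) (monadic V) &
       cd_le (monadic U) (monadic V) <-> slow U]) /\
  (* (iii); for the additive cut [0, 1) = {0} the relation is equality *)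
  (U <> [set hnat M 0] ->
   ~ borel_smooth (monadic U) /\
   (cd_smooth (monadic U) <-> countably_cofinal U /\ slow U)) /\
  (* (iv) *)
  (forall W : nat -> set (hyperN M),
     (forall n, countably_cofinal (W n) /\ fast (W n)) ->
     exists U' V' : set (hyperN M),
       [/\ countably_cofinal U' /\ fast U',
           countably_cofinal V' /\ fast V' &
           forall n, borel_lt (monadic U') (monadic (W n)) /\
                     borel_lt (monadic (W n)) (monadic V')]) /\
  (forall W : nat -> set (hyperN M),
     (forall n, countably_coinitial (W n) /\ fast (W n)) ->
     exists U' V' : set (hyperN M),
       [/\ countably_coinitial U' /\ fast U',
           countably_coinitial V' /\ fast V' &
           forall n, borel_lt (monadic U') (monadic (W n)) /\
                     borel_lt (monadic (W n)) (monadic V')]).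
Proof.
have V0 := additive_cut0 addV V_neq0.
split; first exact: eqN_monadic.
split.
  case=> [[cU cV]|[cU cV]].
    have [a ia EU] := cofinal_rep addU cU; have [b ib EV] := cofinal_rep addV cV.
    have prec_le : cut_prec U V -> borel_le (monadic U) (monadic V).
      by case=> [/cofinal_prec_borel_le|/coinitial_prec_borel_le].
    have le_prec : cd_le (monadic U) (monadic V) -> cut_prec U V.
      move=> [f cdf red]; left; exists a, b; split=> //.
      exact: (cofinal_neg ia ib EU EV cdf red).
    split.
    - have [h|h] := inc_prec_total a b; first by left; apply: cofinal_prec_borel_le; exists a, b.
      by right; apply: cofinal_prec_borel_le; exists b, a.
    - by split=> [/borel_le_cd//|/le_prec/prec_le].
    - by split=> [//|/prec_le/borel_le_cd].
    - by move=> sU; apply: borel_le_cd; apply: cofinal_prec_borel_le; apply: slow_cofinal_prec.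
  have [a ia EU] := coinitial_rep addU cU; have [b ib EV] := coinitial_rep addV cV.
  have prec_le : cut_prec U V -> borel_le (monadic U) (monadic V).
    by case=> [/cofinal_prec_borel_le|/coinitial_prec_borel_le].
  have le_prec : cd_le (monadic U) (monadic V) -> cut_prec U V.
    move=> [f cdf red]; right; exists a, b; split=> //.
    exact: (coinitial_neg ia ib EU EV cdf red).
  split.
  - have [h|h] := dec_prec_total a b; first by left; apply: coinitial_prec_borel_le; exists a, b.
    by right; apply: coinitial_prec_borel_le; exists b, a.
  - by split=> [/borel_le_cd//|/le_prec/prec_le].
  - by split=> [//|/prec_le/borel_le_cd].
  - by move=> sU; apply: borel_le_cd; apply: coinitial_prec_borel_le; apply: slow_coinitial_prec.
split.
  move=> cU cV; have [a ia EU] := cofinal_rep addU cU; have [b ib EV] := coinitial_rep addV cV.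
  have [RV [iRV dRV EFV]] := monadic_coinitial_approx ib EV.
  have [RU [iRU dRU EFU]] := monadic_cofinal_approx ia EU.
  split.
  - by move=> [f cdf]; apply: (coinitial_to_cofinal_neg ib EV iRU dRU EFU cdf).
  - by move=> [f bf]; apply: (cofinal_borel_neg ia EU iRV dRV EFV bf).
  - split=> [[f cdf red]|sU].
      apply: contrapT => nU.
      exact: (fast_neg ia (fast_cofinal_gaps ia EU nU) EU iRV dRV EFV cdf red).
    (* Distinct multiples of a number outside V lie in distinct classes of E_V. *)
    have [e Ee] := slow_cofinal_rep sU cU; have [d nd] := not_full V_neqT.
    apply: (slow_cofinal_cd_le Ee (d := d)); last exact: monadic_scale.
    by apply/hltP => h; apply: nd; have [cutV _] := addV; apply: cutV V0 _.
split.
  move=> U1; have [cU|cU] := cd_cut_cases addU cdU U_neq0 U_neqT U1.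
    have [a ia EU] := cofinal_rep addU cU.
    (* Equality is a constant sequence of internal relations: a decreasing intersection here, an
       increasing union in the coinitial case. *)
    have E : forall y y' : hyperN M, eqN M y y' <-> forall m : nat, @diagonal M (pr y y').
      by move=> y y'; rewrite /eqN; split=> [/diagonalP//|/(_ 0)/diagonalP].
    split.
      move=> [f bf].
      exact: (cofinal_borel_neg (R := fun _ => @diagonal M) ia EU
        (fun _ => diagonal_internal M) (fun _ _ => id) E bf).
    split=> [[f cdf red]|[_ sU]].
      split=> //; apply: contrapT => nU.
      exact: (fast_neg (R := fun _ => @diagonal M) ia (fast_cofinal_gaps ia EU nU) EU
        (fun _ => diagonal_internal M) (fun _ _ => id) E cdf red).
    have [e Ee] := slow_cofinal_rep sU cU.
    apply: (slow_cofinal_cd_le Ee (d := hnat M 1)); first by htransfer.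
    by rewrite /eqN; htransfer => y y'; rewrite !muln1.
  have [a ia EU] := coinitial_rep addU cU.
  have E : forall y y' : hyperN M, eqN M y y' <-> exists m : nat, @diagonal M (pr y y').
    by move=> y y'; rewrite /eqN; split=> [/diagonalP h|[_]/diagonalP//]; exists 0.
  have ncd : ~ cd_smooth (monadic U).
    move=> [f cdf].
    exact: (coinitial_to_cofinal_neg (R := fun _ => @diagonal M) ia EU
      (fun _ => diagonal_internal M) (fun _ _ => id) E cdf).
  split; first by move/borel_le_cd.
  by split=> [//|[cU' _]]; have := cofinal_not_coinitial cU' cU.
by split=> W; [apply: cofinal_fast_unbounded|apply: coinitial_fast_unbounded].
Qed.
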